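(* Let $r,s\in\mathbb N$, $r\ge 1$, $s\ge2$, and let $T=(\mathrm{Diff}^r_+(S^1))^s$ be the space of all step skew products over the Bernoulli shift on $s$ symbols with fiber $S^1$ whose fiber maps $f_1,\dots,f_s$ are orientation preserving $C^r$-diffeomorphisms of the circle. There is a residual set $R\subset T$ such that for any step skew product in $R$ the statistical attractor is Lyapunov stable and coincides with the Milnor attractor.
   Context: $\Sigma^s=\{1,\dots,s\}^{\mathbb Z}$ with distance $d(\omega,\tilde\omega)=2^{-m}$, $m=\min\{|n|:\omega_n\neq\tilde\omega_n\}$, and the $(1/s,\dots,1/s)$-Bernoulli probability measure $\mu_{\Sigma^s}$; $(\sigma\omega)_n=\omega_{n+1}$ is the Bernoulli shift. The step skew product with fiber $S^1$ and fiber maps $f_1,\dots,f_s$ is $F:X\to X$, $X=\Sigma^s\times S^1$, $F(\omega,p)=(\sigma\omega,f_{\omega_0}(p))$; it is identified with $(f_1,\dots,f_s)\in T$, and $T$ carries the $C^r$-topology. The metric on $X$ is the sum of the distances in the base and the fiber; $\mu_X$ is the product of $\mu_{\Sigma^s}$ and Lebesgue measure on $S^1$. A subset of a topological space is residual if it contains a countable intersection of open everywhere dense sets. The Milnor attractor $A_M(F)$ is the smallest closed subset of $X$ containing $\omega(x)$ for $\mu_X$-a.e. $x$. For $x\in X$ and $U\subset X$, let $Freq(x,U)=\limsup_{N\to\infty}\frac1N\#\{0\le n<N:F^n(x)\in U\}$; the statistical $\omega$-limit set $\omega_{stat}(x)$ is the set of $z\in X$ such that $Freq(x,U)>0$ for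 every neighborhood $U$ of $z$. The statistical attractor $A_{stat}(F)$ is the smallest closed subset of $X$ containing $\omega_{stat}(x)$ for $\mu_X$-a.e. $x$. An invariant or absorbing ($F(A)\subset A$) closed set $A\subset X$ is Lyapunov stable if for any neighborhood $U$ of $A$ there is a smaller neighborhood $V$ of $A$ such that positive semi-trajectories starting in $V$ never leave $U$. *)

(* Defs.v *)
From HB Require Import structures.
From mathcomp Require Import all_boot all_order all_algebra.
From mathcomp Require Import all_classical all_reals all_analysis.
From mathcomp Require Import measurable_realfun ring lra zify.
Set Implicit Arguments.
Unset Strict Implicit.
Unset Printing Implicit Defensive.
Import Order.TTheory GRing.Theory Num.Theory.
Import numFieldNormedType.Exports.
Local Open Scope classical_set_scope.
Local Open Scope ring_scope.

(* The arguments [R] (real numbers in which distances are measured) and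
   [hs : 2 <= s] do not occur in the body: they let the instances below depend
   on them ([hs] provides the point required by [measurableType]). *)
Definition shift_space (R : realType) (s : nat) (hs : (2 <= s)%N) : Type :=
  int -> 'I_s.

Section shift_space_metric.
Context (R : realType) (s : nat) (hs : (2 <= s)%N).
Local Notation Sigma := (shift_space R hs).
Implicit Types (w v : Sigma) (m : nat).

HB.instance Definition _ := gen_eqMixin Sigma.
HB.instance Definition _ := gen_choiceMixin Sigma.
HB.instance Definition _ := isPointed.Build Sigma (fun=> Ordinal (ltnW hs)).

Definition differ w v m : bool := (w m != v m) || (w (- m%:Z) != v (- m%:Z)).

Definition shift_dist w v : R :=
  if pselect (exists m, differ w v m) is left h then 2 ^- ex_minn h else 0.

Lemma differ_dist w v m : differ w v m -> 2 ^- m <= shift_dist w v.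
Proof.
move=> h; rewrite /shift_dist; case: pselect => [h'|]; last by case; exists m.
case: ex_minnP => k _ /(_ _ h) km.
by rewrite lef_pV2 ?posrE ?exprn_gt0// ler_weXn2l// ler1n.
Qed.

Lemma dist_lt w v m : (forall k, (k < m)%N -> ~~ differ w v k) ->
  shift_dist w v <= 2 ^- m.
Proof.
move=> h; rewrite /shift_dist; case: pselect => [h'|_]; last first.
  by rewrite invr_ge0 exprn_ge0.
case: ex_minnP => k hk _; rewrite lef_pV2 ?posrE ?exprn_gt0//.
by rewrite ler_weXn2l// ?ler1n// leqNgt; apply/negP => /h; rewrite hk.
Qed.

Lemma shift_dist_ge0 w v : 0 <= shift_dist w v.
Proof.
by rewrite /shift_dist; case: pselect => // h; rewrite invr_ge0 exprn_ge0.
Qed.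

Lemma shift_distxx w : shift_dist w w = 0.
Proof.
rewrite /shift_dist; case: pselect => // h; exfalso; case: h => m.
by rewrite /differ !eqxx.
Qed.

Lemma shift_dist_positivity w v : shift_dist w v = 0 -> w = v.
Proof.
move=> d0; apply/funext => n.
suff : ~~ differ w v `|n|%N.
  rewrite negb_or !negbK => /andP[/eqP h1 /eqP h2].
  by case: (intP n) h1 h2 => [//|k|k]; rewrite ?abszN.
apply/negP => /differ_dist; rewrite d0 leNgt; move/negP; apply.
by rewrite invr_gt0 exprn_gt0.
Qed.

Lemma differC w v : differ w v =1 differ v w.
Proof. by move=> m; rewrite /differ ![w _ == _]eq_sym. Qed.

Lemma shift_dist_sym w v : shift_dist w v = shift_dist v w.
Proof.
by rewrite /shift_dist (_ : differ w v = differ v w)//; apply/funext/differC.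
Qed.

Lemma shift_dist_triangle v w u :
  shift_dist w u <= shift_dist w v + shift_dist v u.
Proof.
rewrite {1}/shift_dist; case: pselect => [h|_]; last first.
  by rewrite addr_ge0 ?shift_dist_ge0.
case: ex_minnP => k wuk _.
have : differ w v k || differ v u k.
  apply: contraTT wuk; rewrite !negb_or !negbK.
  by move=> /andP[/andP[/eqP -> /eqP ->] /andP[/eqP -> /eqP ->]]; rewrite !eqxx.
case/orP => /differ_dist/le_trans; apply.
  by rewrite lerDl shift_dist_ge0.
by rewrite lerDr shift_dist_ge0.
Qed.

HB.instance Definition _ := isMetric.Build R Sigma
  shift_distxx shift_dist_positivity shift_dist_sym shift_dist_triangle.

Definition coordinate_sets : set (set Sigma) :=
  [set [set w : Sigma | w na.1 = na.2] | na in [set: int * 'I_s]].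

HB.instance Definition _ := @isMeasurable.Build (sigma_display coordinate_sets)
  Sigma <<s coordinate_sets >> (@sigma_algebra0 _ setT coordinate_sets)
  (@sigma_algebraC Sigma coordinate_sets)
  (@sigma_algebra_bigcup _ setT coordinate_sets).

End shift_space_metric.

(* The circle R/Z, each class being represented by its element in [0, 1). *)
Record circle (R : realType) := Circle {
  circle_val :> R ;
  circle_valP : 0 <= circle_val < 1 }.

Section circle.
Context (R : realType).
Local Notation S1 := (circle R).
Implicit Types (p q : S1) (x y : R).

HB.instance Definition _ := [isSub for @circle_val R].
HB.instance Definition _ := [Choice of S1 by <:].

Lemma frac_part_itv x : 0 <= x - (Num.floor x)%:~R < 1.
Proof. by have /andP[h1 h2] := floor_itv x; rewrite subr_ge0 h1 ltrBlDl -intrD1. Qed.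

Definition to_circle x : S1 := Circle (frac_part_itv x).

HB.instance Definition _ := isPointed.Build S1 (to_circle 0).

Definition circle_dist p q : R :=
  Num.min `|circle_val p - circle_val q| (1 - `|circle_val p - circle_val q|).

Lemma circle_distxx p : circle_dist p p = 0.
Proof. by rewrite /circle_dist subrr normr0 subr0 minEle ler01. Qed.

Lemma circle_dist_positivity p q : circle_dist p q = 0 -> p = q.
Proof.
move: p q => [p hp] [q hq]; rewrite /circle_dist /= => h.
apply/val_inj => /=; move: h; rewrite minEle; case: ifPn => _.
  by move/eqP; rewrite normr_eq0 subr_eq0 => /eqP.
by case: (ger0P (p - q)) => _ h; lra.
Qed.

Lemma circle_dist_sym p q : circle_dist p q = circle_dist q p.
Proof. by rewrite /circle_dist distrC. Qed.

Lemma circle_dist_triangle q p t :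
  circle_dist p t <= circle_dist p q + circle_dist q t.
Proof.
move: p q t => [p hp] [q hq] [t ht]; rewrite /circle_dist /= !minEle.
by case: (ger0P (p - q)) => ?; case: (ger0P (q - t)) => ?;
   case: (ger0P (p - t)) => ?; do 3 (case: ifPn => ?); lra.
Qed.

HB.instance Definition _ := isMetric.Build R S1
  circle_distxx circle_dist_positivity circle_dist_sym circle_dist_triangle.

HB.instance Definition _ := @isMeasurable.Build (sigma_display (@open S1))
  S1 <<s @open S1 >> (@sigma_algebra0 _ setT (@open S1))
  (@sigma_algebraC S1 (@open S1))
  (@sigma_algebra_bigcup _ setT (@open S1)).

Lemma to_circle_dist x y : mdist (to_circle x) (to_circle y) <= `|x - y|.
Proof.
rewrite /mdist /= /circle_dist /=.
have := frac_part_itv x; have := frac_part_itv y.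
set a := Num.floor x; set b := Num.floor y => hy hx.
have [->|ab] := eqVneq a b.
  by rewrite ge_min opprD addrACA opprK [- _ + _]addrC subrr addr0 lexx.
suff : 1 <= `|(a - b)%:~R : R|.
  rewrite intrB ge_min => h; apply/orP; right.
  by move: h; do !case: ger0P => ?; lra.
by rewrite -intr_norm -[1]/(1%:~R) ler_int -gtz0_ge1 normr_gt0 subr_eq0.
Qed.

Lemma continuous_to_circle : continuous to_circle.
Proof.
move=> x U /nbhs_ballP[e e0 eU]; apply/nbhs_ballP; exists e => // y xy.
apply: eU; rewrite ballEmdist /= (le_lt_trans (to_circle_dist _ _))//.
Qed.

End circle.

Section lebesgue01.
Context (R : realType).

Definition lebesgue01 : set (measurableTypeR R) -> \bar R :=
  mrestr (@lebesgue_measure R) (measurable_itv `[0, 1[).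

HB.instance Definition _ := Measure.copy lebesgue01
  (mrestr (@lebesgue_measure R) (measurable_itv `[0, 1[)).

Lemma lebesgue01_setT : lebesgue01 setT = 1%E.
Proof. by rewrite /lebesgue01 /mrestr setTI lebesgue_measure_itv /= lte01 sube0. Qed.

HB.instance Definition _ :=
  Measure_isProbability.Build _ _ _ lebesgue01 lebesgue01_setT.

Lemma measurable_to_circle :
  @measurable_fun _ _ (measurableTypeR R) (circle R) setT (@to_circle R).
Proof.
apply: (@measurability _ _ _ _ setT (@to_circle R) (@open (circle R))) => //.
move=> _ [U oU <-]; rewrite setTI; apply: open_measurable.
by apply: open_comp => // x _; exact: continuous_to_circle.
Qed.

Definition circle_lebesgue : probability (circle R) R :=
  distribution lebesgue01
    (@mfun_Sub _ _ (measurableTypeR R) _ _ (mem_set measurable_to_circle)).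

End lebesgue01.

(* The Bernoulli measure, characterised by [bernoulli_measure_cylinder], is
   constructed as the law of the base-[s] digits of a uniform point
   of [0, 1), the integers being enumerated by [pickle]. *)
Section bernoulli.
Context (R : realType) (s : nat) (hs : (2 <= s)%N).
Local Notation Sigma := (shift_space R hs).

Let s_gt0 : (0 < s)%N := ltnW hs.
Let sR_gt0 : 0 < s%:R :> R. Proof. by rewrite ltr0n. Qed.

Definition digit (x : R) (k : nat) : nat :=
  (Num.truncn (s%:R ^+ k.+1 * x) %% s)%N.

Definition digits (x : R) : Sigma :=
  fun n => Ordinal (ltn_pmod (Num.truncn (s%:R ^+ (pickle n).+1 * x)) s_gt0).

Lemma truncnM_divn (y : R) : 0 <= y ->
  (Num.truncn (s%:R * y) %/ s)%N = Num.truncn y.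
Proof.
move=> y0; set N := Num.truncn y.
have /andP[h1 h2] : N%:R <= y < N.+1%:R by exact: truncn_itv.
have h3 : (N * s <= Num.truncn (s%:R * y))%N.
  by rewrite truncn_ge_nat ?mulr_ge0 ?ler0n// natrM mulrC ler_pM2l.
have h4 : (Num.truncn (s%:R * y) < N.+1 * s)%N.
  by rewrite truncn_lt_nat ?mulr_ge0 ?ler0n// natrM mulrC ltr_pM2r.
by apply/eqP; rewrite eqn_leq leq_divRL// h3 -ltnS ltn_divLR// h4.
Qed.

Fixpoint horner_word (v : nat -> nat) n : nat :=
  if n is m.+1 then (horner_word v m * s + v m)%N else 0%N.

Lemma digits_horner (x : R) (v : nat -> nat) n : 0 <= x < 1 ->
  (forall k, (k < n)%N -> (v k < s)%N) ->
  (forall k, (k < n)%N -> digit x k = v k) <->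
  Num.truncn (s%:R ^+ n * x) = horner_word v n.
Proof.
move=> /andP[x0 x1]; elim: n => [|n ih] hv.
  split=> // _; rewrite expr0 mul1r /=; apply/eqP.
  by rewrite truncn_eq// x0.
have sx0 : 0 <= s%:R ^+ n * x by rewrite mulr_ge0 ?exprn_ge0.
have E := truncnM_divn sx0; rewrite mulrA -exprS in E.
have {}ih := ih (fun k kn => hv _ (ltnW kn)).
have vn := hv _ (ltnSn n).
split=> [h|h].
  rewrite (divn_eq (Num.truncn _) s) E /=.
  by rewrite (iffLR ih) ?[(_ %% _)%N](h n)// => k kn; apply: h; exact: ltnW.
have h1 : Num.truncn (s%:R ^+ n * x) = horner_word v n.
  by rewrite -E h /= divnMDl// divn_small// addn0.
move=> k; rewrite ltnS leq_eqVlt => /orP[/eqP->|]; last exact: (iffRL ih).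
by rewrite /digit h /= modnMDl modn_small.
Qed.

Lemma horner_word_lt v n : (forall k, (k < n)%N -> (v k < s)%N) ->
  (horner_word v n < s ^ n)%N.
Proof.
elim: n => // n ih hv /=.
have /ih h : forall k, (k < n)%N -> (v k < s)%N by move=> k /ltnW/hv.
rewrite expnSr (@leq_trans ((horner_word v n).+1 * s))//; last by rewrite leq_mul2r h orbT.
by rewrite mulSn [(s + _)%N]addnC ltn_add2l hv.
Qed.

Definition word_set n (v : nat -> nat) : set R :=
  [set x | 0 <= x < 1 /\ forall k, (k < n)%N -> digit x k = v k].

Lemma word_setE n v : (forall k, (k < n)%N -> (v k < s)%N) ->
  word_set n v = `[(horner_word v n)%:R / s%:R ^+ n,
                   (horner_word v n).+1%:R / s%:R ^+ n[%classic.
Proof.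
move=> hv; have sn0 : 0 < s%:R ^+ n :> R by rewrite exprn_gt0.
apply/seteqP; split=> x /=; rewrite in_itv /= ler_pdivrMr// ltr_pdivlMr//.
  move=> [x01 /(digits_horner x01 hv) <-]; rewrite [x * _]mulrC.
  by apply: truncn_itv; case/andP: x01 => ? _; rewrite mulr_ge0// ltW.
move=> /andP[h1 h2].
have x01 : 0 <= x < 1.
  rewrite -(pmulr_lge0 _ sn0) (le_trans _ h1)//= -(ltr_pM2r sn0) mul1r.
  by rewrite (lt_le_trans h2)// -natrX ler_nat horner_word_lt.
split => //; apply/(digits_horner x01 hv); apply: truncn_def.
by rewrite mulrC h1.
Qed.

Lemma lebesgue01_word_set n v : (forall k, (k < n)%N -> (v k < s)%N) ->
  measurable (word_set n v) /\ lebesgue01 (word_set n v) = (s%:R ^- n)%:E.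
Proof.
move=> hv; split; first by rewrite word_setE//.
rewrite /lebesgue01 /mrestr setIidl; last first.
  by move=> x [x01 _]; rewrite /= in_itv.
have sn0 : 0 < s%:R ^+ n :> R by rewrite exprn_gt0.
rewrite word_setE// lebesgue_measure_itv /= lte_fin ltr_pM2r ?invr_gt0//.
rewrite ltr_nat ltnSn EFinN -EFinB; congr EFin.
by rewrite -mulrBl -natrB ?subSnn ?mul1r.
Qed.

Lemma measurable_digits : 
  @measurable_fun _ _ (measurableTypeR R) Sigma setT digits.
Proof.
apply: (@measurability _ _ (measurableTypeR R) Sigma setT digits (@coordinate_sets R s hs)) => //.
move=> _ [_ [[n a] _ <-] <-]; rewrite setTI /=.
rewrite (_ : _ @^-1` _ = \bigcup_(N in [set N | (N %% s)%N = a])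
    ((fun x : R => s%:R ^+ (pickle n).+1 * x) @^-1`
      [set y | Num.truncn y = N])); last first.
  apply/seteqP; split=> x /=.
    by move=> [<-]; exists (Num.truncn (s%:R ^+ (pickle n).+1 * x)).
  by move=> [N /= Na xN]; apply/val_inj; rewrite /= xN.
set c : R := s%:R ^+ _; have c0 : 0 < c by rewrite exprn_gt0.
apply: bigcup_measurable => N _ /=.
rewrite (_ : _ @^-1` _ = `[N%:R / c, N.+1%:R / c[%classic `|`
    (if N == 0%N then `]-oo, 0[%classic else set0)).
  by apply: measurableU; [|case: ifP => _]; [exact: measurable_itv|
    exact: measurable_itv|exact: measurable0].
apply/seteqP; split=> x /=; rewrite in_itv /= ler_pdivrMr// ltr_pdivlMr//.
  move=> <-; have [x0|x0] := ltP x 0; last first.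
    by left; rewrite [x * c]mulrC truncn_itv// mulr_ge0// ltW.
  right; have -> : Num.truncn (c * x) = 0%N.
    by rewrite truncn_floor pmulr_rge0// leNgt x0.
  by rewrite eqxx /= in_itv.
rewrite [x * c]mulrC => -[/truncn_def//|]; case: eqP => [-> /=|//].
by rewrite in_itv /= truncn_floor pmulr_rge0// leNgt => ->.
Qed.

Definition bernoulli_measure : probability Sigma R := 
  distribution (@lebesgue01 R)
    (@mfun_Sub _ _ (measurableTypeR R) _ _ (mem_set measurable_digits)).

Definition agree_on (J : seq int) (a : int -> 'I_s) (i : nat) : pred 'I_s :=
  [pred b | all (fun n => (pickle n == i) ==> (b == a n)) J].

Lemma card_agree_on (J : seq int) (a : int -> 'I_s) M : uniq J ->
  (forall n, n \in J -> (pickle n < M)%N) ->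
  (#|family (fun i : 'I_M => agree_on J a i)| * s ^ size J = s ^ M)%N.
Proof.
move=> uJ JM; pose J' := [seq pickle n | n <- J].
have uJ' : uniq J' by rewrite map_inj_uniq//; exact: (pcan_inj pickleK).
rewrite card_family foldrE big_map big_enum /=.
rewrite (eq_bigr (fun i : 'I_M => if val i \in J' then 1%N else s)); last first.
  move=> i _; case: ifPn => [/mapP[n nJ iE]|iJ].
    rewrite -(card1 (a n)); apply: eq_card => b; rewrite !inE.
    apply/allP/eqP => [/(_ _ nJ)|-> m mJ]; first by rewrite iE eqxx => /eqP.
    by apply/implyP; rewrite iE => /eqP/(pcan_inj pickleK) ->.
  rewrite -[RHS]card_ord; apply: eq_card => b; rewrite !inE.
  apply/allP => n nJ; apply/implyP => /eqP ni; move/negP: iJ; case;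
  by rewrite -[val i]/(nat_of_ord i) -ni map_f.
rewrite -(big_mkord xpredT (fun i => if i \in J' then 1%N else s)).
have -> : (s ^ size J = \prod_(0 <= i < M) (if i \in J' then s else 1))%N.
  rewrite -big_mkcond -big_filter (perm_big J'); last first.
    apply: uniq_perm => //; first by rewrite filter_uniq// iota_uniq.
    move=> k; rewrite mem_filter mem_index_iota leq0n /=.
    by apply: andb_idr => /mapP[n nJ ->]; exact: JM.
  by rewrite big_const_seq count_predT size_map iter_muln_1.
rewrite -big_split /= (eq_bigr (fun=> s)); last by move=> i _; case: ifP; lia.
by rewrite prod_nat_const_nat subn0.
Qed.

Lemma bernoulli_measure_cylinder (J : seq int) (a : int -> 'I_s) : uniq J ->
  bernoulli_measure [set w : Sigma | forall n, n \in J -> w n = a n] =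
    (s%:R ^- size J)%:E.
Proof.
move=> uJ; rewrite /bernoulli_measure /= /distribution /pushforward.
pose M := (\max_(n <- J) pickle n).+1.
have JM n : n \in J -> (pickle n < M)%N.
  by move=> nJ; rewrite ltnS; exact: leq_bigmax_seq.
pose F (i : 'I_M) := agree_on J a i.
pose ext (v : {ffun 'I_M -> 'I_s}) (k : nat) : nat :=
  if insub k is Some i then v i else 0%N.
have ext_lt v k : (k < M)%N -> (ext v k < s)%N.
  by move=> kM; rewrite /ext insubT.
set C := _ @^-1` _.
have CE : C `&` `[0, 1[ = \bigcup_(v in [set` enum (family F)]) word_set M (ext v).
  apply/seteqP; split=> x /=.
    rewrite in_itv /= => -[xC x01].
    exists [ffun i : 'I_M => Ordinal (ltn_pmod (Num.truncn (s%:R ^+ i.+1 * x)) s_gt0)].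
      rewrite /= mem_enum; apply/familyP => i; rewrite inE ffunE; apply/allP => n nJ.
      by apply/implyP => /eqP <-; apply/eqP; exact: xC.
    split=> // k kM; rewrite /ext insubT /= ffunE //=.
  move=> [v]; rewrite /= mem_enum => /familyP vF [x01 xv]; split; last by rewrite in_itv.
  move=> n nJ; apply/val_inj => /=.
  have kM := JM n nJ; have := xv _ kM.
  rewrite /digit => ->; rewrite /ext insubT /=.
  have := vF (Ordinal kM); rewrite inE => /allP/(_ _ nJ).
  by rewrite /= eqxx /= => /eqP ->.
have mW v : measurable (word_set M (ext v)).
  exact: (lebesgue01_word_set (ext_lt v)).1.
have -> : lebesgue01 C = lebesgue01 (\bigcup_(v in [set` enum (family F)]) word_set M (ext v)).
  rewrite /lebesgue01 /mrestr -CE -setIA setIid //.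
rewrite measure_fin_bigcup/=; [|exact: finite_seq| |]; last 2 first.
- move=> u v _ _ [x [[_ xu] [_ xv]]]; apply/ffunP => i; apply/val_inj.
  by have := xu _ (ltn_ord i); rewrite xv// /ext valK /= => ->.
- by move=> v _; exact: mW.
rewrite -fsbig_seq ?enum_uniq//.
under eq_bigr do rewrite (lebesgue01_word_set (ext_lt _)).2.
rewrite sumEFin big_const_seq count_predT -cardE iter_addr_0; congr EFin.
have := congr1 (fun n => n%:R : R) (card_agree_on a uJ JM).
rewrite natrM !natrX => E.
have sn0 n : s%:R ^+ n != 0 :> R by rewrite expf_neq0// lt0r_neq0.
by apply: (mulIf (sn0 (size J))); rewrite mulVf// -[_ *+ #|_|]mulr_natr -mulrA E mulVf.
Qed.
End bernoulli.

Section compactness.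
Context (R : realType) (s : nat) (hs : (2 <= s)%N).
Local Notation Sigma := (shift_space R hs).
Local Notation X := (Sigma * circle R)%type.

Lemma compact_circle : compact [set: circle R].
Proof.
have -> : [set: circle R] = @to_circle R @` `[0, 1].
  apply/seteqP; split=> // p _; exists (circle_val p).
    by rewrite /= in_itv /=; case/andP: (circle_valP p) => -> /ltW.
  apply/val_inj => /=; have /andP[p0 p1] := circle_valP p.
  have -> : Num.floor (circle_val p) = 0; last by rewrite subr0.
  by apply: floor_def; rewrite p0 add0r.
apply: continuous_compact; last exact: segment_compact.
exact/continuous_subspaceT/continuous_to_circle.
Qed.

Lemma compact_shift_space : compact [set: Sigma].
Proof.
pose K := {ptws int -> discrete_topology 'I_s}.
have cK : compact [set: K].
  have := @tychonoff int (fun=> discrete_topology 'I_s) (fun=> setT)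
    (fun=> @finite_compact (discrete_topology 'I_s) setT
      (@finite_finset 'I_s setT)).
  by congr compact; apply/seteqP.
have -> : [set: Sigma] = (id : K -> Sigma) @` [set: K].
  by apply/seteqP; split=> // w _; exists w.
apply: continuous_compact cK; apply: continuous_subspaceT => w U.
move=> /nbhs_ballP[e /= e0 eU].
have [m me] : exists m, 2 ^- m < e :> R.
  have [m _ hm] := near_infty_natSinv_expn_lt (PosNum e0).
  by exists m; have := hm m (leqnn m); rewrite /= div1r.
have nw (n : int) : nbhs (w : K) [set v : K | v n = w n].
  apply: (@proj_continuous int (fun=> discrete_topology 'I_s) n w [set w n]).
  by rewrite nbhs_principalE; exact/principal_filterP.
have : nbhs (w : K) [set v : K | forall k, (k < m)%N ->
    v k%:Z = w k%:Z /\ v (- k%:Z) = w (- k%:Z)].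
  elim: m {me} => [|m ih]; first by apply: filterS filterT => v _ k.
  apply: filterS (filterI ih (filterI (nw m%:Z) (nw (- m%:Z)))).
  move=> v [h1 [h2 h3]] k; rewrite ltnS leq_eqVlt => /orP[/eqP ->//|].
  exact: h1.
apply: filterS => v hv; apply: eU; rewrite ballEmdist /=.
apply: le_lt_trans me; apply: dist_lt => k km.
have [h1 h2] := hv k km; rewrite /differ h1 h2.
by rewrite !eqxx.
Qed.

(* The product topology of the library is the topology of the sum metric. *)
Lemma nbhs_sum_metric (x : X) (U : set X) : nbhs x U <->
  exists2 e : R, 0 < e &
    forall y : X, mdist x.1 y.1 + mdist x.2 y.2 < e -> U y.
Proof.
split=> [/nbhs_ballP[e /= e0 eU]|[e e0 eU]].
  exists e => // y xy; apply: eU; split; rewrite ballEmdist /=.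
    by rewrite (le_lt_trans _ xy)// lerDl mdist_ge0.
  by rewrite (le_lt_trans _ xy)// lerDr mdist_ge0.
apply/nbhs_ballP; exists (e / 2) => /=; first by rewrite divr_gt0.
by move=> y []; rewrite !ballEmdist /= => h1 h2; apply: eU; rewrite (splitr e) ltrD.
Qed.

Lemma second_countable_phase_space : @second_countable X.
Proof.
pose Y : pseudoPMetricType R := HB.pack X (Pointed.on X) (PseudoMetric.on X).
apply: (@compact_second_countable R Y); rewrite -setXTT.
by apply: compact_setX; [exact: compact_shift_space|exact: compact_circle].
Qed.

End compactness.

Section circle_diffeomorphisms.
Context (R : realType).
Local Notation S1 := (circle R).
Implicit Types (f : S1 -> S1) (F : R -> R) (r : nat).

Definition is_Cr r F : Prop :=
  (forall k x, (k < r)%N -> derivable (derive1n k F) x 1) /\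
  continuous (derive1n r F).

Definition is_lift F f : Prop := forall x, f (to_circle x) = to_circle (F x).

(* The covering map [to_circle] identifies the C^r self-maps of the circle with
   the maps having a C^r lift to the line. *)
Definition circle_Cr r f : Prop := exists2 F, is_lift F f & is_Cr r F.

Definition circle_Cr_diffeo r f : Prop := exists g,
  [/\ cancel f g, cancel g f, circle_Cr r f & circle_Cr r g].

Definition orientation_preserving f : Prop := exists F,
  [/\ is_lift F f, continuous F & {homo F : x y / x < y}].

Record Diff r := MkDiff {
  diff_map :> S1 -> S1 ;
  diff_map_Cr : circle_Cr_diffeo r diff_map ;
  diff_map_orientation : orientation_preserving diff_map }.

End circle_diffeomorphisms.

Section Cr_topology.
Context (R : realType) (r : nat).
Local Notation Diff := (Diff R r).
Implicit Types f g h : Diff.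

HB.instance Definition _ := gen_eqMixin Diff.
HB.instance Definition _ := gen_choiceMixin Diff.

Lemma Cr_lift_exists f : exists F, is_lift F f /\ is_Cr r F.
Proof. by have [g [_ _ [F F1 F2] _]] := diff_map_Cr f; exists F. Qed.

Definition Cr_lift f : R -> R := sval (cid (Cr_lift_exists f)).

(* Two continuous lifts differ by a constant integer: the derivatives of
   positive order below do not depend on the chosen Cr_lift. *)
Definition Cr_ball f (e : R) g : Prop :=
  (forall p, mdist (f p) (g p) < e) /\
  (forall k x, (1 <= k <= r)%N ->
    `|derive1n k (Cr_lift f) x - derive1n k (Cr_lift g) x| < e).

Let Cr_ent : set_system (Diff * Diff) := entourage_ Cr_ball.

Let Cr_nbhs f : set_system Diff := nbhs_ Cr_ent f.

HB.instance Definition _ := hasNbhs.Build Diff Cr_nbhs.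

Lemma Cr_ball_center f (e : R) : 0 < e -> Cr_ball f e f.
Proof.
move=> e0; split=> [p|k x _]; first by rewrite mdistxx.
by rewrite subrr normr0.
Qed.

Lemma Cr_ball_sym f g (e : R) : Cr_ball f e g -> Cr_ball g e f.
Proof.
case=> h1 h2; split=> [p|k x kr]; first by rewrite metric_sym.
by rewrite distrC h2.
Qed.

Lemma Cr_ball_triangle f g h (e1 e2 : R) :
  Cr_ball f e1 g -> Cr_ball g e2 h -> Cr_ball f (e1 + e2) h.
Proof.
case=> f1 f2 [g1 g2]; split=> [p|k x kr].
  by apply: le_lt_trans (metric_triangle _ (g p) _) _; rewrite ltrD.
apply: le_lt_trans (ler_distD (derive1n k (Cr_lift g) x) _ _) _.
by rewrite ltrD ?f2 ?g2.
Qed.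

HB.instance Definition _ := @Nbhs_isPseudoMetric.Build R Diff
  Cr_ent erefl Cr_ball Cr_ball_center Cr_ball_sym Cr_ball_triangle erefl.

End Cr_topology.

Definition step_skew_products (R : realType) (r s : nat) :=
  {ptws 'I_s -> Diff R r}.

Section skew_products.
Context (R : realType) (r s : nat) (hs : (2 <= s)%N).
Local Notation Sigma := (shift_space R hs).
Local Notation X := (Sigma * circle R)%type.

Definition bernoulli_shift (w : Sigma) : Sigma := fun n => w (n + 1).

Definition skew_product (f : step_skew_products R r s) : X -> X :=
  fun x => (bernoulli_shift x.1, f (x.1 0) x.2).

End skew_products.
Arguments skew_product {R r s} hs f x.

Definition residual (T : topologicalType) (A : set T) : Prop :=
  exists2 O : nat -> set T, (forall n, open (O n) /\ dense (O n)) &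
    \bigcap_n O n `<=` A.

Definition omega_limit (T : topologicalType) (F : T -> T) (x : T) :
    set T :=
  cluster (iter n F x @[n --> \oo]).

Definition frequency (R : realType) (T : Type) (F : T -> T) (x : T)
    (U : set T) : \bar R :=
  limn_esup (fun N => (#|[pred n : 'I_N | `[< U (iter n F x) >]]|%:R / N%:R)%:E).

Definition omega_stat (R : realType) (T : topologicalType) (F : T -> T)
    (x : T) : set T :=
  [set z | forall U, nbhs z U -> (0 < frequency R F x U)%E].

Definition lyapunov_stable (T : topologicalType) (F : T -> T) (A : set T) :
    Prop :=
  [/\ closed A, F @` A `<=` A &
    forall U, set_nbhs A U -> exists V, [/\ set_nbhs A V, V `<=` U &
      forall x n, V x -> U (iter n F x)]].

Section attractors.
Context (R : realType) (s : nat) (hs : (2 <= s)%N).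
Local Notation X := (shift_space R hs * circle R)%type.

Definition mu_X : set X -> \bar R :=
  (bernoulli_measure R hs \x circle_lebesgue R)%E.

HB.instance Definition _ := Measure.copy mu_X
   (bernoulli_measure R hs \x circle_lebesgue R)%E.

Definition closed_ae_supsets (L : X -> set X) : set (set X) :=
  [set A | closed A /\ {ae mu_X, forall x, L x `<=` A}].

Definition smallest_closed_ae (L : X -> set X) : set X :=
  \bigcap_(A in closed_ae_supsets L) A.

(* The intersection is itself one of the sets intersected, because the phase
   space is second countable. *)
Lemma smallest_closed_aeP (L : X -> set X) :
  closed_ae_supsets L (smallest_closed_ae L) /\
  forall A, closed_ae_supsets L A -> smallest_closed_ae L `<=` A.
Proof.
split; last by move=> A LA; exact: bigcap_inf.
split; first by apply: closed_bigI => A [].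
have [B /countable_injP[code codeI] [oB bB]] := second_countable_phase_space R hs.
pose G U := exists2 A, closed_ae_supsets L A & U `&` A = set0.
have : {ae mu_X, forall x, forall n U, B U -> G U -> code U = n ->
    L x `&` U = set0}.
  apply: ae_foralln => n.
  have [[U [BU [A [_ LA] UA] Un]]|noU] :=
      pselect (exists U, [/\ B U, G U & code U = n]).
    apply: filterS LA => x LxA V BV _ Vn.
    have -> : V = U by apply: codeI; rewrite ?inE// Vn Un.
    apply/seteqP; split=> // z [/LxA Az Uz].
    by move/seteqP: UA => [+ _] => /(_ z); exact.
  by apply: nearW => x U BU GU Un; exfalso; apply: noU; exists U.
apply: filterS => x hx y Lxy A [cA LA].
apply: contrapT => nAy.
have [U [BU Uy] UA] := bB y (~` A) (open_nbhs_nbhs (conj (closed_openC cA) nAy)).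
have := hx (code U) U BU _ erefl.
suff GU : G U by move=> /(_ GU)/seteqP[+ _] => /(_ y); exact.
exists A => //; apply/seteqP; split=> // z [Uz Az]; exact: (UA z Uz).
Qed.

Definition milnor_attractor (F : X -> X) : set X :=
  smallest_closed_ae (omega_limit F).

Definition statistical_attractor (F : X -> X) : set X :=
  smallest_closed_ae (omega_stat R F).

End attractors.

(* Main.v *)
Require Import Defs.
From mathcomp Require Import all_boot all_order all_algebra.
From mathcomp Require Import all_classical all_reals all_analysis.
From mathcomp Require Import ring lra zify.
Set Implicit Arguments.
Unset Strict Implicit.
Unset Printing Implicit Defensive.
Import Order.TTheory GRing.Theory Num.Theory.
Import numFieldNormedType.Exports.
Local Open Scope classical_set_scope.
Local Open Scope ring_scope.

(* The skew product is the random iteration of the circle maps f_i, and its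
   attractors are determined by their projections to the fiber.
   Generically f_0 has a periodic point, its periodic points are hyperbolic,
   and f_1 moves the repelling ones away from each other: perturb f_0 by a
   bump to create a sign change of f_0^k - id - m, then by a rotation (Sard),
   then f_1 by a rotation.  Every orbit of the semigroup then enters one of
   finitely many traps, arcs contracted into themselves around a periodic
   attractor a.
   Generically also the orbit closure of a is Lyapunov stable: otherwise
   pseudo-orbits starting at a would leave it, and since rotating all the maps
   moves orbits monotonically, the intermediate value theorem turns such a
   pseudo-orbit into a genuine orbit of a rotated system that carries a whole
   arc around a outside the orbit closure; this is an open condition, hence it
   holds for the generic system itself, a contradiction.
   Let K be the union of the minimal ones among these orbit closures.  Almost
   every orbit falls into every neighbourhood of K, so the Milnor attractor
   lies in the intersection of the sets F^n(Sigma x K), which inherits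
   Lyapunov stability from K.  Conversely each neighbourhood of a point of this
   intersection is reached, from anywhere near a minimal orbit closure, by
   reading a suitable word of bounded length; such words almost surely occur
   with positive frequency, so the intersection lies in the statistical
   attractor. *)

(** * Differentiability classes *)

(** Adding a constant to a lift changes no derivative, so rotating by t is a C^r-perturbation of
    size |t| for every r; hence one and the same family serves for Sard's theorem and for closing
    pseudo-orbits, and large r costs nothing. A rotation acts at every step of an orbit, but always
    in the same direction, so that its effects cannot cancel. Stability of an orbit closure is not
    visibly an open condition, and the periodic point moves with the system; what is open is that a
    fixed arc is carried by some word into the interior of a fixed ball. Arcs and balls with
    rational data give countably many open sets E, and the generic system lies, for each of them, in
    E or in the exterior of E; in the second case the nearby rotated systems are outside E too. The
    attractor may be smaller than Sigma x K, since a point approached at arbitrarily late times has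
    arbitrarily long pasts near Sigma x K; the images under F^n record these pasts. *)

Section differentiability_classes.
Context (R : realType).
Implicit Types (f g h : R -> R) (n : nat) (x : R).

(** The recursion carries the derivative as a witness, so that closure under sums, products and
    composition is a plain induction; [is_CrP] identifies it with [is_Cr]. *)
Fixpoint Cn n f : Prop :=
  if n is m.+1 then
    exists2 df : R -> R, (forall x, is_derive x 1 f (df x)) & Cn m df
  else continuous f.

Lemma is_derive_continuous f (df : R -> R) :
  (forall x, is_derive x 1 f (df x)) -> continuous f.
Proof.
by move=> fdf x; apply/differentiable_continuous/derivable1_diffP/ex_derive.
Qed.

Lemma is_derive_derive1 f (df : R -> R) :
  (forall x, is_derive x 1 f (df x)) -> (derive1 f) = df.
Proof. by move=> fdf; apply/funext => x; rewrite derive1E; apply: derive_val. Qed.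

Lemma Cn_continuous n f : Cn n f -> continuous f.
Proof. by case: n => // n [df /is_derive_continuous]. Qed.

Lemma CnW n f : Cn n.+1 f -> Cn n f.
Proof.
elim: n f => [|n ih] f; first exact: Cn_continuous.
by move=> [df fdf /ih]; exists df.
Qed.

Lemma derive1nSr n f : derive1n n.+1 f = derive1n n (derive1 f).
Proof. by rewrite /derive1n iterSr. Qed.

Lemma is_CrP n f : is_Cr n f <-> Cn n f.
Proof.
elim: n f => [|n ih] f.
  by split=> [[]//|cf]; split.
split=> [[h1 h2]|[df fdf /ih [h1 h2]]].
  exists (derive1 f); first by move=> x; rewrite derive1E; apply: derivableP; exact: (h1 0%N).
  apply/ih; split; last by rewrite -derive1nSr.
  by move=> k x kn; rewrite -derive1nSr; exact: h1.
rewrite -(is_derive_derive1 fdf) in h1 h2.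
split; last by rewrite derive1nSr.
by case=> [|k] x kn; [exact: ex_derive|rewrite derive1nSr; exact: h1].
Qed.

Lemma Cn_is_derive n f x : (0 < n)%N -> Cn n f -> is_derive x 1 f (derive1 f x).
Proof. by case: n => // n _ [df fdf _]; rewrite (is_derive_derive1 fdf). Qed.

Lemma Cn_derive1_cont n f : (0 < n)%N -> Cn n f -> continuous (derive1 f).
Proof.
by case: n => // n _ [df fdf /Cn_continuous]; rewrite (is_derive_derive1 fdf).
Qed.

Lemma Cn_cst n (c : R) : Cn n (fun=> c).
Proof.
elim: n c => [|n ih] c; first exact: cst_continuous.
by exists (fun=> 0) => // x; exact: is_derive_cst.
Qed.

Lemma Cn_id n : Cn n (fun x => x).
Proof.
case: n => [|n]; first by move=> x; exact: cvg_id.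
by exists (fun=> 1); [move=> x; exact: is_derive_id|exact: Cn_cst].
Qed.

Lemma CnD n f g : Cn n f -> Cn n g -> Cn n (fun x => f x + g x).
Proof.
elim: n f g => [|n ih] f g; first by move=> cf cg x; apply: cvgD; [exact: cf|exact: cg].
move=> [df fdf cdf] [dg gdg cdg]; exists (fun x => df x + dg x); last exact: ih.
by move=> x; apply: is_deriveD.
Qed.

Lemma CnM n f g : Cn n f -> Cn n g -> Cn n (fun x => f x * g x).
Proof.
elim: n f g => [|n ih] f g; first by move=> cf cg x; apply: cvgM; [exact: cf|exact: cg].
move=> /[dup] cf [df fdf cdf] /[dup] cg [dg gdg cdg].
exists (fun x => f x * dg x + g x * df x).
  by move=> x; apply: is_deriveM.
by apply: CnD; apply: ih => //; exact: CnW.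
Qed.

Lemma CnV n f : (forall x, f x != 0) -> Cn n f -> Cn n (fun x => (f x)^-1).
Proof.
move=> f0; elim: n => [|n ih]; first by move=> cf x; apply: cvgV => //; exact: cf.
move=> /[dup] cf [df fdf cdf].
exists (fun x => - 1 * ((f x)^-1 * (f x)^-1) * df x).
  move=> x; have := realfun.is_deriveV (f0 x) (fdf x).
  by congr is_derive; rewrite /GRing.scale /= mulN1r -invfM -expr2.
apply: CnM => //; apply: CnM; first exact: Cn_cst.
by apply: CnM; apply: ih; exact: CnW.
Qed.

Lemma Cn_comp n f g : Cn n f -> Cn n g -> Cn n (fun x => f (g x)).
Proof.
elim: n f g => [|n ih] f g.
  by move=> cf cg x; apply: continuous_comp; [exact: cg|exact: cf].
move=> [df fdf cdf] /[dup] cg [dg gdg cdg]; exists (fun x => df (g x) * dg x).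
  by move=> x; apply: is_derive1_comp.
by apply: CnM => //; apply: ih => //; exact: CnW.
Qed.

Lemma Cn_cos_sin n : Cn n (@cos R) /\ Cn n (@sin R).
Proof.
elim: n => [|n [ih1 ih2]]; first by split; [exact: continuous_cos|exact: continuous_sin].
split; last by exists cos => // x; exact: is_derive_sin.
exists (fun x => -1 * sin x); first by move=> x; rewrite mulN1r; exact: is_derive_cos.
by apply: CnM => //; exact: Cn_cst.
Qed.

(** Bootstrapping: the derivative of [g] at y is the inverse of [df (g y)], which is as regular as
    [g] is already known to be, so each order gives the next. *)
Lemma Cn_inverse n f (df : R -> R) g : cancel f g -> cancel g f ->
  (forall x, is_derive x 1 f (df x)) -> (forall x, df x != 0) ->
  Cn n.+1 f -> Cn n.+1 g.
Proof.
move=> fK gK fdf df0.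
have gd (y : R) : is_derive y 1 g ((df (g y))^-1).
  rewrite -{1}(gK y); apply: is_derive_inverse => //.
    by near=> z; exact: fK.
  by near=> z; exact: (is_derive_continuous fdf).
elim: n => [|n ih].
  move=> [df' /is_derive_derive1 <-]; rewrite (is_derive_derive1 fdf) => cdf.
  exists (fun y => (df (g y))^-1) => // y; apply: cvgV => //.
  by apply: (@continuous_comp _ _ _ g df); [exact: (is_derive_continuous gd)|exact: cdf].
move=> /[dup] cf [df' /is_derive_derive1 <-]; rewrite (is_derive_derive1 fdf) => cdf.
have cg := ih (CnW cf).
exists (fun y => (df (g y))^-1); first exact: gd.
apply: (@CnV n.+1 (fun y => df (g y))) => //.
exact: (@Cn_comp n.+1 df g).
Unshelve. all: by end_near. Qed.

End differentiability_classes.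

(** * Lifts of circle maps *)

Section circle_lifts.
Context (R : realType).
Local Notation S1 := (circle R).
Implicit Types (p q : S1) (x y e : R) (F G H : R -> R).

Lemma to_circle_int x (m : int) : to_circle (x + m%:~R) = to_circle x.
Proof.
apply/val_inj => /=; rewrite floorDrz ?intr_int//.
by rewrite intrKfloor intrD opprD addrACA subrr addr0.
Qed.

Lemma to_circle_eq x y : to_circle x = to_circle y -> exists m : int, x = y + m%:~R.
Proof.
move=> /(congr1 (@circle_val R)) /= h; exists (Num.floor x - Num.floor y).
by rewrite intrB; lra.
Qed.

Lemma to_circle_val p : to_circle (circle_val p) = p.
Proof.
apply/val_inj => /=; have /andP[p0 p1] := circle_valP p.
have -> : Num.floor (circle_val p) = 0; last by rewrite subr0.
by apply: floor_def; rewrite p0 add0r.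
Qed.

Lemma mdist_circle_val p q e : mdist p q < e ->
  exists m : int, `|circle_val p - circle_val q - m%:~R| < e.
Proof.
rewrite /mdist /= /circle_dist gt_min => /orP[h|]; first by exists 0; rewrite subr0.
have := circle_valP p; have := circle_valP q.
case: (ger0P (circle_val p - circle_val q)) => pq hq hp h.
  by exists 1; rewrite mulr1z ltr_norml; apply/andP; split; lra.
by exists (-1); rewrite mulrN1z ltr_norml; apply/andP; split; lra.
Qed.

Lemma mdist_lift x q e : mdist (to_circle x) q < e ->
  exists2 y, to_circle y = q & `|x - y| < e.
Proof.
move=> /mdist_circle_val[m /= h].
exists (circle_val q + (m + Num.floor x)%:~R); first by rewrite to_circle_int to_circle_val.
by move: h; congr (`| _ | < _); rewrite intrD; lra.
Qed.

Lemma mdist_to_circle x y e : mdist (to_circle x) (to_circle y) < e ->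
  exists m : int, `|x - y - m%:~R| < e.
Proof.
move=> /mdist_lift[z /to_circle_eq[m ->] h]; exists m.
by rewrite -addrA -opprD.
Qed.

(** A non-constant [H] would take, between two integer values, the smaller one plus 1/2. *)
Lemma int_valued_cst H : continuous H -> (forall x, exists m : int, H x = m%:~R) ->
  exists m : int, forall x, H x = m%:~R.
Proof.
move=> cH hH; have [m m0] := hH 0; exists m => x.
have [n nx] := hH x; rewrite nx; apply/eqP; rewrite eqr_int; apply/negPn/negP => nm.
have aux (a b : R) (i j : int) : a <= b -> H a = i%:~R -> H b = j%:~R -> i = j.
  move=> ab Ha Hb; apply/eqP/negPn/negP => ij.
  have := @IVT R H a b ((Num.min i j)%:~R + 2^-1) ab (continuous_subspaceT cH).
  rewrite Ha Hb => -[|c _ Hc].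
    have [lij|lji] := ltP i j.
      rewrite (minElt i%:~R) (maxElt i%:~R) ltr_int lij.
      have : (i + 1)%:~R <= j%:~R :> R by rewrite ler_int; lia.
      by rewrite intrD => h; apply/andP; split; lra.
    have lji' : (j < i)%R by lia.
    rewrite (minElt i%:~R) (maxElt i%:~R) ltr_int ltNge (ltW lji') /=.
    have : (j + 1)%:~R <= i%:~R :> R by rewrite ler_int; lia.
    by rewrite intrD => h; apply/andP; split; lra.
  have [k Hk] := hH c.
  move: Hc; rewrite Hk; set l := Num.min i j => Hc.
  have k1 : l%:~R < k%:~R :> R by lra.
  have k2 : k%:~R < (l + 1)%:~R :> R by rewrite intrD; lra.
  by rewrite !ltr_int in k1 k2; lia.
have [x0|x0] := leP 0 x.
  by have := aux _ _ _ _ x0 m0 nx; move/eqP; rewrite eq_sym (negbTE nm).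
by have := aux _ _ _ _ (ltW x0) nx m0; move/eqP; rewrite (negbTE nm).
Qed.

Lemma lifts_eq F G f : is_lift F f -> is_lift G f -> continuous F -> continuous G ->
  exists m : int, forall x, F x = G x + m%:~R.
Proof.
move=> Ff Gf cF cG; have [|x|m h] := @int_valued_cst (fun x => F x - G x).
- by move=> x; apply: cvgB; [exact: cF|exact: cG].
- have [|m ->] := @to_circle_eq (F x) (G x); first by rewrite -Ff -Gf.
  by exists m; rewrite addrAC subrr add0r.
- by exists m => x; have := h x; lra.
Qed.

Record deg1 F : Prop := Deg1 {
  deg1_lt : {homo F : x y / x < y} ;
  deg1_1 : forall x, F (x + 1) = F x + 1 }.

Lemma deg1_le F : deg1 F -> {homo F : x y / x <= y}.
Proof. by move=> [dF _] x y; rewrite le_eqVlt => /orP[/eqP->//|/dF/ltW]. Qed.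

Lemma deg1_int F : deg1 F -> forall x (m : int), F (x + m%:~R) = F x + m%:~R.
Proof.
move=> [_ F1].
have Fn x (n : nat) : F (x + n%:R) = F x + n%:R.
  by elim: n => [|n ih]; rewrite ?addr0// -!natr1 !addrA F1 ih.
move=> x [n|n]; first exact: Fn.
by rewrite NegzE mulrNz -[in RHS](subrK (n.+1%:R) x) [in RHS]Fn addrK.
Qed.

Lemma deg1D F c : deg1 F -> deg1 (fun x => F x + c).
Proof.
move=> [F1 F2]; split=> [x y /F1|x]; first by rewrite ltrD2r.
by rewrite F2 addrAC.
Qed.

End circle_lifts.

Section lifts_of_diffeomorphisms.
Context (R : realType).
Local Notation S1 := (circle R).

(** The integer [F (x + 1) - F x] does not depend on [x]. If it were at least 2, the value [F 0 + 1]
    would be attained strictly inside the unit interval, against injectivity of [f]. *)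
Lemma orientation_lift_deg1 (F : R -> R) (f : S1 -> S1) : injective f ->
  is_lift F f -> continuous F -> {homo F : x y / x < y} -> deg1 F.
Proof.
move=> fI Ff cF hF.
have [d dF] : exists d : int, forall x, F (x + 1) - F x = d%:~R.
  apply: int_valued_cst => [x|x].
    apply: cvgB; last exact: cF.
    apply: continuous_comp; last exact: cF.
    by apply: cvgD; [exact: cvg_id|exact: cvg_cst].
  have [|m ->] := @to_circle_eq R (F (x + 1)) (F x); last by exists m; lra.
  by rewrite -!Ff (to_circle_int x 1).
have d0 : 0 < d%:~R :> R by rewrite -(dF 0) subr_gt0 hF// add0r.
rewrite ltr0z in d0.
split => // x; suff -> : F (x + 1) = F x + (F (x + 1) - F x).
  rewrite dF; suff -> : d = 1 by [].
  have d1 : 1 <= d%:~R :> R by rewrite -[1]/(1%:~R) ler_int; lia.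
  have [|y y01 Fy] := @IVT R F 0 1 (F 0 + 1) ler01 (continuous_subspaceT cF).
    have := dF 0; rewrite add0r => h; rewrite (minElt (F 0)) (maxElt (F 0)) hF//.
    by apply/andP; split; lra.
  have [|m ym] := @to_circle_eq R y 0.
    by apply: fI; rewrite !Ff Fy (to_circle_int _ 1).
  move: y01; rewrite in_itv /= ym add0r => /andP[m0 m1].
  rewrite ler0z -[1]/(1%:~R) ler_int in m0 m1.
  have [m0'|m1'] : m = 0 \/ m = 1 by lia.
    by move: Fy; rewrite ym m0' mulr0z addr0 => /esym/eqP; rewrite -subr_eq0 addrAC subrr add0r oner_eq0.
  apply/eqP; rewrite -(eqr_int R) -(dF 0) -[X in F (_ + X)]/(1%:~R) -m1' -ym.
  by rewrite Fy addrAC subrr add0r m1'.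
by rewrite addrCA subrr addr0.
Qed.

Variable r : nat.
Hypothesis r1 : (1 <= r)%N.
Implicit Types (f g h : Diff R r) (x y e : R).

Lemma Cr_liftP f : is_lift (Cr_lift f) f /\ Cn r (Cr_lift f).
Proof. by rewrite /Cr_lift; case: cid => F /= [Ff /is_CrP]. Qed.

Lemma diff_inj f : injective f.
Proof. by have [g [fg _ _ _]] := diff_map_Cr f; exact: can_inj fg. Qed.

Lemma Cr_lift_cont f : continuous (Cr_lift f).
Proof. exact: Cn_continuous (Cr_liftP f).2. Qed.
Arguments Cr_lift_cont : clear implicits.

Lemma Cr_lift_deg1 f : deg1 (Cr_lift f).
Proof.
have [Ff _] := Cr_liftP f; have [G [Gf cG hG]] := diff_map_orientation f.
have [F1 F2] := orientation_lift_deg1 (@diff_inj f) Gf cG hG.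
have [m hm] := lifts_eq Ff Gf (Cr_lift_cont f) cG.
rewrite (_ : Cr_lift f = fun x => G x + m%:~R); first by apply: deg1D.
exact/funext.
Qed.

Lemma Cr_lift_derive f x : is_derive x 1 (Cr_lift f) (derive1 (Cr_lift f) x).
Proof. exact: Cn_is_derive (Cr_liftP f).2. Qed.

Lemma Cr_lift_derive_cont f : continuous (derive1 (Cr_lift f)).
Proof. exact: Cn_derive1_cont (Cr_liftP f).2. Qed.

Arguments Cr_lift_derive_cont : clear implicits.

(** Monotonicity gives only a nonnegative derivative. It does not vanish because the inverse
    diffeomorphism has a differentiable lift [K] and [K \o Cr_lift f] is a translation, so that two
    derivatives have product 1. *)
Lemma Cr_lift_derive_gt0 f x : 0 < derive1 (Cr_lift f) x.
Proof.
rewrite lt_neqAle; apply/andP; split; last first.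
  apply: (@incr_derive1_ge0 _ _ setT).
  - by move=> y _; have := Cr_lift_derive f y => /@ex_derive.
  - by move=> y z _ _ /(deg1_lt (Cr_lift_deg1 f)).
  - exact: filterT.
have [g [fg gf _ [K Kg /is_CrP cK]]] := diff_map_Cr f.
have [Ff _] := Cr_liftP f.
have cK' := Cn_continuous cK.
have [m hm] : exists m : int, forall x, K (Cr_lift f x) = x + m%:~R.
  apply: (@lifts_eq _ _ id (g \o f)).
  - by move=> y; rewrite /= Ff Kg.
  - by move=> y; rewrite /= fg.
  - by move=> y; apply: continuous_comp; [exact: Cr_lift_cont|exact: cK'].
  - by move=> y; exact: cvg_id.
have hK x := @Cn_is_derive _ _ _ x r1 cK.
have h1 := is_derive1_comp (hK (Cr_lift f x)) (Cr_lift_derive f x).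
have h2 : is_derive x 1 (fun x : R => x + m%:~R) (1 + 0) by apply: is_deriveD.
have E : K \o Cr_lift f = (fun x : R => x + m%:~R) by apply/funext => y /=; rewrite hm.
rewrite E in h1; have := @derive_val _ _ _ _ _ _ _ h1; rewrite (@derive_val _ _ _ _ _ _ _ h2).
by move=> h; apply/eqP => h0; move: h; rewrite -h0 mulr0 addr0 => /eqP; rewrite oner_eq0.
Qed.

Lemma deg1_surj F : continuous F -> deg1 F -> forall y : R, exists x : R, F x = y.
Proof.
move=> cF dF y.
pose m := Num.floor (y - F 0).
have /andP[m1 m2] := floor_itv (y - F 0); rewrite -/m intrD in m1 m2.
have e1 := deg1_int dF 0 m; have e2 := deg1_int dF 0 (m + 1).
have [||x _ Fx] := @IVT R F (0 + m%:~R) (0 + (m + 1)%:~R) y _ (continuous_subspaceT cF).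
- by rewrite !add0r ler_int; lia.
- by rewrite e1 e2 (minElt (F 0 + _)) (maxElt (F 0 + _)) ltrD2l ltr_int ltrDl ltr01 intrD; apply/andP; split; lra.
by exists x.
Qed.

Lemma Diff_of_lift (H dH : R -> R) : Cn r H -> deg1 H ->
  (forall x, is_derive x 1 H (dH x)) -> (forall x, 0 < dH x) ->
  exists h : Diff R r, is_lift H h.
Proof.
move=> cH dg hdH dH0.
have cH0 := Cn_continuous cH.
pose K y := sval (cid (deg1_surj cH0 dg y)).
have KH y : H (K y) = y by rewrite /K; case: cid.
have HI : injective H.
  move=> x y Hxy; have [xy|yx|//] := ltgtP x y.
    by have := deg1_lt dg xy; rewrite Hxy ltxx.
  by have := deg1_lt dg yx; rewrite Hxy ltxx.
have HK x : K (H x) = x by apply: HI; rewrite KH.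
have lift_of (F : R -> R) : (forall x (m : int), F (x + m%:~R) = F x + m%:~R) ->
    is_lift F (fun p => to_circle (F (circle_val p))).
  by move=> dF x /=; rewrite -mulrNz dF to_circle_int.
have Hh := lift_of H (deg1_int dg).
have Kint x (m : int) : K (x + m%:~R) = K x + m%:~R.
  by apply: HI; rewrite KH (deg1_int dg) KH.
have Kh := lift_of K Kint.
set h := (fun p => _) in Hh; set k := (fun p => _) in Kh.
have hk : cancel h k by move=> p; rewrite -[p]to_circle_val Hh Kh HK.
have kh : cancel k h by move=> p; rewrite -[p]to_circle_val Kh Hh KH.
have cK : Cn r K.
  case: r r1 cH => // n _ cH; apply: (@Cn_inverse _ n H dH) => //.
  by move=> x; rewrite lt0r_neq0.
have h1 : circle_Cr_diffeo r h.
  by exists k; split=> //; [exists H|exists K] => //; apply/is_CrP.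
have h2 : orientation_preserving h by exists H; split=> //; exact: deg1_lt dg.
by exists (MkDiff h1 h2).
Qed.

Lemma Cr_ball_of_lift f h H e : is_lift H h -> Cn r H ->
  (forall x, `|Cr_lift f x - H x| < e) ->
  (forall k x, (1 <= k <= r)%N ->
    `|derive1n k (Cr_lift f) x - derive1n k H x| < e) ->
  Cr_ball f e h.
Proof.
move=> Hh cH h1 h2.
have [Lh _] := Cr_liftP h; have [Lf _] := Cr_liftP f.
split=> [p|k x kr].
  rewrite -(to_circle_val p) Hh Lf.
  exact: le_lt_trans (to_circle_dist _ _) (h1 _).
suff -> : derive1n k (Cr_lift h) = derive1n k H by exact: h2.
have [m hm] := lifts_eq Lh Hh (Cr_lift_cont h) (Cn_continuous cH).
case: k kr => // k kr; rewrite !derive1nSr; congr derive1n.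
have hdH y := @Cn_is_derive _ _ _ y r1 cH.
apply: is_derive_derive1 => y.
rewrite (_ : Cr_lift h = (fun x => H x + m%:~R)); last exact/funext.
by rewrite -[derive1 H y]addr0; apply: is_deriveD.
Qed.

(** The first derivatives differ by less than [e]. This bound and [Cr_ball_lifts] supply the two
    hypotheses of [trap_open]. *)
Lemma Cr_ball_lipschitz f g e x y : Cr_ball f e g ->
  `|(Cr_lift g x - Cr_lift f x) - (Cr_lift g y - Cr_lift f y)| <= e * `|x - y|.
Proof.
move=> [_ h].
pose D x := Cr_lift g x - Cr_lift f x; pose dD x := derive1 (Cr_lift g) x - derive1 (Cr_lift f) x.
have hD (z : R) : is_derive z 1 D (dD z).
  by apply: is_deriveB; exact: Cr_lift_derive.
have cD := is_derive_continuous hD.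
have dDe z : `|dD z| <= e by rewrite distrC ltW//; apply: (h 1%N); rewrite r1.
have aux (a b : R) : a <= b -> `|D b - D a| <= e * `|b - a|.
  move=> ab; have [c _ ->] := @MVT_segment R D dD a b ab (fun z _ => hD z) (continuous_subspaceT cD).
  by rewrite normrM ler_wpM2r.
by have [/aux|/ltW/aux//] := leP x y; rewrite distrC [`|y - x|]distrC.
Qed.

(** Closeness on the circle gives an integer at each point, a priori varying with it. It is fixed at
    0, and the Lipschitz bound over a unit interval, which costs the second [e], carries it to every
    other point. *)
Lemma Cr_ball_lifts f g e : Cr_ball f e g ->
  exists m : int, forall x, `|Cr_lift g x - Cr_lift f x - m%:~R| < 2 * e.
Proof.
move=> fg.
have [m hm] : exists m : int, `|Cr_lift g 0 - Cr_lift f 0 - m%:~R| < e.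
  apply: mdist_to_circle; rewrite -(Cr_liftP g).1 -(Cr_liftP f).1.
  by rewrite metric_sym; exact: fg.1.
exists m => x.
have e0 : 0 < e := le_lt_trans (normr_ge0 _) hm.
pose y := x - (Num.floor x)%:~R.
have -> : Cr_lift g x - Cr_lift f x = Cr_lift g y - Cr_lift f y.
  have -> : x = y + (Num.floor x)%:~R by rewrite /y subrK.
  by rewrite !(deg1_int (Cr_lift_deg1 _)); lra.
have y01 := frac_part_itv x; rewrite -/y in y01.
have := Cr_ball_lipschitz y 0 fg; rewrite subr0 => h.
have h' : e * `|y| <= e.
  rewrite -[leRHS]mulr1 ler_wpM2l ?(ltW e0)// ger0_norm; by case/andP: y01 => // ? /ltW.
rewrite (_ : _ - m%:~R = ((Cr_lift g y - Cr_lift f y) - (Cr_lift g 0 - Cr_lift f 0)) + (Cr_lift g 0 - Cr_lift f 0 - m%:~R)); last by lra.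
rewrite (le_lt_trans (ler_normD _ _))// mulr_natl mulr2n ler_ltD//.
exact: le_trans h h'.
Qed.

End lifts_of_diffeomorphisms.

Arguments Cr_lift_cont {R r}.
Arguments Cr_lift_derive_cont {R r}.

(** * Words and rotations *)

Section words.
Context (I T : Type) (f : I -> T -> T).

Definition act (w : seq I) (x : T) : T := foldl (fun y i => f i y) x w.

Lemma act_cat u v x : act (u ++ v) x = act v (act u x).
Proof. by rewrite /act foldl_cat. Qed.

Lemma act_nseq n i x : act (nseq n i) x = iter n (f i) x.
Proof. by elim: n x => // n ih x; rewrite /= ih -iterSr. Qed.

Lemma act_invariant (V : set T) : (forall i x, V x -> V (f i x)) ->
  forall w x, V x -> V (act w x).
Proof. by move=> fV; elim=> //= i w ih x Vx; exact/ih/fV. Qed.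

End words.

Section rotated_words.
Context (R : realType) (I : Type) (F : I -> R -> R).
Hypothesis F1 : forall i, deg1 (F i).

Definition rotate (F : I -> R -> R) (t : R) : I -> R -> R := fun i x => F i x + t.

Lemma deg1_act w : deg1 (act F w).
Proof.
elim: w => [|i w [ih1 ih2]]; first by split.
by split=> /= [x y xy|x]; [exact/ih1/deg1_lt|rewrite deg1_1// ih2].
Qed.

Lemma rotate_deg1 t i : deg1 (rotate F t i). Proof. exact: deg1D. Qed.

Hypothesis Fc : forall i, continuous (F i).

Lemma act_rotate_continuous w (g : R -> R) : continuous g ->
  continuous (fun t => act (rotate F t) w (g t)).
Proof.
elim: w g => [|i w ih] g cg //=; apply: ih => t; rewrite /rotate.
apply: cvgD; last exact: cvg_id.
by apply: continuous_comp; [exact: cg|exact: Fc].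
Qed.

Lemma act_rotate_le w t t' x y : t <= t' -> x <= y ->
  act (rotate F t) w x <= act (rotate F t') w y.
Proof.
move=> tt; elim: w x y => //= i w ih x y xy; apply: ih.
by rewrite lerD//; exact: deg1_le.
Qed.

Lemma act_rotate0 w x : act (rotate F 0) w x = act F w x.
Proof. by elim: w x => //= i w ih x; rewrite ih /rotate addr0. Qed.

(** The last letter already contributes [t]; by monotonicity the rotations of the preceding letters
    push the same way, so nothing is lost. *)
Lemma act_rotate_ge w t x : 0 <= t -> (0 < size w)%N ->
  act F w x + t <= act (rotate F t) w x.
Proof.
elim/last_ind: w => // w i _ t0 _; rewrite -cats1 !act_cat /= lerD2r.
by apply: deg1_le => //; rewrite -act_rotate0; exact: act_rotate_le.
Qed.

Lemma act_rotate_leN w t x : t <= 0 -> (0 < size w)%N ->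
  act (rotate F t) w x <= act F w x + t.
Proof.
elim/last_ind: w => // w i _ t0 _; rewrite -cats1 !act_cat /= lerD2r.
by apply: deg1_le => //; rewrite -act_rotate0; exact: act_rotate_le.
Qed.

Lemma act_rotate_lipschitz C t w x y : 0 <= C ->
  (forall i x y, `|F i x - F i y| <= C * `|x - y|) ->
  `|act (rotate F t) w x - act (rotate F t) w y| <= C ^+ size w * `|x - y|.
Proof.
move=> C0 FC; elim: w x y => [|i w ih] x y /=; first by rewrite expr0 mul1r.
rewrite (le_trans (ih _ _))// exprSr -mulrA ler_wpM2l ?exprn_ge0//.
by rewrite /rotate opprD addrACA subrr addr0.
Qed.

Lemma iter_contraction (G : R -> R) k b c l (M : int) : deg1 G -> 0 <= l ->
  (forall x, b <= x <= c -> b + M%:~R <= iter k G x <= c + M%:~R) ->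
  (forall x y, b <= x <= c -> b <= y <= c ->
    `|iter k G x - iter k G y| <= l * `|x - y|) ->
  forall n x y, b <= x <= c -> b <= y <= c ->
    `|iter (k * n) G x - iter (k * n) G y| <= l ^+ n * `|x - y|.
Proof.
move=> dG l0 GM Gl; elim=> [|n ih] x y xb yb; first by rewrite muln0 expr0 mul1r.
have GnM j (m : int) z : iter j G (z + m%:~R) = iter j G z + m%:~R.
  by elim: j => //= j ->; rewrite deg1_int.
rewrite mulnSr !iterD.
rewrite -[iter k G x](subrK M%:~R) -[iter k G y](subrK M%:~R) !GnM.
rewrite opprD addrACA subrr addr0 exprSr -mulrA.
have [/GM hx /GM hy] := (xb, yb).
apply: le_trans (ih _ _ _ _) _; [lra|lra|].
by rewrite ler_wpM2l ?exprn_ge0// opprD addrACA subrr addr0 Gl.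
Qed.

(* Rotating all the maps by [t] moves the end point of an orbit monotonically
   and continuously, by at least [t]: the error [`|act F u a - x0| <= t0] made
   by the pseudo-orbit is corrected by the intermediate value theorem.  The
   initial block of [i]'s contracts [b, c], uniformly in the rotation. *)
Lemma rotation_connecting (i : I) (C t0 l b c a x0 rho : R) k (M : int) u w :
  0 <= C -> (forall i x y, `|F i x - F i y| <= C * `|x - y|) ->
  0 <= t0 -> 0 <= l < 1 -> (0 < k)%N ->
  (forall t, `|t| <= t0 -> exists M : int,
    (forall x, b <= x <= c -> b + M%:~R <= iter k (rotate F t i) x <= c + M%:~R) /\
    (forall x y, b <= x <= c -> b <= y <= c ->
      `|iter k (rotate F t i) x - iter k (rotate F t i) y| <= l * `|x - y|)) ->
  b <= a <= c -> iter k (F i) a = a + M%:~R ->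
  `|act F u a - x0| <= t0 -> 0 < rho ->
  exists t z, `|t| <= t0 /\
    forall x, b <= x <= c ->
      exists m : int, `|act (rotate F t) z x - act F w x0 - m%:~R| < rho.
Proof.
move=> C0 FC t00 /andP[l0 l1] k0 H ab aM ux0 rho0.
(* [l ^+ n * D] bounds the length of the image of the arc after n contracting returns followed by
   [u ++ w]; n is chosen to make it smaller than [rho] for all rotations at once. *)
pose D := C ^+ size (u ++ w) * (c - b).
have bc : b <= c by case/andP: ab => /le_trans h /h.
have D0 : 0 <= D by rewrite mulr_ge0 ?exprn_ge0 ?subr_ge0.
have [n n0 lD] : exists2 n, (0 < n)%N & l ^+ n * D < rho.
  have : (fun n => l ^+ n * D) @ \oo --> 0 * D.
    apply: cvgM; last exact: cvg_cst.
    by apply: cvg_expr; rewrite ger0_norm.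
  rewrite mul0r => /cvgr0_norm_lt /(_ _ rho0) [n _ hn].
  exists n.+1 => //; apply: le_lt_trans (hn n.+1 _); first exact: ler_norm.
  by rewrite /= leqnSn.
pose z0 := nseq (k * n) i ++ u; pose z := z0 ++ w.
have z0_gt0 : (0 < size z0)%N by rewrite size_cat size_nseq addn_gt0 muln_gt0 k0 n0.
have aMn : act F (nseq (k * n) i) a = a + (M *+ n)%:~R.
  rewrite act_nseq; elim: (n) => [|j ih]; first by rewrite muln0 mulr0n addr0.
  have GnM j' (m : int) y : iter j' (F i) (y + m%:~R) = iter j' (F i) y + m%:~R.
    by elim: j' => //= j' ->; rewrite deg1_int.
  by rewrite mulnSr iterD aM GnM ih mulrSr intrD addrA.
pose Mn := M *+ n.
pose h t := act (rotate F t) z a.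
have ch : continuous h by apply: act_rotate_continuous => t; exact: cvg_cst.
pose v := act F w x0 + Mn%:~R.
have vE : v = act F w (x0 + Mn%:~R) by rewrite (deg1_int (deg1_act w)).
have z0E : act F z0 a = act F u a + Mn%:~R.
  by rewrite act_cat aMn (deg1_int (deg1_act u)).
move: ux0; rewrite ler_norml => /andP[ux0 ux0'].
have h1 : h (- t0) <= v.
  rewrite vE /h act_cat -(act_rotate0 w); apply: act_rotate_le; first by lra.
  apply: le_trans (act_rotate_leN _ _ _) _ => //; first by lra.
  by rewrite z0E; lra.
have h2 : v <= h t0.
  rewrite vE /h act_cat -(act_rotate0 w); apply: act_rotate_le; first by lra.
  apply: le_trans (act_rotate_ge _ _ _) => //.
  by rewrite z0E; lra.
have [||t] := @IVT R h (- t0) t0 v _ (continuous_subspaceT ch); first by lra.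
  by rewrite ge_min h1 le_max h2 orbT.
rewrite in_itv /= -ler_norml => tt0 hv.
exists t, z; split => // x xb; exists Mn.
have [M' [HM Hl]] := H t tt0.
rewrite -addrA -opprD -/v -hv /h /z /z0 -catA !act_cat -!act_cat.
rewrite !(act_cat _ (nseq _ _)) !act_nseq.
apply: le_lt_trans (act_rotate_lipschitz _ _ _ _ C0 FC) _.
apply: le_lt_trans lD; rewrite mulrCA ler_wpM2l ?exprn_ge0//.
apply: le_trans (iter_contraction _ l0 HM Hl n xb ab) _; first exact: rotate_deg1.
rewrite ler_wpM2l ?exprn_ge0// ler_norml; apply/andP; split; lra.
Qed.

End rotated_words.

(** * Traps *)

Section traps.
Context (R : realType).
Implicit Types (F G : R -> R) (b c l : nat -> R).

(* A cycle of arcs [b j, c j] of the circle, each mapped by [F] into the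
   interior of the next one up to an integer translation, and contracted over
   the whole cycle; the Lipschitz constants [l j] are not affected by
   rotations. *)
Record trap F k b c l : Prop := Trap {
  trap_k : (0 < k)%N ;
  trap_map : forall j, (j < k)%N ->
    exists m : int, b j.+1 + m%:~R < F (b j) /\ F (c j) < c j.+1 + m%:~R ;
  trap_lip : forall j x y, (j < k)%N -> b j <= x <= c j -> b j <= y <= c j ->
    `|F x - F y| <= l j * `|x - y| ;
  trap_close : exists m : int, b 0 + m%:~R <= b k /\ c k <= c 0 + m%:~R ;
  trap_bc : b 0 < c 0 ;
  trap_l : (forall j, 0 <= l j) /\ \prod_(j < k) l j < 1 }.

Lemma trap_iter F k b c l : deg1 F -> trap F k b c l ->
  exists M : int,
    (forall x, b 0 <= x <= c 0 -> b 0 + M%:~R < iter k F x < c 0 + M%:~R) /\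
    (forall x y, b 0 <= x <= c 0 -> b 0 <= y <= c 0 ->
      `|iter k F x - iter k F y| <= \prod_(j < k) l j * `|x - y|).
Proof.
move=> dF [k0 Fm Fl [m0 [bk ck]] bc [l0 l1]].
(* Strict inclusion is claimed for positive j only: at j = 0 the point may be an end of the arc. *)
have : forall j, (j <= k)%N -> exists M : int,
    (forall x, b 0 <= x <= c 0 ->
      b j + M%:~R <= iter j F x <= c j + M%:~R /\
      ((0 < j)%N -> b j + M%:~R < iter j F x < c j + M%:~R)) /\
    (forall x y, b 0 <= x <= c 0 -> b 0 <= y <= c 0 ->
      `|iter j F x - iter j F y| <= \prod_(i < j) l i * `|x - y|).
  elim=> [_|j ih jk].
    exists 0; split=> [x|x y _ _]; first by rewrite !addr0.
    by rewrite big_ord0 mul1r.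
  have [M [hM hl]] := ih (ltnW jk); have [m [m1 m2]] := Fm j jk.
  exists (m + M).
  have H x : b 0 <= x <= c 0 ->
      b j.+1 + (m + M)%:~R < iter j.+1 F x < c j.+1 + (m + M)%:~R.
    move=> /hM[/andP[h1 h2] _] /=.
    have := deg1_le dF h1; have := deg1_le dF h2; rewrite !deg1_int// intrD.
    by move=> ? ?; apply/andP; split; lra.
  split=> [x /H /[dup] h /andP[/ltW h1 /ltW h2]|x y xb yb]; first by rewrite h1 h2.
  have [/hM[hx _] /hM[hy _]] := (xb, yb); rewrite big_ord_recr /= [_ * l j]mulrC -mulrA.
  apply: le_trans (ler_wpM2l (l0 j) (hl _ _ xb yb)).
  rewrite -[iter j F x](subrK M%:~R) -[iter j F y](subrK M%:~R) !(deg1_int dF).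
  have E (u v w : R) : u + w - (v + w) = u - v by lra.
  rewrite (E (F _) (F _)) (E (_ - _) (_ - _)).
  by apply: Fl => //; lra.
move=> /(_ k (leqnn k))[M [hM hl]]; exists (m0 + M).
split=> // x /hM[_ /(_ k0)/andP[h1 h2]]; rewrite intrD.
by apply/andP; split; lra.
Qed.

Lemma iter_continuous F n : continuous F -> continuous (iter n F).
Proof.
move=> cF; elim: n => [|n ih] x; first exact: cvg_id.
by apply: continuous_comp; [exact: ih|exact: cF].
Qed.

Lemma trap_fixpoint F k b c l : deg1 F -> continuous F -> trap F k b c l ->
  exists a (M : int), b 0 < a < c 0 /\ iter k F a = a + M%:~R.
Proof.
move=> dF cF tF; have [M [hM _]] := trap_iter dF tF.
have bc := trap_bc tF.
have [/andP[h1 _] /andP[_ h2]] := (hM (b 0) ltac:(lra), hM (c 0) ltac:(lra)).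
have ch : continuous (fun x => x - iter k F x).
  by move=> x; apply: cvgB; [exact: cvg_id|exact: iter_continuous].
have [||a] := @IVT R (fun x => x - iter k F x) (b 0) (c 0) (- M%:~R) _ (continuous_subspaceT ch).
- exact: ltW.
- by rewrite ge_min le_max; apply/andP; split; apply/orP; [left|right]; lra.
rewrite in_itv /= => /hM/andP[a1 a2] aE; exists a, M; split; first by lra.
by lra.
Qed.

Lemma prod_near (l : nat -> R) k : \prod_(j < k) l j < 1 ->
  \forall e \near 0^'+, \prod_(j < k) (l j + e) < 1.
Proof.
move=> l1; suff cl : (fun e => \prod_(j < k) (l j + e)) @ (0 : R) --> \prod_(j < k) (l j + 0).
  have /cl : nbhs (\prod_(j < k) (l j + 0)) [set y | y < 1].
    by apply: open_nbhs_nbhs; split; [exact: open_lt|under eq_bigr do rewrite addr0].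
  by move=> h; apply: (@filterS _ (nbhs (0 : R)) _ _ _ _ h) => e he _.
elim: k {l1} => [|k ih].
  by rewrite big_ord0; under eq_fun do rewrite big_ord0; exact: cvg_cst.
rewrite big_ord_recr /=; under eq_fun do rewrite big_ord_recr /=.
by apply: cvgM => //; apply: cvgD; [exact: cvg_cst|exact: cvg_id].
Qed.

(** The conditions at the ends of the arcs are finitely many strict inequalities, which leave room
    for a displacement of 2e; each Lipschitz constant grows by [e], which keeps the product below 1.
    The common integer m is absorbed by the translations of the trap. *)
Lemma trap_open F k b c l : deg1 F -> trap F k b c l ->
  \forall e \near 0^'+, forall G,
    (exists m : int, forall x, `|G x - F x - m%:~R| < 2 * e) ->
    (forall x y, `|(G x - F x) - (G y - F y)| <= e * `|x - y|) ->
    trap G k b c (fun j => l j + e).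
Proof.
move=> dF [k0 Fm Fl bck bc [l0 l1]].
have : \forall e \near 0^'+, forall j : 'I_k, exists m : int,
    b j.+1 + m%:~R + 2 * e < F (b j) /\ F (c j) < c j.+1 + m%:~R - 2 * e.
  apply: filter_forall => j; have [m [h1 h2]] := Fm j (ltn_ord j).
  have d0 : 0 < Num.min (F (b j) - (b j.+1 + m%:~R)) (c j.+1 + m%:~R - F (c j)) / 2.
    by rewrite divr_gt0// lt_min; apply/andP; split; lra.
  near=> e; exists m.
  have : e < Num.min (F (b j) - (b j.+1 + m%:~R)) (c j.+1 + m%:~R - F (c j)) / 2.
    by near: e; exact: nbhs_right_lt.
  by rewrite ltr_pdivlMr// lt_min => /andP[? ?]; split; lra.
have := prod_near l1; apply: filterS3 (nbhs_right_gt 0) => e e0 hprod hm G [n Gn] GF.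
split=> //.
- move=> j jk; have [m [h1 h2]] := hm (Ordinal jk); exists (m + n); rewrite intrD.
  have := Gn (b j); have := Gn (c j); rewrite !ltr_norml => /andP[? ?] /andP[? ?].
  by split; rewrite /= in h1 h2; lra.
- move=> j x y jk xb yb; have := Fl j x y jk xb yb; have := GF x y => h3 h4.
  rewrite mulrDl (_ : G x - G y = (F x - F y) + ((G x - F x) - (G y - F y))); last by lra.
  by rewrite (le_trans (ler_normD _ _))// lerD.
- by split=> // j; rewrite addr_ge0// ltW.
Unshelve. all: by end_near. Qed.

End traps.

(** * Hyperbolicity of generic rotations *)

Section uniform_derivatives.
Context (R : realType).
Implicit Types (F dF : R -> R) (x y z t : R).

(** Strict differentiability with one [d] for all base points [z]. Both [x] and [y] move, because
    contraction on an arc compares two arbitrary points of it. *)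
Definition uniformly_derivable F dF := forall e, 0 < e -> exists2 d, 0 < d &
  forall x y z, `|x - z| < d -> `|y - z| < d ->
    `|F x - F y - dF z * (x - y)| <= e * `|x - y|.

Lemma mean_value F dF x y : (forall x, is_derive x 1 F (dF x)) ->
  exists c, Num.min x y <= c <= Num.max x y /\ F x - F y = dF c * (x - y).
Proof.
move=> hF; have cF := is_derive_continuous hF.
have [xy|/ltW yx] := leP x y.
  have [c cxy h] := @MVT_segment R F dF x y xy (fun z _ => hF z) (continuous_subspaceT cF).
  by exists c; split; [move: cxy; rewrite in_itv|lra].
have [c cxy h] := @MVT_segment R F dF y x yx (fun z _ => hF z) (continuous_subspaceT cF).
by exists c; split=> //; move: cxy; rewrite in_itv.
Qed.

Lemma periodic_int (h : R -> R) : (forall x, h (x + 1) = h x) ->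
  forall x (m : int), h (x + m%:~R) = h x.
Proof.
move=> h1; have hn x (n : nat) : h (x + n%:R) = h x.
  by elim: n => [|n ih]; rewrite ?addr0// -natr1 addrA h1.
move=> x [n|n]; first exact: hn.
by rewrite NegzE mulrNz -[in RHS](subrK (n.+1%:R) x) [in RHS]hn.
Qed.

Lemma periodic_deriv F dF : deg1 F -> (forall x, is_derive x 1 F (dF x)) ->
  forall x, dF (x + 1) = dF x.
Proof.
move=> dgF hF x.
have h1 : is_derive x 1 (fun y => F (y + 1)) (dF (x + 1) * (1 + 0)).
  by apply: (@is_derive1_comp _ F (fun y => y + 1)) => //; apply: is_deriveD.
have h2 : is_derive x 1 (fun y => F y + 1) (dF x + 0) by apply: is_deriveD.
have E : (fun y => F (y + 1)) = (fun y => F y + 1) by apply/funext => y; exact: deg1_1.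
rewrite E in h1; have := @derive_val _ _ _ _ _ _ _ h1; rewrite (@derive_val _ _ _ _ _ _ _ h2).
by lra.
Qed.

Lemma periodic_bounded (h : R -> R) : continuous h -> (forall x, h (x + 1) = h x) ->
  exists2 C, 0 < C & forall x, `|h x| <= C.
Proof.
move=> ch h1.
have cn : continuous (fun x => `|h x|).
  by move=> x; apply: continuous_comp; [exact: ch|exact: norm_continuous].
have [c _ hc] := EVT_max (@ler01 R) (continuous_subspaceT cn).
exists (`|h c| + 1) => [|x]; first by rewrite ltr_wpDl.
rewrite -(subrK (Num.floor x)%:~R x) (periodic_int h1).
rewrite (@le_trans _ _ `|h c|) ?lerDl//; apply: hc.
by rewrite in_itv /=; have /andP[-> /ltW] := frac_part_itv x.
Qed.

(** By the mean value theorem the difference quotient is a value of [dF] near [z]; compactness of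
    [0, 1] makes the continuity of [dF] uniform, and periodicity transports it. *)
Lemma deg1_uniformly_derivable F dF : deg1 F -> (forall x, is_derive x 1 F (dF x)) ->
  continuous dF -> uniformly_derivable F dF.
Proof.
move=> dgF hF cdF e e0; have dF1 := periodic_deriv dgF hF.
pose P d z := forall x y, `|x - z| < d -> `|y - z| < d ->
    `|F x - F y - dF z * (x - y)| <= e * `|x - y|.
have : \forall d \near 0^'+, `[0 : R, 1] `<=` P d.
  apply: (compact_near_coveringP `[0 : R, 1]).1; first exact: segment_compact.
  move=> z0 _.
  have /cvgrPdist_lt/(_ (e / 2)) := cdF z0; rewrite divr_gt0// => /(_ isT)/nbhs_ballP[d /= d0 hd].
  exists (ball z0 (d / 2), [set d' | d' < d / 2]) => /=.
    split; first by apply: nbhsx_ballx; rewrite divr_gt0.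
    by apply: nbhs_right_lt; rewrite divr_gt0.
  move=> [z d'] /= [zz0 d'd] x y xz yz.
  rewrite /ball /= in zz0.
  have [c [/andP[c1 c2] ->]] := mean_value x y hF.
  rewrite -mulrBl normrM ler_wpM2r//.
  have cz0 : `|z0 - c| < d.
    move: zz0 xz yz c1 c2; rewrite !ltr_norml ge_min le_max.
    move=> /andP[? ?] /andP[? ?] /andP[? ?] /orP[?|?] /orP[?|?]; apply/andP; split; lra.
  have zz0' : `|z0 - z| < d by rewrite (lt_trans zz0)//; lra.
  have := hd c cz0; have := hd z zz0'; rewrite /= !ltr_norml ler_norml.
  by move=> /andP[? ?] /andP[? ?]; apply/andP; split; lra.
move=> hP; have [d [/= d0 hd]] := filter_ex (filterI (nbhs_right_gt 0) hP).
exists d => // x y z xz yz; pose m := (Num.floor z)%:~R : R.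
have Fm u : F u = F (u - m) + m by rewrite -(deg1_int dgF) subrK.
have E (u v : R) : u - m - (v - m) = u - v by lra.
have := hd (z - m) _ (x - m) (y - m).
rewrite !E (Fm x) (Fm y) -(periodic_int dF1 (z - m) (Num.floor z)) subrK.
rewrite (_ : F (x - m) + m - (F (y - m) + m) = F (x - m) - F (y - m)); last by lra.
by apply=> //; rewrite /= in_itv /=; have /andP[-> /ltW] := frac_part_itv z.
Qed.

Section rotated_iterates.
Variables (F dF : R -> R) (C : R).
Hypotheses (dgF : deg1 F) (FdF : uniformly_derivable F dF).
Hypotheses (C1 : 1 <= C) (dFC : forall x, `|dF x| <= C).
Hypothesis (FC : forall x y, `|F x - F y| <= C * `|x - y|).

Local Notation Frot t := (fun x => F x + t).

(** The derivative at [x] of the k-th iterate of the rotated map, by the chain rule; rotating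
    changes only the orbit along which [dF] is evaluated. *)
Definition multiplier t k x := \prod_(j < k) dF (iter j (Frot t) x).

Lemma iter_lipschitz t k x y :
  `|iter k (Frot t) x - iter k (Frot t) y| <= C ^+ k * `|x - y|.
Proof.
elim: k => [|k ih] /=; first by rewrite expr0 mul1r.
rewrite opprD addrACA subrr addr0 (le_trans (FC _ _))// exprS -mulrA.
by rewrite ler_wpM2l// (le_trans ler01).
Qed.

(** Chain rule by induction on [k]. That [d] serves all [t] is essential: [nondegenerate_rotation]
    chooses its parameters after [d]. *)
Lemma iter_uniformly_derivable k e : 0 < e -> exists2 d, 0 < d &
  forall t x y z, `|x - z| < d -> `|y - z| < d ->
    `|iter k (Frot t) x - iter k (Frot t) y - multiplier t k z * (x - y)| <= e * `|x - y|.
Proof.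
have C0 : 0 < C by rewrite (lt_le_trans ltr01).
elim: k e => [|k ih] e e0.
  exists 1 => // t x y z _ _; rewrite /multiplier big_ord0 mul1r subrr normr0.
  by rewrite mulr_ge0// ltW.
have [d1 d10 h1] : exists2 d, 0 < d & forall x y z, `|x - z| < d -> `|y - z| < d ->
    `|F x - F y - dF z * (x - y)| <= (e / (2 * C ^+ k)) * `|x - y|.
  by apply: FdF; rewrite divr_gt0// mulr_gt0// exprn_gt0.
have [|d2 d20 h2] := ih (e / (2 * C)); first by rewrite divr_gt0// mulr_gt0.
exists (Num.min (d1 / C ^+ k) d2); first by rewrite lt_min d20 andbT divr_gt0// exprn_gt0.
move=> t x y z; rewrite !lt_min => /andP[xz1 xz2] /andP[yz1 yz2].
have near1 u : `|u - z| < d1 / C ^+ k -> `|iter k (Frot t) u - iter k (Frot t) z| < d1.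
  move=> uz; apply: le_lt_trans (iter_lipschitz _ _ _ _) _.
  by rewrite mulrC -ltr_pdivlMr// exprn_gt0.
have := h1 _ _ _ (near1 _ xz1) (near1 _ yz1); have := h2 t x y z xz2 yz2.
rewrite /multiplier big_ord_recr /=.
set Px := iter k _ x; set Py := iter k _ y; set Pz := iter k _ z; set D := \prod_(i < k) _.
move=> h3 h4.
rewrite (_ : _ - _ - _ = (F Px - F Py - dF Pz * (Px - Py)) + dF Pz * (Px - Py - D * (x - y))); last by ring.
apply: le_trans (ler_normD _ _) _; rewrite [in leRHS](splitr e) mulrDl; apply: lerD.
  apply: le_trans h4 _; have := iter_lipschitz t k x y; rewrite -/Px -/Py => h5.
  apply: le_trans (ler_wpM2l _ h5) _; first by rewrite ltW// divr_gt0// mulr_gt0// exprn_gt0.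
  rewrite mulrA ler_wpM2r// le_eqVlt; apply/orP; left; apply/eqP.
  by field; rewrite expf_neq0// lt0r_neq0.
rewrite normrM; apply: le_trans (ler_pM _ _ (dFC _) h3) _ => //.
rewrite mulrA ler_wpM2r// le_eqVlt; apply/orP; left; apply/eqP.
by field; rewrite lt0r_neq0.
Qed.

Lemma iter_rotate_le t t' k x y : t <= t' -> x <= y -> iter k (Frot t) x <= iter k (Frot t') y.
Proof.
by move=> tt xy; elim: k => //= k ih; rewrite lerD//; exact: deg1_le.
Qed.

Lemma iter_rotate_ge t t' k x : t <= t' -> (0 < k)%N ->
  iter k (Frot t) x + (t' - t) <= iter k (Frot t') x.
Proof.
case: k => // k tt _ /=; have := iter_rotate_le k tt (lexx x).
by move=> /(deg1_le dgF) ?; lra.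
Qed.

Lemma iter_rotate_int t k x (m : int) :
  iter k (Frot t) (x + m%:~R) = iter k (Frot t) x + m%:~R.
Proof. by elim: k => //= k ->; rewrite (deg1_int dgF) addrAC. Qed.

Lemma multiplier_int t k x (m : int) : (forall x, dF (x + 1) = dF x) ->
  multiplier t k (x + m%:~R) = multiplier t k x.
Proof.
move=> dF1; apply: eq_bigr => j _; rewrite iter_rotate_int.
exact: periodic_int.
Qed.

(* Sard's theorem for [t], which is a C^1 function of the fixed point [x] of
   [iter k (Frot t) - m]: two degenerate fixed points at distance at most 1/N
   have parameters [t] at distance at most e/N. *)
Lemma nondegenerate_rotation k (m : int) a b : (forall x, dF (x + 1) = dF x) ->
  (0 < k)%N -> a < b -> exists t, a < t < b /\ forall x, iter k (Frot t) x = x + m%:~R -> multiplier t k x != 1.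
Proof.
move=> dF1 k0 ab; apply: contrapT => nex.
have crit t : a < t < b -> exists x, [/\ 0 <= x < 1, iter k (Frot t) x = x + m%:~R & multiplier t k x = 1].
  move=> tab; apply: contrapT => nx; apply: nex; exists t; split=> // x xm.
  apply/eqP => x1; apply: nx; exists (x - (Num.floor x)%:~R); split.
  - exact: frac_part_itv.
  - by rewrite -mulrNz iter_rotate_int xm addrAC.
  - by rewrite -mulrNz multiplier_int.
(* The 4 ensures (b - a) / (4N) < (b - a) / (N + 2) for every N >= 1, the final contradiction. *)
pose e := (b - a) / 4; have e0 : 0 < e by rewrite divr_gt0// subr_gt0.
have [d d0 hd] := iter_uniformly_derivable k e0.
have [N N0 Nd] : exists2 N : nat, (0 < N)%N & N%:R^-1 < d.
  by exists (Num.truncn d^-1).+1 => //; rewrite invf_plt ?posrE// truncnS_gt.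
have NR0 : 0 < N%:R :> R by rewrite ltr0n.
(* N + 1 equally spaced parameters strictly inside (a, b), against N cells of length 1/N for their
   degenerate fixed points: two of these points share a cell. *)
pose t (j : 'I_N.+1) : R := a + (b - a) * (j.+1%:R / (N%:R + 2)).
have tab j : a < t j < b.
  have j1 : 0 < j.+1%:R / (N%:R + 2) :> R by rewrite divr_gt0// ?ltr0n// addr_gt0.
  have j2 : j.+1%:R / (N%:R + 2) < 1 :> R.
    rewrite ltr_pdivrMr ?addr_gt0// mul1r -natrD ltr_nat; have := ltn_ord j; lia.
  have ba : 0 < b - a by rewrite subr_gt0.
  rewrite /t ltrDl mulr_gt0//= -ltrBrDl -[ltRHS]mulr1.
  by rewrite ltr_pM2l.
have {}crit j := cid (crit _ (tab j)).
pose x j := sval (crit j).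
have xP j : [/\ 0 <= x j < 1, iter k (Frot (t j)) (x j) = x j + m%:~R & multiplier (t j) k (x j) = 1].
  by rewrite /x; case: (crit j).
have piece_lt j : (Num.truncn (N%:R * x j) < N)%N.
  have [/andP[x0 x1] _ _] := xP j.
  by rewrite truncn_lt_nat ?mulr_ge0// -[ltRHS]mulr1 ltr_pM2l.
pose p j := Ordinal (piece_lt j).
have : ~~ injectiveb p.
  apply/negP => /injectiveP pI; have := leq_card p pI.
  by rewrite !card_ord ltnn.
move=> /injectivePn[i [j ij /(congr1 val) /= pij]].
wlog lij : i j ij pij / (i < j)%N => [hw|].
  by have [h|h|/val_inj h] := ltngtP i j; [exact: hw h| |by rewrite h eqxx in ij];
    apply: (hw j i) => //; rewrite eq_sym.
have [/andP[xi0 xi1] xim xi] := xP i; have [/andP[xj0 xj1] xjm xj] := xP j.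
have xij : `|x j - x i| < N%:R^-1.
  have /andP[h1 h2] := truncn_itv (mulr_ge0 (ltW NR0) xi0).
  have /andP[h3 h4] := truncn_itv (mulr_ge0 (ltW NR0) xj0).
  rewrite -pij in h3 h4; rewrite -natr1 in h2 h4.
  rewrite -[ltRHS]mul1r ltr_pdivlMr// -[X in _ * X](ger0_norm (ltW NR0)) -normrM.
  by rewrite ltr_norml; apply/andP; split; rewrite mulrBl ![_ * N%:R]mulrC; lra.
(* At parameter [t i] the iterate minus the identity has derivative 0 at [x i], so it displaces
   [x j] by m up to e/N. Passing to [t j] moves the image forward by at least [t j - t i], although
   [x j] is then displaced by exactly m. *)
have := hd (t i) (x j) (x i) (x i) (lt_trans xij Nd) _.
rewrite subrr normr0 => /(_ d0); rewrite xi mul1r xim.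
have tij : t j - t i = (b - a) * ((j - i)%N%:R / (N%:R + 2)).
  by rewrite /t natrB 1?ltnW// -!natr1; field; rewrite lt0r_neq0// addr_gt0.
have tij' : (b - a) / (N%:R + 2) <= t j - t i.
  rewrite tij ler_pM2l ?subr_gt0// -[leLHS]mul1r ler_pM2r ?invr_gt0 ?addr_gt0//.
  by rewrite ler1n subn_gt0.
have N20 : 0 < N%:R + 2 :> R by rewrite addr_gt0.
have tij0 : t i <= t j.
  by rewrite -subr_ge0 (le_trans _ tij')// divr_ge0// ?subr_ge0 ltW.
have := iter_rotate_ge (x j) tij0 k0; rewrite xjm => h5.
have h6 : e * `|x j - x i| < (b - a) / (N%:R + 2).
  apply: le_lt_trans (ler_wpM2l (ltW e0) (ltW xij)) _.
  rewrite /e -!mulrA ltr_pM2l ?subr_gt0// -invfM ltf_pV2 ?posrE ?mulr_gt0//.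
  have : 1 <= N%:R :> R by rewrite ler1n.
  by lra.
rewrite ler_norml => /andP[? ?]; lra.
Qed.

End rotated_iterates.
End uniform_derivatives.

(** * Convergence of orbits of monotone maps *)

Section monotone_limits.
Context (R : realType).

(** The direction of the first step persists, so the orbit is monotone, and integer translates of
    the fixed point [z0] confine it to an interval of length 1. *)
Lemma deg1_orbit_cvg (W : R -> R) (z0 x : R) : deg1 W -> continuous W -> W z0 = z0 ->
  exists2 z, W z = z & (fun n => iter n W x) @ \oo --> z.
Proof.
move=> dW cW Wz0; pose u n := iter n W x; pose j := Num.floor (x - z0).
have /andP[j1 j2] := floor_itv (x - z0); rewrite -/j in j1 j2.
have Wj (m : int) : W (z0 + m%:~R) = z0 + m%:~R by rewrite deg1_int// Wz0.
have uB n : z0 + j%:~R <= u n <= z0 + (j + 1)%:~R.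
  elim: n => [|n /andP[h1 h2]] /=; first by rewrite /u /=; apply/andP; split; lra.
  by rewrite -{1}Wj -(Wj (j + 1)); apply/andP; split; exact: deg1_le.
have cu : cvgn u.
  have [xW|/ltW xW] := leP x (W x).
    apply: nondecreasing_is_cvgn; last first.
      by exists (z0 + (j + 1)%:~R) => _ [n _ <-]; have /andP[] := uB n.
    apply/nondecreasing_seqP; elim=> [//|n ih].
    by rewrite /u !iterS; exact: deg1_le.
  apply: nonincreasing_is_cvgn; last first.
    by exists (z0 + j%:~R) => _ [n _ <-]; have /andP[] := uB n.
  apply/nonincreasing_seqP; elim=> [//|n ih].
  by rewrite /u !iterS; exact: deg1_le.
exists (limn u); last exact: cu.
have h1 : (fun n => W (u n)) @ \oo --> W (limn u).
  by apply: continuous_cvg => //; exact: cW.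
have h2 : (fun n => u n.+1) @ \oo --> limn u.
  by rewrite -(cvg_shiftS u) in cu; exact: (cvg_trans _ cu).
exact: (cvg_unique _ h1 h2).
Qed.

End monotone_limits.

(** * Attracting and repelling periodic points *)

Section hyperbolic_maps.
Context (R : realType).
Variables (F dF : R -> R) (C : R).
Hypotheses (dgF : deg1 F) (cF : continuous F) (FdF : uniformly_derivable F dF).
Hypotheses (C1 : 1 <= C) (dFC : forall x, `|dF x| <= C).
Hypothesis (FC : forall x y, `|F x - F y| <= C * `|x - y|).
Hypothesis (dF0 : forall x, 0 < dF x).
Variables (t : R) (k : nat) (m : int).
Hypothesis (k0 : (0 < k)%N).

Let H x := F x + t.
Let W x := iter k H x - m%:~R.
Let D z := multiplier F dF t k z.

Let dH : deg1 H. Proof. exact: deg1D. Qed.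

Let cH : continuous H.
Proof. by move=> x; apply: cvgD; [exact: cF|exact: cvg_cst]. Qed.

Let dW : deg1 W.
Proof.
apply: (@deg1D _ (iter k H) (- m%:~R)); elim: k => [|n [h1 h2]]; first by split.
by split=> [x y /h1/(deg1_lt dH)//|x]; rewrite /= h2 (deg1_1 dH).
Qed.

Let cW : continuous W.
Proof. by move=> x; apply: cvgB; [exact: iter_continuous|exact: cvg_cst]. Qed.

Lemma iter_return n x : iter n W x = iter (k * n) H x - (m *+ n)%:~R.
Proof.
elim: n x => [|n ih] x; first by rewrite muln0 subr0.
rewrite iterS ih /W mulnS iterD -mulrNz.
have Hint j y (i : int) : iter j H (y + i%:~R) = iter j H y + i%:~R.
  by elim: j => //= j ->; rewrite deg1_int.
by rewrite Hint mulrSr intrD mulrNz; lra.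
Qed.

Lemma fixpoint_linearization z e : W z = z -> 0 < e ->
  \forall y \near z, `|W y - z - D z * (y - z)| <= e * `|y - z|.
Proof.
move=> Wz e0; have [d d0 hd] := iter_uniformly_derivable FdF C1 dFC FC k e0.
apply/nbhs_ballP; exists d => // y; rewrite /ball /= distrC => yz.
have := hd t y z z yz; rewrite subrr normr0 => /(_ d0).
rewrite -/H -/(D z) (_ : iter k H y - iter k H z = W y - z)//.
by rewrite -[X in _ = _ - X]Wz /W; lra.
Qed.

(** With error [D z - 1] the linearization gives |W y - z| >= |y - z|: near a repelling fixed point
    distances never decrease, so an orbit converges to it only by landing on it. *)
Lemma repelling_limit z x : W z = z -> 1 < D z ->
  (fun n => iter n W x) @ \oo --> z -> exists n, iter n W x = z.
Proof.
move=> Wz Dz xz; have e0 : 0 < D z - 1 by rewrite subr_gt0.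
have [N _ hN] := xz _ (fixpoint_linearization Wz e0).
exists N; apply/eqP; rewrite -subr_eq0 -normr_eq0; apply/negPn/negP => u0.
set a := `|_| in u0; have a0 : 0 < a by rewrite lt_def u0 /a normr_ge0.
have mono n : a <= `|iter (n + N) W x - z|.
  elim: n => [//|n ih]; apply: le_trans ih _; rewrite addSn iterS.
  have /= := hN (n + N)%N (leq_addl _ _); set y := iter _ W x => h.
  have : D z * `|y - z| <= `|W y - z| + (D z - 1) * `|y - z|.
    have D0 : 0 <= D z by lra.
    rewrite -{1}(ger0_norm D0) -normrM -lerBlDl (le_trans _ h)// (le_trans (lerB_dist _ _))//.
    by rewrite distrC.
  by lra.
have /cvgrPdist_lt/(_ a a0) [N' _ hN'] := xz.
have := hN' (N' + N)%N (leq_addr _ _); have := mono N'; rewrite distrC.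
by move=> /le_lt_trans h /h; rewrite ltxx.
Qed.

(** The arcs are centred on the orbit of [z], and each radius is the previous one times [dF + e].
    The linearization error e/2 is smaller than e, so each image lies strictly inside the next arc;
    the product of the factors is below 1, so the last radius is smaller than the first. *)
Lemma attracting_trap z : W z = z -> D z < 1 ->
  exists b c l, trap H k b c l /\ b 0%N < z < c 0%N.
Proof.
move=> Wz Dz; pose zs j := iter j H z.
have Hz j : zs j.+1 = H (zs j) by [].
have := prod_near (l := fun j => dF (zs j)) Dz.
move=> /(filterI (nbhs_right_gt 0)) /filter_ex[e [/= e0 he]].
pose l j := dF (zs j) + e; have l0 j : 0 < l j by rewrite addr_gt0.
have e20 : 0 < e / 2 by rewrite divr_gt0.
have [d d0 hd] := FdF e20.
pose P j := \prod_(i < j) l i; have P0 j : 0 < P j by exact: prodr_gt0.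
have [rho [rho0 hrho]] : exists rho, 0 < rho /\ forall j : 'I_k.+1, rho * P j < d.
  have : \forall rho \near 0^'+, forall j : 'I_k.+1, rho * P j < d.
    apply: filter_forall => j; near=> rho; rewrite -ltr_pdivlMr//.
    by near: rho; apply: nbhs_right_lt; rewrite divr_gt0.
  by move=> /(filterI (nbhs_right_gt 0)) /filter_ex[rho [? ?]]; exists rho.
pose r j := rho * P j; have r0 j : 0 < r j by rewrite mulr_gt0.
have rS j : r j.+1 = l j * r j by rewrite /r /P big_ord_recr /=; ring.
exists (fun j => zs j - r j), (fun j => zs j + r j), l.
have r0E : r 0%N = rho by rewrite /r /P big_ord0 mulr1.
split; last by rewrite /= r0E; apply/andP; split; lra.
have Hd x y j : `|x - zs j| <= r j -> `|y - zs j| <= r j -> (j < k)%N ->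
    `|H x - H y - dF (zs j) * (x - y)| <= e / 2 * `|x - y|.
  move=> xj yj jk; have rd : r j < d := hrho (Ordinal (ltnW (jk : (j < k)%N) : (j < k.+1)%N)).
  have := hd x y (zs j) (le_lt_trans xj rd) (le_lt_trans yj rd).
  by rewrite /H opprD addrACA subrr addr0.
split => //.
- move=> j jk; exists 0; rewrite !addr0 Hz rS.
  have dj := dF0 (zs j); have rj := r0 j.
  have zj : `|zs j - zs j| <= r j by rewrite subrr normr0 ltW.
  have xj : `|zs j - r j - zs j| <= r j by rewrite addrAC subrr add0r normrN gtr0_norm.
  have yj : `|zs j + r j - zs j| <= r j by rewrite addrAC subrr add0r gtr0_norm.
  have := Hd _ _ j xj zj jk; have := Hd _ _ j yj zj jk.
  have -> : zs j + r j - zs j = r j by lra.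
  have -> : zs j - r j - zs j = - r j by lra.
  rewrite normrN (gtr0_norm rj) mulrN !ler_norml.
  have er : 0 < e * r j by rewrite mulr_gt0.
  by rewrite /l mulrDl => /andP[? ?] /andP[? ?]; split; lra.
- move=> j x y jk /andP[x1 x2] /andP[y1 y2].
  have xj : `|x - zs j| <= r j by rewrite ler_norml; apply/andP; split; lra.
  have yj : `|y - zs j| <= r j by rewrite ler_norml; apply/andP; split; lra.
  have h := Hd x y j xj yj jk.
  have -> : H x - H y = (H x - H y - dF (zs j) * (x - y)) + dF (zs j) * (x - y) by lra.
  apply: le_trans (ler_normD _ _) _; rewrite normrM (gtr0_norm (dF0 _)) /l mulrDl addrC lerD2l.
  by rewrite (le_trans h)// ler_wpM2r//; lra.
- exists m; rewrite r0E /=.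
  have zk : zs k = z + m%:~R by rewrite -[in RHS]Wz /W subrK.
  have rk : r k < rho by rewrite /r -[ltRHS]mulr1 ltr_pM2l.
  by rewrite zk; split; lra.
- by rewrite r0E /=; lra.
- by split=> // j; exact: ltW.
Unshelve. all: by end_near. Qed.

Hypothesis nondeg : forall z, W z = z -> D z != 1.

(** If [W] fixes [y0], a multiplier different from 1 keeps [W y - y] away from 0 at the other nearby
    [y]; if not, continuity suffices. *)
Lemma isolated_fixpoints y0 : \forall y \near y0, W y = y -> y = y0.
Proof.
have [Wy0|Wy0] := eqVneq (W y0) y0; last first.
  have : \forall y \near y0, W y - y != 0.
    have cWy : {for y0, continuous (fun y => W y - y)}.
      by apply: cvgB; [exact: cW|exact: cvg_id].
    have o : open [set y : R | y != 0] by exact: open_neq.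
    apply: (cWy [set y : R | y != 0]); apply: open_nbhs_nbhs; split => //=.
    by rewrite subr_eq0.
  by apply: filterS => y /eqP h1 h2; exfalso; apply: h1; rewrite h2 subrr.
have e0 : 0 < `|1 - D y0| / 2 by rewrite divr_gt0// normr_gt0 subr_eq0 eq_sym nondeg.
have := fixpoint_linearization Wy0 e0; apply: filterS => y h Wy.
rewrite Wy -{1}[y - y0]mul1r -mulrBl normrM in h.
apply/eqP; rewrite -subr_eq0 -normr_eq0; apply/negPn/negP => yy.
have y0' : 0 < `|y - y0| by rewrite lt_def yy normr_ge0.
by rewrite ler_pM2r// in h; lra.
Qed.

(** Applied to a lift [G] of f_1. Fixed points are isolated: near [z0] only [z0] matters, near
    [G z0] only [G z0] could be fixed, and a small positive s moves the image off it. Compactness of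
    [0, 1] makes s uniform. *)
Lemma avoid_fixpoints (G : R -> R) : deg1 G -> continuous G ->
  \forall s \near 0^'+, forall z, W z = z -> W (G z + s) <> G z + s.
Proof.
move=> dG cG.
have : \forall s \near 0^'+, `[0 : R, 1] `<=` [set z | W z = z -> W (G z + s) <> G z + s].
  apply: (compact_near_coveringP `[0 : R, 1]).1; first exact: segment_compact.
  move=> z0 _.
  have /nbhs_ballP[d /= d0 hd] := isolated_fixpoints (G z0).
  exists ([set z | W z = z -> z = z0], [set s | 0 < s < d]) => /=.
    split; first exact: isolated_fixpoints.
    by near=> s; apply/andP; split; near: s; [exact: nbhs_right_gt|exact: nbhs_right_lt].
  move=> [z s] /= [h1 /andP[s0 sd]] /[dup] Wz /h1 zz0 h; have := hd (G z + s) _ h.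
  rewrite zz0 /ball /= opprD addrA subrr add0r normrN gtr0_norm// => /(_ sd).
  by lra.
apply: filterS => s hs z Wz.
pose j := Num.floor z; pose z' := z - j%:~R.
have zE : z = z' + j%:~R by rewrite subrK.
have Wz' : W z' = z' by rewrite /z' -mulrNz deg1_int// Wz.
have z01 : `[0 : R, 1]%classic z'.
  by rewrite /= in_itv /=; have /andP[-> /ltW] := frac_part_itv z.
have := hs z' z01 Wz'; rewrite zE (deg1_int dG) addrAC (deg1_int dW) => h /addIr.
exact: h.
Unshelve. all: by end_near. Qed.

Lemma reach_trap_or_fixpoint z0 x : W z0 = z0 ->
  (exists b c l n, trap H k b c l /\ exists i : int, b 0%N < iter n H x + i%:~R < c 0%N) \/
  W x = x.
Proof.
move=> Wz0; have [z Wz xz] := deg1_orbit_cvg x dW cW Wz0.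
have : D z < 1 \/ 1 < D z by have := nondeg Wz; rewrite neq_lt => /orP.
case=> Dz.
  left; have [b [c [l [tr bzc]]]] := attracting_trap Wz Dz.
  have : nbhs z [set y | b 0%N < y < c 0%N].
    have : nbhs z `]b 0%N, c 0%N[%classic.
      by apply: open_nbhs_nbhs; split; [exact: interval_open|rewrite /= in_itv].
    by apply: filterS => y; rewrite /= in_itv.
  move=> /xz [N _ hN]; have := hN N (leqnn N).
  by rewrite /= iter_return -mulrNz => h; exists b, c, l, (k * N)%N; split=> //; exists (- (m *+ N)).
right; have [n xn] := repelling_limit Wz Dz xz.
have zn : iter n W z = z by elim: (n) => //= j ->.
have WI : injective W.
  by move=> u v Wuv; have [/(deg1_lt dW)|/(deg1_lt dW)|//] := ltgtP u v; rewrite Wuv ltxx.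
have WnI j : injective (iter j W).
  by elim: j => [|j ih] u v //; rewrite !iterS => /WI/ih.
have xz' : x = z by apply: (WnI n); rewrite xn zn.
by rewrite xz'; exact: Wz.
Qed.

End hyperbolic_maps.

(** * Perturbations *)

Section perturbations.
Context (R : realType).
Implicit Types (f g F G H : R -> R) (n j : nat).

Lemma derive1n_perturb n j f g (c : R) : (j <= n)%N -> Cn n f -> Cn n g ->
  derive1n j (fun x => f x + c * g x) = (fun x => derive1n j f x + c * derive1n j g x).
Proof.
elim: n j f g => [|n ih] [|j] f g //; rewrite ltnS => jn [df hf cf] [dg hg cg].
rewrite !derive1nSr (is_derive_derive1 hf) (is_derive_derive1 hg) -ih//; congr derive1n.
apply: is_derive_derive1 => x; apply: is_deriveD.
Qed.

Lemma derive1n_addc n j f (c : R) : (j < n)%N -> Cn n f ->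
  derive1n j.+1 (fun x => f x + c) = derive1n j.+1 f.
Proof.
case: n => // n _ [df hf _]; rewrite !derive1nSr; congr derive1n.
rewrite (is_derive_derive1 hf); apply: is_derive_derive1 => x.
by rewrite -[df x]addr0; apply: is_deriveD.
Qed.

Lemma Cn_periodic_bounded n g : Cn n g -> (forall x, g (x + 1) = g x) ->
  exists2 C : R, 0 < C & forall j x, (j <= n)%N -> `|derive1n j g x| <= C.
Proof.
elim: n g => [|n ih] g.
  move=> cg g1; have [C C0 hC] := periodic_bounded cg g1.
  by exists C => // -[|j] x.
move=> /[dup] /Cn_continuous cg [dg hg cdg] g1.
have dg1 x : dg (x + 1) = dg x.
  have h1 : is_derive x 1 (fun y => g (y + 1)) (dg (x + 1) * (1 + 0)).
    by apply: (@is_derive1_comp _ g (fun y => y + 1)) => //; apply: is_deriveD.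
  have E : (fun y => g (y + 1)) = g by apply/funext => y; exact: g1.
  rewrite E in h1; have := @derive_val _ _ _ _ _ _ _ h1.
  by rewrite (@derive_val _ _ _ _ _ _ _ (hg x)) addr0 mulr1.
have [C C0 hC] := ih _ cdg dg1; have [C' C'0 hC'] := periodic_bounded cg g1.
exists (Num.max C C') => [|[|j] x jn]; first by rewrite lt_max C0.
  by rewrite le_max hC' orbT.
by rewrite le_max derive1nSr (is_derive_derive1 hg) hC.
Qed.

Variable r : nat.
Hypothesis r1 : (1 <= r)%N.

Record circle_lift F : Prop := Lift {
  lift_Cn : Cn r F ;
  lift_deg1 : deg1 F ;
  lift_derive_gt0 : forall x : R, 0 < derive1 F x }.

Definition Cr_near (e : R) F H : Prop :=
  (forall x, `|F x - H x| < e) /\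
  (forall j x, (1 <= j <= r)%N -> `|derive1n j F x - derive1n j H x| < e).

Lemma Cr_near_trans e1 e2 F G H : Cr_near e1 F G -> Cr_near e2 G H -> Cr_near (e1 + e2) F H.
Proof.
move=> [h1 h2] [h3 h4]; split=> [x|j x jr].
  by rewrite (le_lt_trans (ler_distD (G x) _ _))// ltrD.
by rewrite (le_lt_trans (ler_distD (derive1n j G x) _ _))// ltrD// ?h2 ?h4.
Qed.

Lemma lift_is_derive F : circle_lift F -> forall x : R, is_derive x 1 F (derive1 F x).
Proof. by move=> [cF _ _] x; exact: Cn_is_derive cF. Qed.

Lemma lift_continuous F : circle_lift F -> continuous F.
Proof. by move=> [/Cn_continuous]. Qed.

Lemma lift_derive_continuous F : circle_lift F -> continuous (derive1 F).
Proof. by move=> [cF _ _]; exact: Cn_derive1_cont cF. Qed.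

Lemma lift_derive_periodic F : circle_lift F -> forall x : R, derive1 F (x + 1) = derive1 F x.
Proof. by move=> lF; apply: (periodic_deriv (lift_deg1 lF)); exact: lift_is_derive. Qed.

Lemma lift_uniform F : circle_lift F -> exists C : R,
  [/\ 1 <= C, forall x, `|derive1 F x| <= C, forall x y, `|F x - F y| <= C * `|x - y| &
    uniformly_derivable F (derive1 F)].
Proof.
move=> lF; have hF := lift_is_derive lF.
have [C C0 hC] := periodic_bounded (lift_derive_continuous lF) (lift_derive_periodic lF).
have hC' x : `|derive1 F x| <= Num.max 1 C by rewrite le_max hC orbT.
exists (Num.max 1 C); split => //.
- by rewrite le_max lexx.
- by move=> x y; have [c [_ ->]] := mean_value x y hF; rewrite normrM ler_wpM2r.
- apply: deg1_uniformly_derivable => //; first exact: lift_deg1.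
  exact: lift_derive_continuous.
Qed.

Lemma lift_rotate F t : circle_lift F -> circle_lift (fun x => F x + t).
Proof.
move=> lF; split; [|exact/deg1D/lift_deg1|move=> x].
  by apply: CnD; [exact: lift_Cn|exact: Cn_cst].
have := derive1n_addc (t : R) r1 (lift_Cn lF); rewrite !derive1n1 => ->.
exact: lift_derive_gt0.
Qed.

Lemma Cr_near_rotate F t e : circle_lift F -> `|t| < e -> Cr_near e F (fun x => F x + t).
Proof.
move=> lF te; split=> [x|[|j] x // jr].
  by rewrite opprD addrA subrr add0r normrN.
by rewrite (derive1n_addc _ jr (lift_Cn lF)) subrr normr0 (le_lt_trans _ te).
Qed.

Lemma lift_perturb F g e : circle_lift F -> Cn r g -> (forall x, g (x + 1) = g x) -> 0 < e ->
  exists2 c : R, 0 < c & circle_lift (fun x => F x + c * g x) /\ Cr_near e F (fun x => F x + c * g x).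
Proof.
move=> lF cg g1 e0; have [C C0 hC] := Cn_periodic_bounded cg g1.
have dF0 := lift_derive_gt0 lF.
have [B B0 hB] : exists2 B, 0 < B & forall x, `|(derive1 F x)^-1| <= B.
  apply: (@periodic_bounded _ (fun x => (derive1 F x)^-1)); last first.
    by move=> x; rewrite lift_derive_periodic.
  move=> x; apply: cvgV; first by rewrite lt0r_neq0.
  exact: lift_derive_continuous.
have FB x : B^-1 <= derive1 F x.
  by rewrite invf_ple ?posrE// (le_trans _ (hB x))// ler_norm.
(* [c * C] is at most half of [e], for the distance to [F], and half of [B^-1], a lower bound of the
   derivative of [F], so that the perturbed map keeps a positive derivative. *)
pose c := Num.min e B^-1 / (2 * C).
have c0 : 0 < c by rewrite divr_gt0 ?mulr_gt0// lt_min e0 invr_gt0.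
have cC : c * C < e /\ c * C < B^-1.
  have -> : c * C = Num.min e B^-1 / 2 by rewrite /c; field; rewrite lt0r_neq0.
  have : 0 < Num.min e B^-1 by rewrite lt_min e0 invr_gt0.
  have : Num.min e B^-1 <= e by rewrite ge_min lexx.
  have : Num.min e B^-1 <= B^-1 by rewrite ge_min lexx orbT.
  by move: (Num.min _ _) => a ? ? ?; split; lra.
have near j x : (j <= r)%N -> `|c * derive1n j g x| <= c * C.
  by move=> jr; rewrite normrM gtr0_norm// (ler_wpM2l (ltW c0))// hC.
exists c => //.
have cH : Cn r (fun x => F x + c * g x).
  by apply: CnD; [exact: lift_Cn|apply: CnM => //; exact: Cn_cst].
have dH x : derive1 (fun x => F x + c * g x) x = derive1 F x + c * derive1 g x.
  by have := derive1n_perturb c r1 (lift_Cn lF) cg; rewrite !derive1n1 => ->.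
have dH0 x : 0 < derive1 (fun x => F x + c * g x) x.
  rewrite dH; have := near 1%N x r1; rewrite derive1n1 ler_norml => /andP[? _].
  by have := FB x; have [_ ?] := cC; lra.
split; split => //.
- split=> [x y xy|x]; last by rewrite (deg1_1 (lift_deg1 lF)) g1 addrAC.
  have [z [_]] := mean_value y x (fun x => Cn_is_derive x r1 cH).
  by move=> h; rewrite -subr_gt0 h mulr_gt0// subr_gt0.
- move=> x; rewrite opprD addrA subrr add0r normrN.
  by apply: le_lt_trans (near 0%N x _) _ => //; case: cC.
- move=> j x /andP[_ jr]; rewrite (derive1n_perturb c jr (lift_Cn lF) cg).
  rewrite opprD addrA subrr add0r normrN.
  by apply: le_lt_trans (near j x jr) _; case: cC.
Qed.

End perturbations.

(** * Periodic orbits created by small perturbations *)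

Section periodic_orbits.
Context (R : realType).

Lemma iter_rotate_continuous (F : R -> R) k x : continuous F ->
  continuous (fun t => iter k (fun y => F y + t) x).
Proof.
move=> cF; rewrite (_ : (fun t => _) = fun t => act (rotate (fun=> F) t) (nseq k tt) x).
  by apply: act_rotate_continuous => // t; exact: cvg_cst.
by apply/funext => t; rewrite act_nseq.
Qed.

(** By pigeonhole the orbit of 0 returns modulo integers within 1/N of one of its points; rotations
    by plus and minus that gap put the k-th image on either side of the starting point. *)
Lemma periodic_rotation (F : R -> R) e : continuous F -> deg1 F -> 0 < e ->
  exists t x k (m : int), [/\ `|t| < e, (0 < k)%N & iter k (fun y => F y + t) x = x + m%:~R].
Proof.
move=> cF dF e0.
have [N N0 Nd] : exists2 N : nat, (0 < N)%N & N%:R^-1 < e.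
  by exists (Num.truncn e^-1).+1 => //; rewrite invf_plt ?posrE// truncnS_gt.
have NR0 : 0 < N%:R :> R by rewrite ltr0n.
pose fl j := Num.floor (iter j F 0); pose x j := iter j F 0 - (fl j)%:~R.
have x01 j : 0 <= x j < 1 by exact: frac_part_itv.
have piece_lt j : (Num.truncn (N%:R * x j) < N)%N.
  have /andP[x0 x1] := x01 j.
  by rewrite truncn_lt_nat ?mulr_ge0// -[ltRHS]mulr1 ltr_pM2l.
pose p (j : 'I_N.+1) := Ordinal (piece_lt j).
have : ~~ injectiveb p.
  apply/negP => /injectiveP pI; have := leq_card p pI.
  by rewrite !card_ord ltnn.
move=> /injectivePn[i [j ij /(congr1 val) /= pij]].
wlog lij : i j ij pij / (i < j)%N => [hw|].
  by have [h|h|/val_inj h] := ltngtP i j; [exact: hw h| |by rewrite h eqxx in ij];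
    apply: (hw j i) => //; rewrite eq_sym.
have xij : `|x j - x i| < N%:R^-1.
  have [/andP[xi0 _] /andP[xj0 _]] := (x01 i, x01 j).
  have /andP[h1 h2] := truncn_itv (mulr_ge0 (ltW NR0) xi0).
  have /andP[h3 h4] := truncn_itv (mulr_ge0 (ltW NR0) xj0).
  rewrite -pij in h3 h4; rewrite -natr1 in h2 h4.
  rewrite -[ltRHS]mul1r ltr_pdivlMr// -[X in _ * X](ger0_norm (ltW NR0)) -normrM.
  by rewrite ltr_norml; apply/andP; split; rewrite mulrBl ![_ * N%:R]mulrC; lra.
pose k := (j - i)%N; have k0 : (0 < k)%N by rewrite subn_gt0.
pose y := iter i F 0; pose m := fl j - fl i.
pose d := `|x j - x i|.
have Fky : iter k F y = y + m%:~R + (x j - x i).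
  by rewrite -iterD subnK 1?ltnW// /x /y /m intrB; lra.
have F0 : iter k (fun z => F z + 0) y = iter k F y.
  by congr (iter k _ y); apply/funext => z; rewrite addr0.
have d0 : 0 <= d by exact: normr_ge0.
have h1 : iter k (fun z => F z + - d) y <= y + m%:~R.
  have := @iter_rotate_ge _ _ dF (- d) 0 k y; rewrite F0 Fky => /(_ _ k0) h.
  have := h ltac:(lra); have : x j - x i <= d by exact: ler_norm.
  by lra.
have h2 : y + m%:~R <= iter k (fun z => F z + d) y.
  have := @iter_rotate_ge _ _ dF 0 d k y; rewrite F0 Fky => /(_ d0 k0) h.
  have : - (x j - x i) <= d by rewrite /d -normrN; exact: ler_norm.
  by lra.
have [||t] := @IVT R (fun t => iter k (fun z => F z + t) y) (- d) d (y + m%:~R) _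
    (continuous_subspaceT (@iter_rotate_continuous F k y cF)).
- by lra.
- by rewrite ge_min h1 le_max h2 orbT.
rewrite in_itv /= -ler_norml => td ty.
by exists t, y, k, m; split=> //; rewrite (le_lt_trans td)// (lt_trans xij).
Qed.

(** A mere periodic point may be destroyed by a rotation; strict inequalities of both signs survive
    small ones, in particular the one given by Sard's theorem, and still yield a periodic point. *)
Definition sign_change (F : R -> R) k (m : int) :=
  (exists x, iter k F x < x + m%:~R) /\ (exists x, x + m%:~R < iter k F x).

Lemma sign_change_open (F : R -> R) k m : continuous F -> sign_change F k m ->
  \forall t \near 0, sign_change (fun x => F x + t) k m.
Proof.
move=> cF [[x1 h1] [x2 h2]].
have F0 x : iter k (fun z => F z + 0) x = iter k F x.
  by congr (iter k _ x); apply/funext => z; rewrite addr0.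
have c1 := @iter_rotate_continuous F k x1 cF 0.
have c2 := @iter_rotate_continuous F k x2 cF 0.
have n1 : \forall t \near 0, iter k (fun z => F z + t) x1 < x1 + m%:~R.
  by apply: (c1 [set y | y < x1 + m%:~R]); apply: open_nbhs_nbhs; split; [exact: open_lt|rewrite /= F0].
have n2 : \forall t \near 0, x2 + m%:~R < iter k (fun z => F z + t) x2.
  by apply: (c2 [set y | x2 + m%:~R < y]); apply: open_nbhs_nbhs; split; [exact: open_gt|rewrite /= F0].
by near=> t; split; [exists x1; near: t|exists x2; near: t].
Unshelve. all: by end_near. Qed.

(** [x0] is displaced by exactly [m], and [x] by strictly more or strictly less. A small rotation in
    the opposite direction moves [x0] strictly to the other side, while [x] keeps its inequality. *)
Lemma sign_change_rotate (F : R -> R) k (m : int) x0 x e : continuous F -> deg1 F ->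
  (0 < k)%N -> iter k F x0 = x0 + m%:~R -> iter k F x != x + m%:~R -> 0 < e ->
  exists2 t, `|t| < e & sign_change (fun x => F x + t) k m.
Proof.
move=> cF dF k0 Fx0 + e0; rewrite neq_lt => Fx.
have F0 y : iter k (fun z => F z + 0) y = iter k F y.
  by congr (iter k _ y); apply/funext => z; rewrite addr0.
have c := @iter_rotate_continuous F k x cF 0.
case/orP: Fx => Fx.
  have : \forall t \near (0 : R), iter k (fun z => F z + t) x < x + m%:~R.
    by apply: (c [set y | y < x + m%:~R]); apply: open_nbhs_nbhs; split; [exact: open_lt|rewrite /= F0].
  move=> /nbhs_ballP[d /= d0 hd]; pose t := Num.min d e / 2.
  have t0 : 0 < t by rewrite divr_gt0// lt_min d0.
  have td : t < d /\ t < e.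
    have : 0 < Num.min d e by rewrite lt_min d0.
    have : Num.min d e <= d by rewrite ge_min lexx.
    have : Num.min d e <= e by rewrite ge_min lexx orbT.
    by rewrite /t; move: (Num.min _ _) => a ? ? ?; split; lra.
  exists t; first by rewrite gtr0_norm//; case: td.
  split; first by exists x; apply: hd; rewrite /ball /= sub0r normrN gtr0_norm//; case: td.
  exists x0; have := @iter_rotate_ge _ _ dF 0 t k x0; rewrite F0 Fx0 => /(_ (ltW t0) k0).
  by lra.
have : \forall t \near (0 : R), x + m%:~R < iter k (fun z => F z + t) x.
  by apply: (c [set y | x + m%:~R < y]); apply: open_nbhs_nbhs; split; [exact: open_gt|rewrite /= F0].
move=> /nbhs_ballP[d /= d0 hd]; pose t := Num.min d e / 2.
have t0 : 0 < t by rewrite divr_gt0// lt_min d0.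
have td : t < d /\ t < e.
  have : 0 < Num.min d e by rewrite lt_min d0.
  have : Num.min d e <= d by rewrite ge_min lexx.
  have : Num.min d e <= e by rewrite ge_min lexx orbT.
  by rewrite /t; move: (Num.min _ _) => a ? ? ?; split; lra.
exists (- t); first by rewrite normrN gtr0_norm//; case: td.
split; last by exists x; apply: hd; rewrite /ball /= sub0r opprK gtr0_norm//; case: td.
exists x0; have := @iter_rotate_ge _ _ dF (- t) 0 k x0; rewrite F0 Fx0 => h.
by have := h ltac:(lra) k0; lra.
Qed.

Lemma sign_change_fixpoint (F : R -> R) k m : continuous F -> sign_change F k m ->
  exists x, iter k F x = x + m%:~R.
Proof.
move=> cF [[x1 h1] [x2 h2]].
have ch : continuous (fun x => iter k F x - x).
  by move=> x; apply: cvgB; [exact: iter_continuous|exact: cvg_id].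
have [x12|/ltW x21] := leP x1 x2.
  have [|x _ hx] := @IVT R (fun x => iter k F x - x) x1 x2 m%:~R x12 (continuous_subspaceT ch).
    by rewrite ge_min le_max; apply/andP; split; apply/orP; [left|right]; lra.
  by exists x; lra.
have [|x _ hx] := @IVT R (fun x => iter k F x - x) x2 x1 m%:~R x21 (continuous_subspaceT ch).
  by rewrite ge_min le_max; apply/andP; split; apply/orP; [right|left]; lra.
by exists x; lra.
Qed.

End periodic_orbits.

Section creating_sign_changes.
Context (R : realType) (r : nat).
Hypothesis r1 : (1 <= r)%N.
Implicit Types (F H : R -> R).

Lemma Cn_prod n k (g : nat -> R -> R) : (forall j, Cn n (g j)) ->
  Cn n (fun x => \prod_(j < k) g j x).
Proof.
move=> cg; elim: k => [|k ih].
  by under eq_fun do rewrite big_ord0; exact: Cn_cst.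
by under eq_fun do rewrite big_ord_recr /=; exact: CnM.
Qed.

Lemma sin2_pi_periodic (v : R) : sin (pi * (v + 1)) ^+ 2 = sin (pi * v) ^+ 2.
Proof. by rewrite mulrDr mulr1 sinDpi sqrrN. Qed.

Lemma Cr_near_le e1 e2 F H : e1 <= e2 -> Cr_near r e1 F H -> Cr_near r e2 F H.
Proof.
by move=> e12 [h1 h2]; split=> [x|j x jr]; rewrite (lt_le_trans _ e12)// h2.
Qed.

(* When [iter k G = id + m], adding a bump that vanishes exactly on one orbit of
   [G] keeps that orbit periodic and pushes all the other points forward. *)
Lemma sign_change_perturbation F e : circle_lift r F -> 0 < e ->
  exists H, [/\ circle_lift r H, Cr_near r e F H &
    exists k (m : int), (0 < k)%N /\ sign_change H k m].
Proof.
move=> lF e0; have e40 : 0 < e / 4 by rewrite divr_gt0.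
have [t [x0 [k [m [te k0 Gx0]]]]] :=
  periodic_rotation (lift_continuous lF) (lift_deg1 lF) e40.
set G := (fun y => F y + t) in Gx0.
have lG : circle_lift r G := lift_rotate r1 t lF.
have FG := Cr_near_rotate lF te.
have [[x Gx]|allG] := pselect (exists x, iter k G x != x + m%:~R).
  have [t' t'e sc] := sign_change_rotate (lift_continuous lG) (lift_deg1 lG) k0 Gx0 Gx e40.
  exists (fun x => G x + t'); split; [exact: lift_rotate| |by exists k, m].
  by apply: Cr_near_le (Cr_near_trans FG (Cr_near_rotate lG t'e)); lra.
(* Each factor is smooth, 1-periodic (the square removes the sign of the sine) and zero only on the
   integer translates of one orbit point. *)
pose psi x := \prod_(j < k) sin (pi * (x - iter j G x0)) ^+ 2.
have psi1 x : psi (x + 1) = psi x.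
  by apply: eq_bigr => j _; rewrite addrAC sin2_pi_periodic.
have cpsi : Cn r psi.
  apply: (@Cn_prod r k (fun j x => sin (pi * (x - iter j G x0)) ^+ 2)) => j.
  have cs : Cn r (fun x => sin (pi * (x - iter j G x0))).
    apply: (@Cn_comp _ r sin (fun x => pi * (x - iter j G x0))).
      by have [] := @Cn_cos_sin R r.
    apply: CnM; first exact: Cn_cst.
    by apply: CnD; [exact: Cn_id|exact: Cn_cst].
  by apply: CnM.
have psi0 x : 0 <= psi x by apply: prodr_ge0 => j _; exact: sqr_ge0.
have psiG j : (j < k)%N -> psi (iter j G x0) = 0.
  move=> jk; rewrite /psi (bigD1 (Ordinal jk))//= subrr mulr0 sin0 expr0n /=.
  by rewrite mul0r.
have [y psiy] : exists y, 0 < psi y.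
  (* A point slightly to the right of [x0] avoids the zeros of all the factors: with u the
     fractional part of the offset, u + s stays in (0, 1). *)
  have : \forall s \near 0^'+, forall j : 'I_k, 0 < sin (pi * (x0 + s - iter j G x0)) ^+ 2.
    apply: filter_forall => j; pose v := x0 - iter j G x0.
    have := frac_part_itv v; set u := _ - _ => /andP[u0 u1].
    have u10 : 0 < 1 - u by rewrite subr_gt0.
    near=> s.
    have s0 : 0 < s by near: s; exact: nbhs_right_gt.
    have su : s < 1 - u by near: s; exact: nbhs_right_lt.
    have -> : x0 + s - iter j G x0 = (u + s) + (Num.floor v)%:~R by rewrite /u /v; lra.
    rewrite (periodic_int (h := fun v => sin (pi * v) ^+ 2) sin2_pi_periodic).
    rewrite exprn_gt0// sin_gt0_pi// mulr_gt0 ?pi_gt0//=; last by lra.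
    by rewrite -[ltRHS]mulr1 ltr_pM2l ?pi_gt0//; lra.
  by move=> /filter_ex[s hs]; exists (x0 + s); apply: prodr_gt0 => j _.
have [c c0 [lH GH]] := lift_perturb r1 lG cpsi psi1 e40.
set H := (fun x => G x + c * psi x) in lH GH.
have Hx0 : iter k H x0 = x0 + m%:~R.
  rewrite -Gx0; have : (k <= k)%N by [].
  elim: {-2}k => [//|j ih] jk; rewrite !iterS ih ?(ltnW jk)// /H psiG//.
  by rewrite mulr0 addr0.
have GHle j x : iter j G x <= iter j H x.
  elim: j => //= j ih; apply: le_trans (deg1_le (lift_deg1 lG) ih) _.
  by rewrite /H lerDl mulr_ge0// ltW.
have dGk : deg1 (iter k.-1 G).
  elim: (k.-1) => [|n [h1 h2]]; first by split.
  split=> [x x' /h1/(deg1_lt (lift_deg1 lG))//|x].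
  by rewrite /= h2 (deg1_1 (lift_deg1 lG)).
(* The iterates under [H] dominate those under [G], and the very first step from [y] is strictly
   larger because [psi y] is positive. *)
have Hy : iter k H y != y + m%:~R.
  have Gy : iter k G y = y + m%:~R.
    by apply/eqP/negPn/negP => Gy; apply: allG; exists y.
  have [k' kE] : exists k', k = k'.+1 by exists k.-1; rewrite prednK.
  rewrite -Gy kE gt_eqF// !iterSr; apply: lt_le_trans (GHle _ _).
  rewrite kE /= in dGk; by apply: deg1_lt => //; rewrite /H ltrDl mulr_gt0.
have [t' t'e sc] := sign_change_rotate (lift_continuous lH) (lift_deg1 lH) k0 Hx0 Hy e40.
exists (fun x => H x + t'); split; [exact: lift_rotate| |by exists k, m].
apply: Cr_near_le (Cr_near_trans (Cr_near_trans FG GH) (Cr_near_rotate lH t'e)).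
lra.
Unshelve. all: by end_near. Qed.

Lemma hyperbolic_perturbation F e : circle_lift r F -> 0 < e ->
  exists H, [/\ circle_lift r H, Cr_near r e F H &
    exists k (m : int), [/\ (0 < k)%N, exists x, iter k H x = x + m%:~R &
      forall x, iter k H x = x + m%:~R -> multiplier H (derive1 H) 0 k x != 1]].
Proof.
move=> lF e0; have e20 : 0 < e / 2 by rewrite divr_gt0.
have [G [lG FG [k [m [k0 sc]]]]] := sign_change_perturbation lF e20.
have cG := lift_continuous lG; have dgG := lift_deg1 lG.
have [C [C1 dGC GC udG]] := lift_uniform r1 lG.
have /nbhs_ballP[d /= d0 hd] := sign_change_open cG sc.
pose d' := Num.min d (e / 2); have d'0 : 0 < d' by rewrite lt_min d0.
have [t [/andP[t0 t1] ht]] := nondegenerate_rotation dgG udG C1 dGC GC m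
  (lift_derive_periodic r1 lG) k0 d'0.
move: t1; rewrite /d' lt_min => /andP[td te].
exists (fun x => G x + t).
have lH := lift_rotate r1 t lG.
split=> //.
  apply: Cr_near_le (Cr_near_trans FG (Cr_near_rotate lG _)) => //; last first.
    by rewrite gtr0_norm//; exact: te.
  by lra.
exists k, m; split=> //.
  apply: sign_change_fixpoint (lift_continuous lH) _.
  by apply: hd; rewrite /ball /= sub0r normrN gtr0_norm.
move=> x /ht; congr (_ != _); apply: eq_bigr => j _.
have -> : derive1 (fun x => G x + t) = derive1 G.
  by have := derive1n_addc t r1 (lift_Cn lG); rewrite !derive1n1.
by congr (derive1 G (iter j _ x)); apply/funext => y; rewrite addr0.
Qed.

End creating_sign_changes.

Lemma near_forall_compact (X Y : topologicalType) (K : set X) (y : Y) (P : Y -> X -> Prop) :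
  compact K -> (forall x, K x -> \forall x' \near x & y' \near y, P y' x') ->
  \forall y' \near y, forall x, K x -> P y' x.
Proof.
move=> cK h; exact: ((compact_near_coveringP K).1 cK Y (nbhs y) P (nbhs_filter y) h).
Qed.

(** * The space of step skew products; trapping is open and dense *)

Section space_of_skew_products.
Context (R : realType) (r s : nat).
Hypothesis r1 : (1 <= r)%N.
Local Notation T := (step_skew_products R r s).
Local Notation S1 := (circle R).
Implicit Types (f g : T) (p q : S1).

Lemma Cr_ball_le (h k : Diff R r) (a b : R) : a <= b -> Cr_ball h a k -> Cr_ball h b k.
Proof.
by move=> ab [k1 k2]; split=> [p|j x jr]; rewrite (lt_le_trans _ ab)// k2.
Qed.

(** Finiteness of the alphabet lets one radius serve all letters in the topology of pointwise
    convergence. *)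
Lemma nbhs_skew_products f (U : set T) : nbhs f U <->
  exists2 e : R, 0 < e & forall g : T, (forall i, Cr_ball (f i) e (g i)) -> U g.
Proof.
pose Fe : set_system T := [set V | exists2 e : R, 0 < e &
  forall g : T, (forall i, Cr_ball (f i) e (g i)) -> V g].
have FF : Filter Fe.
  split; first by exists 1.
    move=> A B [e1 e10 h1] [e2 e20 h2]; exists (Num.min e1 e2).
      by rewrite lt_min e10.
    move=> g hg; split; [apply: h1|apply: h2] => i; apply: Cr_ball_le (hg i).
      by rewrite ge_min lexx.
    by rewrite ge_min lexx orbT.
  by move=> A B AB [e e0 h]; exists e => // g /h /AB.
split; last first.
  move=> [e e0 h].
  have : \forall g \near f, forall i : 'I_s, Cr_ball (f i) e ((g : T) i).
    apply: (@filter_forall _ _ (fun i (g : T) => Cr_ball (f i) e (g i)) (nbhs f)) => i.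
    have : nbhs (f i) [set h | Cr_ball (f i) e h].
      by apply/nbhs_ballP; exists e.
    exact: (@proj_continuous 'I_s (fun=> Diff R r) i f).
  by apply: filterS => g; exact: h.
have : Fe --> f.
  apply/cvg_sup => i; rewrite cvg_image; last first.
    by rewrite eqEsubset; split=> v // _; exists (fun=> v).
  move=> W /= /nbhs_ballP[e /= e0 eW]; exists (fun g : T => W (g i)).
    by exists e => // g hg; apply: eW; exact: hg.
  rewrite eqEsubset; split => [j [? + <-//]|j Wj].
  by exists (fun=> j).
by move=> h fU; exact: (h U fU).
Qed.

Lemma lift_continuous_circle (F : R -> R) (f : S1 -> S1) : is_lift F f ->
  continuous F -> continuous f.
Proof.
move=> Ff cF p U; rewrite -{1 2}(to_circle_val p) Ff => /nbhs_ballP[e /= e0 eU].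
have /cvgrPdist_lt/(_ e e0)/nbhs_ballP[d /= d0 hd] := cF (circle_val p).
apply/nbhs_ballP; exists d => // q; rewrite ballEmdist /= => /mdist_lift[y <- xy].
rewrite /= Ff; apply: eU; rewrite ballEmdist /=.
by apply: le_lt_trans (to_circle_dist _ _) _; exact: hd.
Qed.

Lemma Diff_continuous (h : Diff R r) : continuous (h : S1 -> S1).
Proof. exact: lift_continuous_circle (Cr_liftP h).1 (Cr_lift_cont h). Qed.

Definition maps f : 'I_s -> S1 -> S1 := fun i p => f i p.

Lemma act_maps_continuous f w : continuous (act (maps f) w).
Proof.
elim: w => [|i w ih] p; first exact: cvg_id.
by apply: (@continuous_comp _ _ _ (maps f i) (act (maps f) w)); [exact: Diff_continuous|exact: ih].
Qed.

Lemma act_near f w p (U : set S1) : nbhs (act (maps f) w p) U ->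
  \forall q \near p & g \near f, U (act (maps g) w q).
Proof.
elim: w p => [|i w ih] p /= pU.
  exists (U, setT) => /=; first by split=> //; exact: filterT.
  by move=> [q g] [].
have [[A B] /= [/nbhs_ballP[e /= e0 eA] fB] AB] := ih _ pU.
have e20 : 0 < e / 2 by rewrite divr_gt0.
exists ([set q | mdist (f i p) (f i q) < e / 2], B `&` [set g | Cr_ball (f i) (e / 2) (g i)]) => /=.
  split.
    have : nbhs (f i p) (ball (f i p) (e / 2)) by exact: nbhsx_ballx.
    move=> /(@Diff_continuous (f i) p) h; apply: (@filterS _ (nbhs p) _ _ _ _ h) => q.
    by rewrite /= ballEmdist.
  apply: filterI => //; apply/nbhs_skew_products.
  by exists (e / 2) => // g; exact.
move=> [q g] [/= h1 [Bg [h2 _]]]; apply: (AB (g i q, g)); split => //=.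
apply: eA; rewrite ballEmdist /= (splitr e).
by apply: le_lt_trans (metric_triangle _ (f i q) _) _; rewrite ltrD.
Qed.

Lemma open_to_circle_itv (b c : R) : open (@to_circle R @` `]b, c[).
Proof.
rewrite openE => _ [x /= xbc <-].
have : nbhs x `]b, c[%classic by apply: open_nbhs_nbhs; split => //; exact: interval_open.
move=> /nbhs_ballP[d /= d0 hd]; apply/nbhs_ballP; exists d => // q.
by rewrite ballEmdist /= => /mdist_lift[y <- xy]; exists y => //; exact: hd.
Qed.

Lemma open_skew_products (O : set T) :
  (forall f, O f -> \forall g \near f, O g) -> open O.
Proof. by move=> h; rewrite openE => f /h. Qed.

(** Arc and target are fixed, whereas periodic points and orbit closures move with [f]; the interior
    makes the condition open. *)
Definition arc_reaches (b c : R) (A : set S1) : set T :=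
  [set f | exists w, forall x, b <= x <= c -> A° (act (maps f) w (to_circle x))].

Lemma arc_reaches_open b c A : open (arc_reaches b c A).
Proof.
apply: open_skew_products => f [w hw].
have : \forall g \near f, forall x, `[b, c]%classic x -> A° (act (maps g) w (to_circle x)).
  apply: (@near_forall_compact R T _ f (fun g x => A° (act (maps g) w (to_circle x)))).
    exact: segment_compact.
  move=> x; rewrite /= in_itv => /hw/nbhs_interior/act_near[[U V] /= [xU fV] UV].
  exists (@to_circle R @^-1` U, V) => /=; last by move=> [y g] [/= Uy Vg]; exact: (UV (_, g)).
  by split => //; exact: continuous_to_circle.
apply: (@filterS _ (nbhs f)) => g hg; exists w => x xbc; apply: hg.
by rewrite /= in_itv.
Qed.

Variable i0 : 'I_s.

(** Only the open consequence of hyperbolicity is recorded; the trap may depend on [p]. *)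
Definition trapped : set T := [set f | forall p, exists k b c l,
  trap (Cr_lift (f i0)) k b c l /\
  exists w x, b 0%N < x < c 0%N /\ act (maps f) w p = to_circle x].

Lemma trap_near f k b c l : trap (Cr_lift (f i0)) k b c l ->
  \forall g \near f, exists l', trap (Cr_lift ((g : T) i0)) k b c l'.
Proof.
move=> /(trap_open (Cr_lift_deg1 (f i0))) /(filterI (nbhs_right_gt 0)).
move=> /filter_ex[e [/= e0 he]]; apply/nbhs_skew_products; exists e => // g /(_ i0) fg.
exists (fun j => l j + e); apply: he => [|x y]; first exact: Cr_ball_lifts.
exact: Cr_ball_lipschitz.
Qed.

Lemma trapped_open : open trapped.
Proof.
apply: open_skew_products => f tf.
pose P (g : T) (p : S1) := exists k b c l, trap (Cr_lift (g i0)) k b c l /\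
  exists w x, b 0%N < x < c 0%N /\ act (maps g) w p = to_circle x.
have : \forall g \near f, forall p, [set: S1] p -> P g p.
  apply: (@near_forall_compact S1 T _ f P); first exact: compact_circle.
  move=> p _; have [k [b [c [l [tr [w [x [bxc px]]]]]]]] := tf p.
  have : nbhs (act (maps f) w p) (@to_circle R @` `]b 0%N, c 0%N[).
    rewrite px; apply: open_nbhs_nbhs; split; first exact: open_to_circle_itv.
    by exists x => //; rewrite /= in_itv.
  move=> /act_near[[U V] /= [pU fV] UV].
  exists (U, V `&` [set g | exists l', trap (Cr_lift ((g : T) i0)) k b c l']) => /=.
    by split => //; apply: filterI => //; exact: trap_near tr.
  move=> [q g] [/= Uq [Vg [l' tr']]]; exists k, b, c, l'; split => //.
  have [y] := UV (q, g) (conj Uq Vg); rewrite /= in_itv /= => ybc yq.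
  by exists w, y.
by apply: (@filterS _ (nbhs f)) => g hg p; exact: hg.
Qed.

Lemma trap_shift (F G : R -> R) (m : int) k b c l : (forall x, G x = F x + m%:~R) ->
  trap F k b c l -> trap G k b c l.
Proof.
move=> GF [k0 Fm Fl ? ? ?]; split=> //.
  move=> j /Fm[i [h1 h2]]; exists (i + m); rewrite !GF intrD.
  by split; lra.
by move=> j x y jk xj yj; rewrite !GF opprD addrACA subrr addr0; exact: Fl.
Qed.

Lemma lift_of_Diff (h : Diff R r) : circle_lift r (Cr_lift h).
Proof.
split; [exact: (Cr_liftP h).2|exact: Cr_lift_deg1|exact: Cr_lift_derive_gt0].
Qed.

Lemma Diff_of_near_lift (h : Diff R r) e H : circle_lift r H -> Cr_near r e (Cr_lift h) H ->
  exists2 k : Diff R r, is_lift H k & Cr_ball h e k.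
Proof.
move=> lH [h1 h2].
have [k Hk] := Diff_of_lift r1 (lift_Cn lH) (lift_deg1 lH) (lift_is_derive r1 lH) (lift_derive_gt0 lH).
by exists k => //; apply: (Cr_ball_of_lift r1 Hk (lift_Cn lH)).
Qed.

Variable i1 : 'I_s.
Hypothesis i01 : i1 != i0.

(** Only two letters are perturbed. A point whose [i0]-orbit enters no trap is fixed by the return
    map of [H]; the rotated [i1] sends it to a point that is not, and iterating [i0] from there
    leads into a trap. *)
Lemma trapped_dense : dense trapped.
Proof.
move=> O [f Of] oO.
have /nbhs_skew_products[e e0 eO] : nbhs f O by apply: open_nbhs_nbhs.
have [H [lH fH [k [m [k0 [z0 Hz0] Hn]]]]] :=
  hyperbolic_perturbation r1 (lift_of_Diff (f i0)) e0.
have H0 : (fun x => H x + 0) = H by apply/funext => x; rewrite addr0.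
have [C [C1 dHC HC udH]] := lift_uniform r1 lH.
have dH0 := lift_derive_gt0 lH.
have cH := lift_continuous lH; have dgH := lift_deg1 lH.
have nondeg z : iter k (fun x => H x + 0) z - m%:~R = z -> multiplier H (derive1 H) 0 k z != 1.
  by rewrite H0 => hz; apply: Hn; rewrite -{2}hz subrK.
have := avoid_fixpoints dgH cH udH C1 dHC HC nondeg
  (Cr_lift_deg1 (f i1)) (Cr_lift_cont (f i1)).
move=> /(filterI (nbhs_right_lt e0)) /(filterI (nbhs_right_gt 0)) /filter_ex[t [/= t0 [te ht]]].
have [h0 Hh0 fh0] := Diff_of_near_lift lH fH.
pose G x := Cr_lift (f i1) x + t.
have lG : circle_lift r G := lift_rotate r1 t (lift_of_Diff (f i1)).
have fG : Cr_near r e (Cr_lift (f i1)) G.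
  by apply: (Cr_near_rotate (lift_of_Diff (f i1))); rewrite gtr0_norm.
have [h1 Gh1 fh1] := Diff_of_near_lift lG fG.
pose g : T := fun i => if i == i0 then h0 else if i == i1 then h1 else f i.
exists g; split.
  apply: eO => i; rewrite /g; case: eqP => [->//|_]; case: eqP => [->//|_].
  exact: Cr_ball_center.
have Hg : is_lift H (g i0) by rewrite /g eqxx.
have [n hn] := lifts_eq (Cr_liftP (g i0)).1 Hg (Cr_lift_cont (g i0)) cH.
have g0 x : g i0 (to_circle x) = to_circle (H x) by rewrite /g eqxx Hh0.
have g1 x : g i1 (to_circle x) = to_circle (G x).
  by rewrite /g (negbTE i01) eqxx Gh1.
have gn j x : act (maps g) (nseq j i0) (to_circle x) = to_circle (iter j H x).
  by elim: j x => // j ih x; rewrite iterSr -ih /= /maps g0.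
have trap_case x : (exists b c l n, trap (fun x => H x + 0) k b c l /\
      exists i : int, b 0%N < iter n (fun x => H x + 0) x + i%:~R < c 0%N) ->
    exists k b c l, trap (Cr_lift (g i0)) k b c l /\
      exists w y, b 0%N < y < c 0%N /\ act (maps g) w (to_circle x) = to_circle y.
  move=> [b [c [l [j []]]]]; rewrite H0 => tr [i hi].
  exists k, b, c, l; split; first exact: trap_shift hn tr.
  exists (nseq j i0), (iter j H x + i%:~R); split=> //.
  by rewrite to_circle_int gn.
have Hz0' : iter k (fun x => H x + 0) z0 - m%:~R = z0 by rewrite H0 Hz0 addrK.
have reach x := reach_trap_or_fixpoint dgH cH udH C1 dHC HC dH0 k0 nondeg x Hz0'.
move=> p; rewrite -(to_circle_val p); have [/trap_case//|pW] := reach (circle_val p).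
have [/trap_case[k' [b [c [l [tr [w [y [ybc hw]]]]]]]]|Gp] := reach (G (circle_val p)).
  exists k', b, c, l; split => //; exists (i1 :: w), y; split => //.
  by rewrite /= /maps g1.
by exfalso; apply: (ht _ pW).
Qed.

End space_of_skew_products.

(** * Stability of generic orbit closures *)

Section orbits.
Context (R : realType) (s : nat).
Local Notation S1 := (circle R).
Variable phi : 'I_s -> S1 -> S1.

Definition orbit_closure (p : S1) : set S1 := closure (range (fun w => act phi w p)).

Definition stable_orbit (a : S1) := forall U : set S1, open U -> orbit_closure a `<=` U ->
  exists V : set S1, [/\ open V, orbit_closure a `<=` V &
    forall w q, V q -> U (act phi w q)].

(** Together with continuity and injectivity of the maps, this is all that the study of the skew
    product uses about a generic system. *)
Definition finitely_attracted := exists A : seq S1,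
  (forall p, exists2 a, a \in A & orbit_closure p a) /\
  (forall a, a \in A -> nbhs a [set q | orbit_closure q a] /\ stable_orbit a).

Lemma mem_orbit_closure w p : orbit_closure p (act phi w p).
Proof. by apply: subset_closure; exists w. Qed.

Lemma mdist_orbit_closure p q e : orbit_closure p q -> 0 < e ->
  exists w, mdist q (act phi w p) < e.
Proof.
move=> pq e0; have [_ [[w _ <-]]] := pq _ (nbhsx_ballx q e e0).
by rewrite ballEmdist; exists w.
Qed.

End orbits.

Section generic_skew_products.
Context (R : realType) (r s : nat).
Hypothesis r1 : (1 <= r)%N.
Local Notation T := (step_skew_products R r s).
Local Notation S1 := (circle R).
Variable i0 : 'I_s.

Definition rational_arc_reaches (x : rat * rat * (rat * rat)) : set T :=
  arc_reaches (ratr x.1.1) (ratr x.1.2) (ball (to_circle (ratr x.2.1) : S1) (ratr x.2.2)).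

Definition generic : set T := [set f | trapped i0 f /\
  forall x, rational_arc_reaches x f \/ (~` rational_arc_reaches x)° f].

Lemma dense_or_exterior (X : topologicalType) (E : set X) : dense (E `|` (~` E)°).
Proof.
move=> O O0 oO; have [[x [Ox Ex]]|OE] := pselect (O `&` E !=set0).
  by exists x; split=> //; left.
have [x Ox] := O0; exists x; split=> //; right.
apply: (@filterS _ _ _ O); last exact: open_nbhs_nbhs.
by move=> y Oy Ey; apply: OE; exists y.
Qed.

Lemma generic_residual : (exists i1, i1 != i0) -> residual generic.
Proof.
move=> [i1 i10].
pose E n : set T := if unpickle n is Some x then rational_arc_reaches x else setT.
have oE n : open (E n).
  by rewrite /E; case: unpickle => [x|]; [exact: arc_reaches_open|exact: openT].
exists (fun n => if n is n'.+1 then E n' `|` (~` E n')° else trapped i0).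
  case=> [|n]; first by split; [exact: trapped_open|exact: trapped_dense i10].
  split; last exact: dense_or_exterior.
  by apply: openU => //; exact: open_interior.
move=> f hf; split; first exact: (hf 0%N).
by move=> x; have := hf (pickle x).+1 I; rewrite /E pickleK.
Qed.

Variable f : T.
Hypothesis gf : generic f.
Local Notation F := (fun i => Cr_lift (f i)).

Lemma lifts_lipschitz : exists2 C : R, 0 <= C &
  forall i x y, `|F i x - F i y| <= C * `|x - y|.
Proof.
have H i : exists C : R, 0 <= C /\ forall x y, `|F i x - F i y| <= C * `|x - y|.
  have [C [C1 _ HC _]] := lift_uniform r1 (lift_of_Diff r1 (f i)).
  by exists C; split => //; rewrite (le_trans ler01).
pose C i := sval (cid (H i)).
have CP i : 0 <= C i /\ forall x y, `|F i x - F i y| <= C i * `|x - y|.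
  by rewrite /C; case: cid.
exists (\sum_i C i) => [|i x y]; first by apply: sumr_ge0 => i _; exact: (CP i).1.
apply: le_trans ((CP i).2 x y) _; rewrite ler_wpM2r// (bigD1 i)//= lerDl.
by apply: sumr_ge0 => j _; exact: (CP j).1.
Qed.

Lemma act_lift (g : T) (G : 'I_s -> R -> R) : (forall i, is_lift (G i) (g i)) ->
  forall w x, act (maps g) w (to_circle x) = to_circle (act G w x).
Proof. by move=> Gg; elim=> //= i w ih x; rewrite -ih /maps Gg. Qed.

Lemma rotated_near (t e : R) : `|t| < e -> exists2 g : T,
  (forall i, Cr_ball (f i) e (g i)) &
  forall w x, act (maps g) w (to_circle x) = to_circle (act (rotate F t) w x).
Proof.
move=> te.
have H i : exists h : Diff R r, is_lift (rotate F t i) h /\ Cr_ball (f i) e h.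
  have [h h1 h2] := Diff_of_near_lift r1 (lift_rotate r1 t (lift_of_Diff r1 (f i)))
    (Cr_near_rotate (lift_of_Diff r1 (f i)) te).
  by exists h.
exists (fun i => sval (cid (H i))); first by move=> i; case: cid => h [].
by apply: act_lift => i; case: cid => h [].
Qed.

Lemma exterior_near x : ~ rational_arc_reaches x f -> exists2 e : R, 0 < e &
  forall g : T, (forall i, Cr_ball (f i) e (g i)) -> ~ rational_arc_reaches x g.
Proof.
move=> nE; have [//|] := gf.2 x.
by move=> /nbhs_skew_products[e e0 he]; exists e.
Qed.

Lemma rat_between (x y : R) : x < y -> exists q : rat, x < ratr q < y.
Proof.
by move=> /rat_in_itvoo[q]; rewrite in_itv /=; exists q.
Qed.

Variables (k : nat) (b c l : nat -> R).
Hypothesis tr : trap (F i0) k b c l.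
Variables (a : R) (M : int).
Hypotheses (bac : b 0 < a < c 0) (aM : iter k (F i0) a = a + M%:~R).

Lemma trap_basin x : b 0 <= x <= c 0 -> orbit_closure (maps f) (to_circle x) (to_circle a).
Proof.
move=> xb; have [M' [HM Hl]] := trap_iter (Cr_lift_deg1 (f i0)) tr.
have [l0 l1] := trap_l tr; set L := \prod_(j < k) _ in Hl l1.
have L0 : 0 <= L by apply: prodr_ge0.
have ab : b 0 <= a <= c 0 by case/andP: bac => ? ?; apply/andP; split; exact: ltW.
have HM' y : b 0 <= y <= c 0 -> b 0 + M'%:~R <= iter k (F i0) y <= c 0 + M'%:~R.
  by move=> /HM/andP[/ltW -> /ltW ->].
move=> U /nbhs_ballP[e /= e0 eU].
have : (fun n => L ^+ n * `|x - a|) @ \oo --> 0 * `|x - a|.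
  apply: cvgM; last exact: cvg_cst.
  by apply: cvg_expr; rewrite ger0_norm.
rewrite mul0r => /cvgr0_norm_lt /(_ _ e0) [n _ hn].
have {hn} := hn n (leqnn n); rewrite /= => /(le_lt_trans (ler_norm _)) hn.
exists (act (maps f) (nseq (k * n) i0) (to_circle x)); split; first by exists (nseq (k * n) i0).
apply: eU; rewrite ballEmdist /= (act_lift (fun i => (Cr_liftP (f i)).1)) act_nseq.
have -> : to_circle a = to_circle (iter (k * n) (F i0) a).
  have Fint j (m : int) y : iter j (F i0) (y + m%:~R) = iter j (F i0) y + m%:~R.
    by elim: j => //= j ->; rewrite (deg1_int (Cr_lift_deg1 _)).
  have -> : iter (k * n) (F i0) a = a + (M *+ n)%:~R; last by rewrite to_circle_int.
  elim: n {hn} => [|n ih]; first by rewrite muln0 mulr0n addr0.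
  by rewrite mulnSr iterD aM Fint ih mulrSr intrD addrA.
rewrite metric_sym; apply: le_lt_trans (to_circle_dist _ _) _.
apply: le_lt_trans hn.
exact: (iter_contraction (Cr_lift_deg1 (f i0)) L0 HM' Hl).
Qed.

Lemma trap_stable : stable_orbit (maps f) (to_circle a).
Proof.
move=> U oU MU; set Orb := orbit_closure _ _ in MU *.
have cOrb : closed Orb by exact: closed_closure.
have [C C0 HC] := lifts_lipschitz.
(* By compactness of the complement of [U] it suffices to exclude the points [y2] near one [y], for
   all small d depending on [y]. *)
pose P (d : R) (y : S1) := forall q w x, Orb x -> mdist x q < d -> act (maps f) w q <> y.
have : \forall d \near 0^'+, ~` U `<=` P d.
  apply: (compact_near_coveringP (~` U)).1.
    apply: (subclosed_compact _ (@compact_circle R)) => //; exact: open_closedC.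
  move=> y Uy.
  have : nbhs y (~` Orb).
    by apply: open_nbhs_nbhs; split; [exact: closed_openC|move=> /MU].
  move=> /nbhs_ballP[e /= e0 eOrb].
  (* The centre is within e/4 of [y] and the radius between e/4 and e/2: the rational ball is a
     neighbourhood of [y] and stays within e of it, hence off [Orb]. The rational arc around [a]
     lies inside the trap. *)
  have [|y' /andP[y'1 y'2]] := @rat_between (circle_val y - e / 4) (circle_val y + e / 4).
    by lra.
  have [|rho /andP[rho1 rho2]] := @rat_between (e / 4) (e / 2); first by lra.
  have [|b' /andP[b'1 b'2]] := @rat_between (b 0%N) a; first by case/andP: bac.
  have [|c' /andP[c'1 c'2]] := @rat_between a (c 0%N); first by case/andP: bac.
  pose B := ball (to_circle (ratr y') : S1) (ratr rho).
  have yy' : mdist (to_circle (ratr y')) y < e / 4.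
    rewrite -(to_circle_val y); apply: le_lt_trans (to_circle_dist _ _) _.
    by rewrite ltr_norml; apply/andP; split; lra.
  have yB : nbhs y B.
    apply/nbhs_ballP; exists (ratr rho - e / 4); first by rewrite /= subr_gt0.
    move=> q; rewrite /B !ballEmdist /= => yq.
    by apply: le_lt_trans (metric_triangle _ y _) _; lra.
  have BOrb q : B q -> ~ Orb q.
    rewrite /B ballEmdist /= => hq; apply: eOrb; rewrite ballEmdist /=.
    apply: le_lt_trans (metric_triangle _ (to_circle (ratr y')) _) _.
    by rewrite metric_sym; lra.
  (* Words applied to [a] stay in [Orb], so [f] is not in this open set; by genericity no nearby
     system is. *)
  have nE : ~ rational_arc_reaches (b', c', (y', rho)) f.
    move=> [w hw]; apply: (BOrb (act (maps f) w (to_circle a))).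
      by apply: interior_subset; apply: hw => /=; apply/andP; split; exact: ltW.
    exact: mem_orbit_closure.
  have [e' e'0 he'] := exterior_near nE.
  have := trap_open (Cr_lift_deg1 (f i0)) tr.
  move=> /(filterI (nbhs_right_lt e'0)) /(filterI (nbhs_right_gt 0)).
  move=> /filter_ex[t0 [/= t00 [te' htr]]].
  exists (B°, [set d | d < t0]) => /=.
    by split; [exact: nbhs_interior|exact: nbhs_right_lt].
  move=> [y2 d] [/= By2 dt0] q w x Ox xq qy2.
  (* The pseudo-orbit: [u] leads from [a] so close to [x] that it ends within [t0] of [q]; after the
     jump to [q], the word [w] leads to [y2]. *)
  have xq0 : 0 < t0 - mdist x q by rewrite subr_gt0 (lt_trans xq).
  have [u xu] := mdist_orbit_closure Ox xq0.
  have : mdist (act (maps f) u (to_circle a)) q < t0.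
    by apply: le_lt_trans (metric_triangle _ x _) _; rewrite -ltrBrDr metric_sym.
  have Fl := act_lift (fun i => (Cr_liftP (f i)).1).
  rewrite Fl => /mdist_lift[x0 x0q ux0].
  rewrite -x0q Fl in qy2.
  have /nbhs_ballP[rho2' /= rho20 hB] := nbhs_interior By2.
  pose L := \prod_(j < k) (l j + t0).
  have htr' t : `|t| <= t0 -> trap (rotate F t i0) k b c (fun j => l j + t0).
    have E x1 : rotate F t i0 x1 - Cr_lift (f i0) x1 = t by rewrite /rotate addrAC subrr add0r.
    move=> tt; apply: htr => [|x1 x2]; last first.
      by rewrite !E subrr normr0 mulr_ge0// ltW.
    exists 0 => x1; rewrite subr0 E (le_lt_trans tt)//.
    by rewrite mulr_natl mulr2n ltrDl.
  have L01 : 0 <= L < 1.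
    have [h1 h2] := trap_l (htr' 0 ltac:(rewrite normr0; exact: ltW)).
    by rewrite h2 andbT; apply: prodr_ge0.
  have hrot t : `|t| <= t0 -> exists M' : int,
    (forall x, b 0%N <= x <= c 0%N -> b 0%N + M'%:~R <= iter k (rotate F t i0) x <= c 0%N + M'%:~R) /\
    (forall x y, b 0%N <= x <= c 0%N -> b 0%N <= y <= c 0%N ->
      `|iter k (rotate F t i0) x - iter k (rotate F t i0) y| <= L * `|x - y|).
    move=> /htr' htrt.
    have [M' [h1 h2]] := trap_iter (rotate_deg1 (fun i => Cr_lift_deg1 (f i)) t i0) htrt.
    by exists M'; split => // z /h1/andP[/ltW -> /ltW ->].
  have ab : b 0%N <= a <= c 0%N by case/andP: bac => ? ?; apply/andP; split; exact: ltW.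
  have [t [z [tt0 hz]]] := rotation_connecting (fun i => Cr_lift_deg1 (f i))
    (fun i => Cr_lift_cont (f i)) w C0 HC (ltW t00) L01 (trap_k tr) hrot ab aM (ltW ux0) rho20.
  have [g fg gz] := rotated_near (le_lt_trans tt0 te').
  apply: (he' g fg); exists z => x1 /= /andP[x1b x1c].
  have [|m hm] := hz x1.
    by case/andP: bac => ? ?; apply/andP; split; lra.
  rewrite gz; apply: hB; rewrite ballEmdist /= -qy2 metric_sym.
  rewrite -(to_circle_int (act F w x0) m); apply: le_lt_trans (to_circle_dist _ _) _.
  by move: hm; rewrite opprD addrA.
move=> /(filterI (nbhs_right_gt 0)) /filter_ex[d [/= d0 hd]].
exists [set q | exists2 x, Orb x & mdist x q < d]; split.
- rewrite openE => q [x Ox xq]; apply/nbhs_ballP; exists (d - mdist x q); first by rewrite /= subr_gt0.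
  move=> q'; rewrite ballEmdist /= => qq'; exists x => //.
  by apply: le_lt_trans (metric_triangle _ q _) _; lra.
- by move=> x Ox; exists x => //; rewrite mdistxx.
- move=> w q [x Ox xq]; apply: contrapT => nU.
  exact: (hd _ nU q w x Ox xq).
Qed.

End generic_skew_products.

(** Each point has a neighbourhood whose points all have one common periodic attractor in their
    orbit closures; a finite subcover provides the list. *)
Lemma generic_finitely_attracted (R : realType) (r s : nat) (i0 : 'I_s)
  (f : step_skew_products R r s) : (1 <= r)%N -> generic i0 f ->
  finitely_attracted (maps f).
Proof.
move=> r1 gf.
have H (p : circle R) : exists a, [/\ stable_orbit (maps f) a,
    nbhs a [set q | orbit_closure (maps f) q a] &
    nbhs p [set q | orbit_closure (maps f) q a]].
  have [k [b [c [l [tr [w [x [bxc px]]]]]]]] := gf.1 p.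
  have [a [M [bac aM]]] := trap_fixpoint (Cr_lift_deg1 (f i0)) (Cr_lift_cont (f i0)) tr.
  have near_arc (y : R) : b 0%N < y < c 0%N ->
      nbhs (to_circle y) [set q | orbit_closure (maps f) q (to_circle a)].
    move=> byc.
    have : nbhs (to_circle y) (@to_circle R @` `]b 0%N, c 0%N[).
      apply: open_nbhs_nbhs; split; first exact: open_to_circle_itv.
      by exists y => //; rewrite /= in_itv.
    apply: (@filterS _ (nbhs (to_circle y))) => q [z] /=.
    rewrite in_itv /= => /andP[z1 z2] <-.
    by apply: (trap_basin tr bac aM); rewrite !ltW.
  exists (to_circle a); split; [exact: (trap_stable r1 gf tr bac aM)|exact: near_arc|].
  have := near_arc x bxc; rewrite -px => /(@act_maps_continuous _ _ _ f w p) h.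
  apply: (@filterS _ (nbhs p) _ _ _ _ h) => q /= hq U /hq[_ [[v _ <-] Uv]].
  by exists (act (maps f) (w ++ v) q); split; [exists (w ++ v)|rewrite act_cat].
pose a p := sval (cid (H p)).
have aP p : [/\ stable_orbit (maps f) (a p),
    nbhs (a p) [set q | orbit_closure (maps f) q (a p)] &
    nbhs p [set q | orbit_closure (maps f) q (a p)]] by rewrite /a; case: cid.
have := @compact_circle R; rewrite compact_cover.
move=> /(_ _ setT (fun p => [set q | orbit_closure (maps f) q (a p)]°)) [].
- by move=> p _; exact: open_interior.
- by move=> p _; exists p => //; have [] := aP p.
move=> D _ hD; exists (map a (finmap.enum_fset D)); split=> [p|_ /mapP[p _ ->]].
  have [q /= qD /interior_subset pq] := hD p I.
  by exists (a q) => //; exact: map_f.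
by have [] := aP p.
Qed.

(** * Frequencies of words *)

Section words_sums.
Context (R : realType) (s : nat).
Implicit Types (n m : nat) (h : seq 'I_s -> R).

(** Divided by s^n it is the mean of [h] over a uniformly random word; [word_measure] gives the link
    with the Bernoulli measure for indicators. *)
Fixpoint word_sum n h : R :=
  if n is m.+1 then \sum_(i < s) word_sum m (fun w => h (i :: w)) else h [::].

Lemma word_sum_add n m h :
  word_sum (n + m) h = word_sum n (fun u => word_sum m (fun w => h (u ++ w))).
Proof. by elim: n h => //= n ih h; apply: eq_bigr => i _; rewrite ih. Qed.

Lemma ler_word_sum n h h' : (forall w, size w = n -> h w <= h' w) ->
  word_sum n h <= word_sum n h'.
Proof.
elim: n h h' => [|n ih] h h' hh /=; first exact: hh.
by apply: ler_sum => i _; apply: ih => w wn; apply: hh; rewrite /= wn.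
Qed.

Lemma word_sumM n c h : word_sum n (fun w => c * h w) = c * word_sum n h.
Proof.
elim: n h => //= n ih h; rewrite mulr_sumr.
by apply: eq_bigr => i _; rewrite -ih.
Qed.

Lemma word_sumB n h h' : word_sum n (fun w => h w - h' w) = word_sum n h - word_sum n h'.
Proof.
elim: n h h' => //= n ih h h'; rewrite -sumrB.
by apply: eq_bigr => i _; rewrite -ih.
Qed.

Lemma word_sum_cst n c : word_sum n (fun=> c) = s%:R ^+ n * c.
Proof.
elim: n => [|n ih] /=; first by rewrite expr0 mul1r.
by rewrite ih sumr_const card_ord -[LHS]mulr_natl exprS mulrA.
Qed.

Lemma word_sum_eq n u : size u = n -> word_sum n (fun w => (w == u)%:R) = 1.
Proof.
elim: n u => [|n ih] [|j u] //= [un].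
rewrite (bigD1 j)//= [X in _ + X]big1 => [|i ij].
  by rewrite addr0 -[RHS](ih u un); congr word_sum; apply/funext => w; rewrite eqseq_cons eqxx.
rewrite -[RHS](mulr0 (s%:R ^+ n)) -word_sum_cst; congr word_sum.
by apply/funext => w; rewrite eqseq_cons (negbTE ij).
Qed.

End words_sums.

Section block_counting.
Context (R : realType) (s : nat) (S : Type) (phi : 'I_s -> S -> S).
Variables (V : set S) (L : nat) (u : S -> seq 'I_s).
Hypothesis (phiV : forall i x, V x -> V (phi i x)).
Hypothesis (uL : forall q, V q -> size (u q) = L).

(* The number of blocks of length [L] at which the word [w] reads the word
   prescribed by [u] at the current position. *)
Fixpoint hits n (p : S) (w : seq 'I_s) : nat :=
  if n is m.+1 then
    ((take L w == u p) + hits m (act phi (take L w) p) (drop L w))%N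
  else 0%N.

(** An exponential moment. The prescribed word depends on the current position, but in each block
    exactly one of the s^L words is prescribed and counts 1/2 instead of 1, whence the factor s^L -
    1/2. *)
Lemma word_sum_hits n p : V p ->
  word_sum (n * L) (fun w => (2^-1 : R) ^+ hits n p w) <= (s%:R ^+ L - 2^-1) ^+ n.
Proof.
elim: n p => [|n ih] p Vp; first by rewrite mul0n /= !expr0.
rewrite mulSn word_sum_add.
have := ler_word_sum (n := L) (h := fun v => word_sum (n * L) (fun w => (2^-1 : R) ^+ hits n.+1 p (v ++ w)))
  (h' := fun v => (s%:R ^+ L - 2^-1) ^+ n * (1 - 2^-1 * (v == u p)%:R)).
rewrite word_sumM word_sumB word_sum_cst word_sumM word_sum_eq ?uL// !mulr1 -exprSr.
apply=> v vL; rewrite [leLHS](_ : _ = word_sum (n * L)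
    (fun w => (1 - 2^-1 * (v == u p)%:R) * 2^-1 ^+ hits n (act phi v p) w)); last first.
  congr word_sum; apply/funext => w /=; rewrite -vL take_size_cat// drop_size_cat// exprD.
  by congr (_ * _); case: (v == u p); rewrite /= ?expr0 ?expr1 ?mulr1 ?mulr0; lra.
rewrite word_sumM [leRHS]mulrC ler_wpM2l//; first by case: eqP => _ /=; lra.
apply: ih; exact: act_invariant.
Qed.

(** Markov's inequality: the indicator of fewer than [k] hits is at most 2^k times 2^-hits. *)
Lemma word_sum_few_hits n k p : V p ->
  word_sum (n * L) (fun w => (hits n p w < k)%N%:R) <= 2 ^+ k * (s%:R ^+ L - 2^-1 : R) ^+ n.
Proof.
move=> Vp; apply: le_trans (ler_wpM2l _ (word_sum_hits n Vp)); last exact: exprn_ge0.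
rewrite -word_sumM; apply: ler_word_sum => w _.
have [hk|_] := ltnP; last by rewrite mulr_ge0// exprn_ge0.
rewrite exprVn ler_pdivlMr ?exprn_gt0// mul1r ler_weXn2l//; first by rewrite ler1n.
exact: ltnW.
Qed.

End block_counting.

(** * Bernoulli measure of events determined by finitely many letters *)

Section bernoulli_words.
Context (R : realType) (s : nat) (hs : (2 <= s)%N).
Local Notation Sigma := (shift_space R hs).
Local Notation mu := (bernoulli_measure R hs).

Definition word (n : nat) (w : Sigma) : seq 'I_s := mkseq (fun k => w k%:Z) n.

Lemma size_word n w : size (word n w) = n. Proof. exact: size_mkseq. Qed.

Lemma measurable_coordinate (n : int) (a : 'I_s) : measurable [set w : Sigma | w n = a].
Proof. by apply: sub_sigma_algebra; exists (n, a). Qed.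

Lemma word_eqP n (v : seq 'I_s) w : size v = n ->
  word n w = v <-> forall k : 'I_n, w k%:Z = nth (Ordinal (ltnW hs)) v k.
Proof.
move=> vn; split=> [<- k|h]; first by rewrite nth_mkseq.
apply: (@eq_from_nth _ (Ordinal (ltnW hs))); rewrite size_word ?vn// => k kn.
by rewrite nth_mkseq// (h (Ordinal kn)).
Qed.

Lemma measurable_cylinder (v : seq 'I_s) : measurable [set w : Sigma | word (size v) w = v].
Proof.
rewrite (_ : [set _ | _] = \bigcap_(k in [set: 'I_(size v)])
    [set w : Sigma | w (val k)%:Z = nth (Ordinal (ltnW hs)) v k]); last first.
  by apply/seteqP; split=> w /=; [move=> /word_eqP h k _; exact: h|move=> h; apply/word_eqP => // k; exact: h].
apply: fin_bigcap_measurable; first exact: finite_finset.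
by move=> k _; exact: measurable_coordinate.
Qed.

Lemma cylinder_measure (v : seq 'I_s) :
  mu [set w : Sigma | word (size v) w = v] = (s%:R ^- size v)%:E.
Proof.
pose J := [seq Posz k | k <- iota 0 (size v)].
have uJ : uniq J by rewrite map_inj_uniq ?iota_uniq// => i j [].
have := @bernoulli_measure_cylinder R s hs J (fun n => nth (Ordinal (ltnW hs)) v `|n|%N) uJ.
rewrite size_map size_iota => <-; congr (mu _); apply/seteqP; split=> w /=.
  move=> /word_eqP h n /mapP[k]; rewrite mem_iota add0n => /= kv ->.
  exact: (h erefl (Ordinal kv)).
move=> h; apply/word_eqP => // k; apply: (h k%:Z).
by apply/mapP; exists (val k) => //; rewrite mem_iota add0n /=.
Qed.

(** The prefix [v] is kept fixed so that the induction on the number of free letters can branch on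
    the next one. *)
Lemma word_measure_from (D : seq 'I_s -> bool) n (v : seq 'I_s) :
  measurable [set w : Sigma | word (size v) w = v /\ D (word (size v + n) w)] /\
  mu [set w : Sigma | word (size v) w = v /\ D (word (size v + n) w)] =
    (word_sum n (fun w => (D (v ++ w))%:R) * s%:R ^- (size v + n))%:E.
Proof.
elim: n v => [|n ih] v.
  rewrite addn0 [word_sum _ _]/= cats0; have [Dv|/negP Dv] := boolP (D v).
    rewrite (_ : [set _ | _] = [set w | word (size v) w = v]); last first.
      by apply/seteqP; split=> w /=; [case|move=> wv; split=> //; rewrite wv].
    split; first exact: measurable_cylinder.
    by rewrite cylinder_measure mul1r.
  rewrite (_ : [set _ | _] = set0); last first.
    by apply/seteqP; split=> w //= -[->].
  by split; [exact: measurable0|rewrite measure0 mul0r].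
pose E i := [set w : Sigma | word (size (rcons v i)) w = rcons v i /\
  D (word (size (rcons v i) + n) w)].
have wordS w : word (size v).+1 w = rcons (word (size v) w) (w (size v)%:Z) by exact: mkseqS.
have EE : [set w : Sigma | word (size v) w = v /\ D (word (size v + n.+1) w)] =
    \bigcup_(i in [set` enum 'I_s]) E i.
  apply/seteqP; split=> w /=.
    move=> [wv Dw]; exists (w (size v)%:Z); first by rewrite /= mem_enum.
    by rewrite /E /= size_rcons wordS wv addSnnS.
  move=> [i _]; rewrite /E /= size_rcons wordS addSnnS => -[/rcons_inj[? _] ?].
  by split.
have mE i : measurable (E i) := (ih (rcons v i)).1.
rewrite EE; split; first by apply: fin_bigcup_measurable.
rewrite measure_fin_bigcup; [|exact: finite_seq| |]; last 2 first.
- move=> i j _ _ [w []]; rewrite /E /= !size_rcons => -[wi _] [wj _].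
  by move: wi; rewrite wj => /rcons_inj[].
- by move=> i _; exact: mE.
rewrite -fsbig_seq ?enum_uniq// big_enum.
rewrite (eq_bigr (fun i : 'I_s => (word_sum n (fun w => (D (rcons v i ++ w))%:R) *
    s%:R ^- (size v + n.+1))%:E)); last first.
  move=> i _; apply: etrans (ih (rcons v i)).2 _.
  by rewrite size_rcons addSnnS.
rewrite sumEFin -mulr_suml; congr ((_ * _)%:E); apply: eq_bigr => i _.
by congr word_sum; apply/funext => w; rewrite cat_rcons.
Qed.

Lemma word_measure (D : seq 'I_s -> bool) n :
  measurable [set w : Sigma | D (word n w)] /\
  mu [set w : Sigma | D (word n w)] = (word_sum n (fun w => (D w)%:R) * s%:R ^- n)%:E.
Proof.
have := word_measure_from D n [::]; rewrite [size _]/= add0n.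
rewrite (_ : [set w : Sigma | word 0 w = [::] /\ D (word n w)] = [set w | D (word n w)])//.
by apply/seteqP; split=> w //= [].
Qed.

End bernoulli_words.

Section frequencies.
Context (R : realType) (s : nat) (hs : (2 <= s)%N) (S : Type).
Local Notation Sigma := (shift_space R hs).
Local Notation mu := (bernoulli_measure R hs).
Variable phi : 'I_s -> S -> S.
Implicit Types (w : Sigma) (p : S) (T : set (Sigma * S)).

Definition step_skew (x : Sigma * S) : Sigma * S :=
  (bernoulli_shift x.1, phi (x.1 0) x.2).

Lemma iter_skew n w p :
  iter n step_skew (w, p) = ((fun j => w (j + n%:Z)) : Sigma, act phi (word n w) p).
Proof.
elim: n => [|n ih]; first by congr pair; apply/funext => j; rewrite addr0.
have -> : word n.+1 w = word n w ++ [:: w n%:Z] by rewrite /word mkseqS cats1.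
rewrite iterS ih act_cat /step_skew /= add0r; congr pair.
by apply/funext => j; rewrite /bernoulli_shift; congr w; lia.
Qed.

Lemma word_add n m w : word (n + m) w = word n w ++ word m ((fun j => w (j + n%:Z)) : Sigma).
Proof.
rewrite /word /mkseq iotaD map_cat add0n; congr (_ ++ _).
by rewrite -[n in iota n m]addn0 iotaDl -map_comp; apply: eq_map => k /=; rewrite PoszD addrC.
Qed.

Definition visits N x T : nat := \sum_(0 <= t < N) `[< T (iter t step_skew x) >].

Lemma card_visits N x T : #|[pred n : 'I_N | `[< T (iter n step_skew x) >]]| = visits N x T.
Proof.
rewrite -sum1_card big_mkcond /= /visits big_mkord.
by apply: eq_bigr => t _; rewrite inE; case: asboolP.
Qed.

Lemma visits_add n m x T : visits (n + m) x T = (visits n x T + visits m (iter n step_skew x) T)%N.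
Proof.
rewrite /visits (big_cat_nat _ (n := n)) ?leq_addr//=; congr addn.
rewrite -{1}[n]add0n big_addn addKn; apply: eq_bigr => t _.
by rewrite iterD.
Qed.

Lemma limn_esup_ge (c : \bar R) (v : nat -> \bar R) :
  (forall n, exists2 m, (n <= m)%N & (c <= v m)%E) -> (c <= limn_esup v)%E.
Proof.
move=> h; rewrite limn_esup_lim; apply: lime_ge; first exact: is_cvg_esups.
apply: nearW => n; have [m nm cm] := h n.
by apply: le_trans cm _; apply: ereal_sup_ubound; exists m.
Qed.

Lemma frequency_gt0 x T (K : nat) : (0 < K)%N ->
  (forall k0, exists2 k, (k0 <= k)%N & (k <= visits (K * k) x T)%N) ->
  (0 < frequency R step_skew x T)%E.
Proof.
move=> K0 h; have KR0 : 0 < K%:R :> R by rewrite ltr0n.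
apply: (@lt_le_trans _ _ (K%:R^-1)%:E); first by rewrite lte_fin invr_gt0.
apply: limn_esup_ge => n; have [k nk hk] := h n.+1.
have k0 : (0 < k)%N by apply: leq_trans nk.
exists (K * k)%N.
  by apply: leq_trans (ltnW nk) _; rewrite leq_pmull.
rewrite card_visits lee_fin natrM ler_pdivlMr ?mulr_gt0 ?ltr0n//.
by rewrite mulrA mulVf ?lt0r_neq0// mul1r ler_nat.
Qed.

Section blocks.
Variables (V : set S) (L : nat) (u : S -> seq 'I_s) (T : set (Sigma * S)).
Hypothesis (phiV : forall i x, V x -> V (phi i x)).
Hypothesis (uL : forall q, V q -> size (u q) = L).
Hypothesis (uT : forall q w, V q -> word L w = u q ->
  exists2 t, (t < L)%N & T (iter t step_skew (w, q))).

Lemma hits_visits n p w : V p ->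
  (hits phi L u n p (word (n * L) w) <= visits (n * L) (w, p) T)%N.
Proof.
elim: n p w => [//|n ih] p w Vp; rewrite mulSn visits_add iter_skew /=.
rewrite word_add take_size_cat ?size_word// drop_size_cat ?size_word//.
apply: leq_add; last by apply: ih; exact: act_invariant.
case: eqP => // wu; have [t tL Tt] := uT Vp wu.
rewrite /visits big_mkord (bigD1 (Ordinal tL))//=.
by case: asboolP.
Qed.

Lemma few_hits_measure : exists2 C : nat, (0 < C)%N & forall p k, V p ->
  let E := [set w : Sigma | (hits phi L u (C * k) p (word (C * k * L) w) < k)%N] in
  measurable E /\ (mu E <= (2^-1 ^+ k)%:E)%E.
Proof.
have sL : 1 <= s%:R ^+ L :> R.
  by rewrite exprn_ege1// ler1n ltnW.
pose d : R := 1 - 2^-1 * s%:R ^- L.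
have sL0 : 0 < s%:R ^+ L :> R by rewrite (lt_le_trans ltr01).
have isL0 : 0 < s%:R ^- L :> R by rewrite invr_gt0.
have isL1 : s%:R ^- L <= 1 :> R by rewrite invf_le1.
have d01 : 0 <= d < 1 by rewrite /d; lra.
(* With 1/4 for each unit of k, the factor 2^k from Markov's inequality still leaves 2^-k. *)
have [C C0 hC] : exists2 C, (0 < C)%N & d ^+ C <= 4^-1.
  have : (fun n => d ^+ n) @ \oo --> (0 : R).
    by apply: cvg_expr; rewrite ger0_norm; case/andP: d01.
  have q0 : 0 < 4^-1 :> R by [].
  move=> /cvgr0_norm_lt /(_ _ q0) [n _ hn].
  exists n.+1 => //; have := hn n.+1 (leqnSn n); rewrite /= => /ltW; apply: le_trans.
  exact: ler_norm.
exists C => // p k Vp E.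
have [mE muE] := word_measure R hs (fun v => hits phi L u (C * k) p v < k)%N (C * k * L).
split; first exact: mE.
rewrite muE lee_fin.
have h := word_sum_few_hits R phiV uL (C * k) k Vp.
apply: le_trans (ler_wpM2r _ h) _; first by rewrite invr_ge0 exprn_ge0.
have -> : s%:R ^- (C * k * L) = (s%:R ^- L) ^+ (C * k) :> R.
  by rewrite mulnC exprM exprVn.
rewrite -mulrA -exprMn mulrBl divff ?lt0r_neq0// -/d exprM -exprMn.
have dC0 : 0 <= d ^+ C by rewrite exprn_ge0//; case/andP: d01.
apply: lerXn2r; rewrite ?nnegrE ?mulr_ge0//.
by rewrite (_ : 2^-1 = 2 * 4^-1); [rewrite ler_pM2l|field].
Qed.

(** The frequency is an upper limit, so infinitely many good k are enough: the intersection of the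
    bad events over k >= k0 has measure at most 2^-k for each of these k, hence 0. *)
Lemma block_frequency p : (0 < L)%N -> V p ->
  {ae mu, forall w, (0 < frequency R step_skew (w, p) T)%E}.
Proof.
move=> L0 Vp; have [C C0 hC] := few_hits_measure.
pose E k := [set w : Sigma | (hits phi L u (C * k) p (word (C * k * L) w) < k)%N].
have mE k : measurable (E k) by exact: (hC p k Vp).1.
have muE k : (mu (E k) <= (2^-1 ^+ k)%:E)%E by exact: (hC p k Vp).2.
have : {ae mu, forall w, forall k0 : nat, exists2 k, (k0 <= k)%N & ~ E k w}.
  apply: ae_foralln => k0.
  pose B := \bigcap_(k in [set k | (k0 <= k)%N]) E k.
  have mB : measurable B by apply: bigcap_measurable => [|k _]; [exists k0 => /=|].
  exists B; split => //.
    have h k : (k0 <= k)%N -> (mu B <= (2^-1 ^+ k)%:E)%E.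
      move=> kk; apply: le_trans (muE k); apply: le_measure; rewrite ?inE//.
      by apply: bigcap_inf.
    apply/eqP; rewrite -measure_le0; apply/lee_addgt0Pr => e e0; rewrite add0e.
    have : (fun n => (2^-1 : R) ^+ n) @ \oo --> (0 : R).
      by apply: cvg_expr; rewrite ger0_norm//; lra.
    move=> /cvgr0_norm_lt /(_ _ e0) [n _ hn].
    apply: le_trans (h (n + k0)%N (leq_addl _ _)) _; rewrite lee_fin.
    have := hn (n + k0)%N (leq_addr _ _) => /= /ltW; apply: le_trans; exact: ler_norm.
  move=> w /= hw k kk; apply: contrapT => nE; apply: hw; by exists k.
apply: filterS => w hw; apply: (@frequency_gt0 _ _ (C * L)).
  by rewrite muln_gt0 C0.
move=> k0; have [k kk nE] := hw k0; exists k => //.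
have -> : (C * L * k = C * k * L)%N by rewrite mulnAC.
apply: leq_trans (hits_visits (C * k) w Vp).
by rewrite leqNgt; apply/negP.
Qed.

End blocks.
End frequencies.

(** * The attractor of the skew product *)

Section skew_dynamics.
Context (R : realType) (s : nat) (hs : (2 <= s)%N).
Local Notation Sigma := (shift_space R hs).
Local Notation S1 := (circle R).
Local Notation X := (Sigma * S1)%type.
Implicit Types (w v : Sigma) (p q : S1) (x y z : X).

Definition agree (m : nat) w v := forall j : int, (`|j| <= m)%N -> w j = v j.

Lemma agree_near m w : nbhs w [set v | agree m w v].
Proof.
apply/nbhs_ballP; exists (2 ^- m) => /=; first by rewrite invr_gt0 exprn_gt0.
move=> v; rewrite ballEmdist /= => wv j jm.
have : ~~ differ w v `|j|%N.
  apply/negP => /differ_dist; apply/negP; rewrite -ltNge (lt_le_trans wv)//.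
  by rewrite lef_pV2 ?posrE ?exprn_gt0// ler_weXn2l// ler1n.
rewrite negb_or !negbK => /andP[/eqP h1 /eqP h2].
by case: (intP j) h1 h2 => [//|k|k]; rewrite ?abszN.
Qed.

Lemma nbhs_cylinderP x (U : set X) : nbhs x U <->
  exists m (N : set S1), nbhs x.2 N /\ forall y, agree m x.1 y.1 -> N y.2 -> U y.
Proof.
split=> [[[A B] /= [/nbhs_ballP[e /= e0 eA] xB] AB]|[m [N [xN h]]]]; last first.
  exists ([set v | agree m x.1 v], N) => /=; first by split=> //; exact: agree_near.
  by move=> [v q] [/= h1 h2]; exact: h.
have [m me] : exists m, 2 ^- m < e :> R.
  have [m _ hm] := near_infty_natSinv_expn_lt (PosNum e0).
  by exists m; have := hm m (leqnn m); rewrite /= div1r.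
exists m, B; split=> // -[v q] /= xv Bq; apply: (AB (v, q)); split=> //=.
apply: eA; rewrite ballEmdist /=; apply: le_lt_trans me.
apply: dist_lt => k km; rewrite /differ negb_or !negbK.
by apply/andP; split; apply/eqP; apply: xv; rewrite ?abszN; exact: ltnW.
Qed.

Lemma phase_space_hausdorff : hausdorff_space X.
Proof.
move=> [w p] [v q] xy; congr pair.
  apply: (@metric_hausdorff R Sigma) => A B wA vB.
  have [||[u t] [[/= Au _] [/= Bu _]]] := xy (A `*` setT) (B `*` setT).
  - by exists (A, setT) => //; split=> //; exact: filterT.
  - by exists (B, setT) => //; split=> //; exact: filterT.
  - by exists u.
apply: (@metric_hausdorff R S1) => A B pA qB.
have [||[u t] [[/= _ At] [/= _ Bt]]] := xy (setT `*` A) (setT `*` B).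
- by exists (setT, A) => //; split=> //; exact: filterT.
- by exists (setT, B) => //; split=> //; exact: filterT.
- by exists t.
Qed.

Lemma compact_phase_space : compact [set: X].
Proof.
by rewrite -setXTT; apply: compact_setX; [exact: compact_shift_space|exact: compact_circle].
Qed.

Variable phi : 'I_s -> S1 -> S1.
Hypothesis phi_cont : forall i, continuous (phi i).
Local Notation F := (@step_skew R s hs S1 phi).

Lemma skew_continuous : continuous F.
Proof.
move=> x U /nbhs_cylinderP[m [N [xN h]]]; apply/nbhs_cylinderP.
exists m.+1, (phi (x.1 0) @^-1` N); split; first exact: phi_cont.
move=> y xy yN; apply: h => [j jm|/=].
  by apply: xy; lia.
by rewrite -(xy 0).
Qed.

Lemma iter_skew_continuous n : continuous (iter n F).
Proof.
elim: n => [|n ih] x; first exact: cvg_id.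
by apply: (@continuous_comp _ _ _ (iter n F) F); [exact: ih|exact: skew_continuous].
Qed.

Lemma act_continuous u : continuous (act phi u).
Proof.
elim: u => [|i u ih] p; first exact: cvg_id.
by apply: (@continuous_comp _ _ _ (phi i) (act phi u)); [exact: phi_cont|exact: ih].
Qed.

Lemma orbit_closure_trans p q t : orbit_closure phi p q -> orbit_closure phi q t ->
  orbit_closure phi p t.
Proof.
move=> pq qt U /nbhs_interior tU; have [_ [[u _ <-] uU]] := qt _ tU.
have [_ [[v _ <-] vU]] := pq _ (@act_continuous u q _ uU).
by exists (act phi (v ++ u) p); split; [exists (v ++ u)|rewrite act_cat].
Qed.

Lemma orbit_closure_act u p q : orbit_closure phi p q -> orbit_closure phi p (act phi u q).
Proof. by move=> /orbit_closure_trans; apply; exact: mem_orbit_closure. Qed.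

Lemma orbit_closure_refl p : orbit_closure phi p p.
Proof. exact: (@mem_orbit_closure _ _ phi [::]). Qed.

Lemma orbit_closure_reach p q (G : set S1) : orbit_closure phi p q -> nbhs q G ->
  exists u, G (act phi u p).
Proof. by move=> pq /pq[_ [[u _ <-] Gu]]; exists u. Qed.

Lemma uniform_reach (C G : set S1) : compact C -> open G ->
  (forall p, C p -> exists u, G (act phi u p)) ->
  exists N, forall p, C p -> exists2 u, (size u <= N)%N & G (act phi u p).
Proof.
move=> cC oG hG.
pose P N p := exists2 u, (size u <= N)%N & G (act phi u p).
have : \forall N \near \oo, C `<=` P N.
  apply: (compact_near_coveringP C).1 => // p /hG[u Gu].
  exists (act phi u @^-1` G, [set N | (size u <= N)%N]) => /=.
    split; last by exists (size u).
    by apply: act_continuous; exact: open_nbhs_nbhs.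
  by move=> [q N] [/= Gq uN]; exists u.
by move=> [N _ hN]; exists N => p Cp; exact: hN N (leqnn N) p Cp.
Qed.

Section attractor.
Variable A : seq S1.
Hypothesis A_reach : forall p, exists2 a, a \in A & orbit_closure phi p a.
Hypothesis A_stable : forall a, a \in A -> stable_orbit phi a.

(** Minimality is tested on the finite list [A] only; [terminal_orbit_closure] extends it to all
    points of the orbit closure. *)
Definition terminal a := a \in A /\
  forall b, b \in A -> orbit_closure phi a b -> orbit_closure phi b a.

Definition fiber_attractor : set S1 :=
  \bigcup_(a in [set a | terminal a]) orbit_closure phi a.

(** Descent on the number of elements of [A] in the orbit closure: a non-terminal [a] reaches some b
    that does not reach it back, and the closure of b contains fewer of them, having lost [a]. *)
Lemma terminal_reach p : exists2 a, terminal a & orbit_closure phi p a.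
Proof.
have [a0 a0A pa0] := A_reach p.
suff H n a : a \in A -> (count (fun b => `[< orbit_closure phi a b >]) A <= n)%N ->
    exists2 b, terminal b & orbit_closure phi a b.
  have [b tb ab] := H _ a0 a0A (leqnn _).
  by exists b => //; exact: orbit_closure_trans pa0 ab.
elim: n a => [|n ih] a aA.
  rewrite leqn0 => /eqP/eqP; rewrite eqn0Ngt -has_count => /hasPn/(_ a aA)/asboolPn.
  by case; exact: orbit_closure_refl.
move=> an; have [ta|nta] := pselect (terminal a).
  by exists a => //; exact: orbit_closure_refl.
have [b bA [ab nba]] : exists2 b, b \in A & orbit_closure phi a b /\ ~ orbit_closure phi b a.
  apply: contrapT => h; apply: nta; split=> // b bA ab.
  by apply: contrapT => nba; apply: h; exists b.
have [|c tc bc] := ih b bA; last by exists c => //; exact: orbit_closure_trans ab bc.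
rewrite -ltnS (leq_trans _ an)//.
have : subpred (fun c => `[< orbit_closure phi b c >])
    (fun c => `[< orbit_closure phi a c >] && (c != a)).
  move=> c /asboolP bc; apply/andP; split.
    by apply/asboolP; exact: orbit_closure_trans ab bc.
  by apply/eqP => ca; apply: nba; rewrite -ca.
move=> /(sub_count)/(_ A) h; apply: leq_ltn_trans h _.
move: aA; elim: (A) => // c B ihB; rewrite inE => /orP[/eqP <-|aB] /=.
  rewrite eqxx andbF add0n; have -> : `[< orbit_closure phi a a >] by apply/asboolP; exact: orbit_closure_refl.
  by rewrite add1n ltnS; apply: sub_count => d /andP[].
rewrite -addnS leq_add ?ihB//.
by case: asboolP => //= _; case: (_ != _).
Qed.

Lemma fiber_attractor_closed : closed fiber_attractor.
Proof.
apply: closed_bigcup => [|a _]; last exact: closed_closure.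
by apply: (sub_finite_set _ (finite_seq A)) => a [].
Qed.

Lemma fiber_attractor_act u q : fiber_attractor q -> fiber_attractor (act phi u q).
Proof. by move=> [a ta aq]; exists a => //; exact: orbit_closure_act. Qed.

Lemma fiber_attractor_stable (U : set S1) : open U -> fiber_attractor `<=` U ->
  exists V, [/\ open V, fiber_attractor `<=` V & forall u q, V q -> U (act phi u q)].
Proof.
move=> oU KU; exists ([set q | forall u, U (act phi u q)]°); split.
- exact: open_interior.
- move=> q [a /= ta aq]; have [|V [oV aV VU]] := A_stable ta.1 oU.
    by move=> t at_; apply: KU; exists a.
  apply: (@filterS _ (nbhs q) _ V); last by apply: open_nbhs_nbhs; split=> //; exact: aV.
  by move=> t Vt u; exact: VU.
- by move=> u q /interior_subset; exact.
Qed.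

Definition level n : set X := iter n F @` [set x | fiber_attractor x.2].

Definition attractor : set X := \bigcap_n level n.

Lemma level_compact n : compact (level n).
Proof.
apply: continuous_compact.
  by apply: continuous_subspaceT; exact: iter_skew_continuous.
rewrite (_ : [set x | _] = setT `*` fiber_attractor); last first.
  by apply/seteqP; split=> x /=; tauto.
apply: compact_setX; first exact: compact_shift_space.
by apply: (subclosed_compact fiber_attractor_closed (@compact_circle R)).
Qed.

Lemma level_closed n : closed (level n).
Proof. exact: (compact_closed phase_space_hausdorff (@level_compact n)). Qed.

Lemma attractor_closed : closed attractor.
Proof. by apply: closed_bigI => n _; exact: level_closed. Qed.

Lemma iter_skew2 n x : (iter n F x).2 = act phi (word n x.1) x.2.
Proof. by case: x => w p; rewrite iter_skew. Qed.

Lemma level_le m n : (m <= n)%N -> level n `<=` level m.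
Proof.
move=> mn _ [x /= Kx <-]; exists (iter (n - m) F x); last by rewrite -iterD subnKC.
by rewrite /= iter_skew2; exact: fiber_attractor_act.
Qed.

Lemma attractor_invariant : F @` attractor `<=` attractor.
Proof.
move=> _ [x Ax <-] n _; have [y Ky <-] := Ax n I.
by apply: (@level_le n n.+1) => //; exists y.
Qed.

Lemma attractor_iter n x : attractor x -> attractor (iter n F x).
Proof.
by move=> Ax; elim: n => //= n ih; apply: attractor_invariant; exists (iter n F x).
Qed.

(** Points outside [U] chosen in every level would have a cluster point, which lies in all the
    levels because they are closed and decreasing. *)
Lemma level_in_nbhs (U : set X) : open U -> attractor `<=` U -> exists n, level n `<=` U.
Proof.
move=> oU AU; apply: contrapT => nU.
have H n : exists x, level n x /\ ~ U x.
  apply: contrapT => h; apply: nU; exists n => x xn.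
  by apply: contrapT => nUx; apply: h; exists x.
pose u n := sval (cid (H n)).
have uP n : level n (u n) /\ ~ U (u n) by rewrite /u; case: cid.
have PF : ProperFilter (u @ \oo) by exact: fmap_proper_filter.
have [x [_ xu]] := compact_phase_space PF filterT.
have cl (B : set X) : closed B -> (\forall n \near \oo, B (u n)) -> B x.
  move=> cB Bu; apply: cB => V xV.
  exact: (xu B V Bu xV).
have Ux : ~ U x by apply: (cl (~` U)); [exact: open_closedC|near=> n; exact: (uP n).2].
apply: Ux; apply: AU => n _; apply: (cl (level n)); first exact: level_closed.
near=> m; apply: (@level_le n m); first by near: m; exists n.
exact: (uP m).1.
Unshelve. all: by end_near. Qed.

(** Being near the attractor depends on the past as well as on the fiber coordinate. The last n
    steps supply that past: from a fiber coordinate in [W] they lead into [U] whatever the base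
    point. The first n steps are controlled by continuity. *)
Lemma attractor_lyapunov : lyapunov_stable F attractor.
Proof.
split; [exact: attractor_closed|exact: attractor_invariant|].
move=> U AU.
have AU' : attractor `<=` U°.
  by move=> x Ax; exact: (AU x Ax).
have [n nU] := level_in_nbhs (@open_interior _ U) AU'.
pose W := [set p | forall w, U° (iter n F (w, p))].
have KW : fiber_attractor `<=` W°.
  move=> p Kp.
  have h w : [set: Sigma] w -> \forall w' \near w & q \near p, U° (iter n F (w', q)).
    move=> _; have : U° (iter n F (w, p)) by apply: nU; exists (w, p).
    move=> /nbhs_interior/(@iter_skew_continuous n (w, p)) [[B C] /= [wB pC] BC].
    by exists (B, C) => //= -[w' q] [/= Bw Cq]; exact: (BC (w', q)).
  have := @near_forall_compact Sigma S1 setT p (fun q w => U° (iter n F (w, q)))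
    (@compact_shift_space R s hs) h.
  by apply: filterS => q hq w; exact: hq.
have [V [oV KV VW]] := fiber_attractor_stable (@open_interior _ W) KW.
exists ([set x | V x.2] `&` [set x | forall m : 'I_n, U° (iter m F x)]); split.
- move=> x Ax; apply: filterI.
    have : nbhs x.2 V.
      by apply: open_nbhs_nbhs; split=> //; apply: KV; have [y Ky <-] := Ax 0%N I.
    by move=> h; exists (setT, V) => /=; [split=> //; exact: filterT|move=> y []].
  apply: (@filter_forall _ _ (fun (m : 'I_n) x => U° (iter m F x)) (nbhs x)) => m.
  have /nbhs_interior : U° (iter m F x) by apply: AU'; exact: attractor_iter.
  exact: iter_skew_continuous.
(* Time 0 is among the finitely many controlled times unless n = 0, and then [W] itself controls
   it. *)
- move=> x [Vx hx]; have [n0|n0] := posnP n.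
    have := interior_subset (VW [::] x.2 Vx); move=> /(_ x.1).
    by rewrite n0 /= -surjective_pairing => /interior_subset.
  exact: (interior_subset (hx (Ordinal n0))).
move=> x m [Vx hx]; have [mn|nm] := ltnP m n.
  exact: (interior_subset (hx (Ordinal mn))).
rewrite -(subnKC nm) iterD; apply: interior_subset.
have := interior_subset (VW (word (m - n) x.1) x.2 Vx).
rewrite -iter_skew2 => /(_ (iter (m - n) F x).1).
by rewrite -surjective_pairing.
Qed.

End attractor.
End skew_dynamics.

(** * Almost every orbit *)

Section product_null_sets.
Context d1 d2 (T1 : measurableType d1) (T2 : measurableType d2) (R : realType).
Variable m1 : {sigma_finite_measure set T1 -> \bar R}.
Variable m2 : {sigma_finite_measure set T2 -> \bar R}.
Variable N : set (T1 * T2).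
Hypothesis mN : measurable N.

(** Uniqueness of the product measure exchanges the order of integration. Sections at a fixed second
    coordinate are needed because [block_frequency] fixes the point of the fiber. *)
Lemma product_measure_swap : ((m1 \x m2) N = \int[m2]_y m1 (ysection N y))%E.
Proof.
rewrite -[RHS]/((m1 \x^ m2)%E N).
by apply: product_measure_unique => //= ? ? ? ?; rewrite product_measure2E.
Qed.

Lemma null_sections : ((m1 \x m2) N = 0)%E -> {ae m2, forall y, m1 (ysection N y) = 0%E}.
Proof.
rewrite product_measure_swap => h.
have := (ae_eq_integral_abs m2 measurableT (measurable_fun_ysection m1 mN)).1.
rewrite (_ : \int[m2]_x `|_| = 0)%E; last first.
  by rewrite -[RHS]h; apply: eq_integral => y _; rewrite gee0_abs.
by move=> /(_ erefl); apply: filterS => y /(_ I).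
Qed.

Lemma null_of_sections : (forall y, m1 (ysection N y) = 0%E) -> ((m1 \x m2) N = 0)%E.
Proof. by move=> h; rewrite product_measure_swap integral0_eq. Qed.

End product_null_sets.

Section limit_sets.
Context (R : realType) (s : nat) (hs : (2 <= s)%N).
Local Notation Sigma := (shift_space R hs).
Local Notation S1 := (circle R).
Local Notation X := (Sigma * S1)%type.
Local Notation mu := (bernoulli_measure R hs).
Local Notation lambda := (circle_lebesgue R).

Lemma open_measurable_circle (V : set S1) : open V -> measurable V.
Proof. by move=> oV; exact: sub_sigma_algebra. Qed.

Lemma ae_circle_open (V : set S1) (P : S1 -> Prop) : open V -> V !=set0 ->
  {ae lambda, forall p, P p} -> exists2 p, V p & P p.
Proof.
move=> oV [p Vp] [N [mN N0 PN]]; apply: contrapT => nP.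
have VN : V `<=` N by move=> q Vq; apply: PN => /= Pq; apply: nP; exists q.
have : nbhs (circle_val p) (@to_circle R @^-1` V).
  by apply: continuous_to_circle; rewrite to_circle_val; exact: open_nbhs_nbhs.
move=> /nbhs_ballP[d /= d0 hd].
(* The measure lives on the representatives in [0, 1), so the interval is taken to the right of [x]
   and cut at 1. *)
pose x := circle_val p; pose y := Num.min (x + d) 1.
have /andP[x0 x1] := circle_valP p.
have xy : x < y by rewrite lt_min ltrDl d0.
have I01 : `[x, y[%classic `<=` @to_circle R @^-1` N `&` `[0, 1[%classic.
  move=> z /=; rewrite !in_itv /= lt_min => /and3P[z1 z2 z3]; split.
    by apply: VN; apply: hd; rewrite /ball /= ltr_norml; apply/andP; split; rewrite -/x; lra.
  by rewrite z3 andbT (le_trans x0).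
have := N0; rewrite /circle_lebesgue /= /distribution /pushforward /lebesgue01 /mrestr => N0'.
have mpre : measurable (@to_circle R @^-1` N : set (measurableTypeR R)).
  by rewrite -[X in measurable X]setTI; exact: measurable_to_circle.
have : (@lebesgue_measure R `[x, y[%classic <= 0)%E.
  rewrite -N0'; apply: le_measure => //; rewrite inE; first exact: measurable_itv.
  by apply: measurableI => //; exact: measurable_itv.
by rewrite lebesgue_measure_itv /= lte_fin xy -EFinD lee_fin subr_le0 leNgt xy.
Qed.

Lemma word_take t n (w : Sigma) : (t <= n)%N -> word t w = take t (word n w).
Proof.
by move=> tn; rewrite -(subnKC tn) word_add take_size_cat ?size_word.
Qed.

Variable phi : 'I_s -> S1 -> S1.
Hypothesis phi_cont : forall i, continuous (phi i).
Hypothesis phi_inj : forall i, injective (phi i).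
Local Notation F := (@step_skew R s hs S1 phi).

(** Otherwise there are at most [n0] visits in all, and their proportion tends to 0. *)
Lemma frequency_visit x (T : set X) n0 : (0 < frequency R F x T)%E ->
  exists2 t, (n0 <= t)%N & T (iter t F x).
Proof.
move=> f0; apply: contrapT => nT.
have visits_le N : (visits phi N x T <= n0)%N.
  have -> : visits phi N x T = visits phi (minn n0 N) x T.
    have [nN|Nn] := leqP n0 N; last by [].
    rewrite -(subnKC nN) visits_add /visits [X in (_ + X)%N]big1 ?addn0// => t _.
    case: asboolP => //; rewrite -iterD => Tt; exfalso; apply: nT.
    by exists (t + n0)%N => //; exact: leq_addl.
  apply: leq_trans (geq_minl n0 N).
  apply: (@leq_trans (\sum_(0 <= t < minn n0 N) 1)).
    by apply: leq_sum => t _; exact: leq_b1.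
  by rewrite sum_nat_const_nat muln1 subn0.
move: f0; apply/negP; rewrite -leNgt /frequency limn_esup_lim.
apply/lee_addgt0Pr => e e0; rewrite add0e; apply: lime_le; first exact: is_cvg_esups.
near=> n.
have n_gt0 : (0 < n)%N by near: n; exists 1%N.
apply: ge_ereal_sup => _ [m /= nm <-]; rewrite card_visits lee_fin.
have m0 : 0 < m%:R :> R by rewrite ltr0n (leq_trans n_gt0).
rewrite ler_pdivrMr//; apply: (@le_trans _ _ n0%:R); first by rewrite ler_nat.
rewrite -ler_pdivrMl//; apply: (@le_trans _ _ n%:R); last by rewrite ler_nat.
near: n; exists (Num.truncn (e^-1 * n0%:R)).+1 => // k /= hk.
by apply: ltW; apply: lt_le_trans (truncnS_gt _) _; rewrite ler_nat.
Unshelve. all: by end_near. Qed.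

Lemma omega_stat_sub x : omega_stat R F x `<=` omega_limit F x.
Proof.
move=> z zx B C [n0 _ hB] zC; have [t n0t Ct] := frequency_visit n0 (zx C zC).
by exists (iter t F x); split=> //; exact: hB.
Qed.

Variable A : seq S1.
Hypothesis A_reach : forall p, exists2 a, a \in A & orbit_closure phi p a.
Hypothesis A_basin : forall a, a \in A -> nbhs a [set q | orbit_closure phi q a].
Hypothesis A_stable : forall a, a \in A -> stable_orbit phi a.

Local Notation K := (fiber_attractor phi A).

Lemma measurable_visit (V : set S1) t : open V -> measurable [set x : X | V (iter t F x).2].
Proof.
move=> oV.
rewrite (_ : [set _ | _] = \bigcup_(v in [set: t.-tuple 'I_s])
    ([set w : Sigma | word (size v) w = v] `*` (act phi v @^-1` V))).
  apply: fin_bigcup_measurable; first exact: finite_finset.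
  move=> v _; apply: measurableX; first exact: measurable_cylinder.
  apply: open_measurable_circle; apply: open_comp => // p _.
  exact: act_continuous.
apply/seteqP; split=> [[w p]|[w p] [v _ [/= wv Vp]]]; rewrite /= iter_skew2 /=.
  move=> Vp; exists (Tuple (introT eqP (size_word t w))) => //=.
  by rewrite size_word.
by move: wv Vp; rewrite size_tuple => <-.
Qed.

Lemma ae_visit (V : set S1) : open V -> K `<=` V ->
  {ae @mu_X R s hs, forall x, exists t, V (iter t F x).2}.
Proof.
move=> oV KV; pose N := \bigcap_t ~` [set x : X | V (iter t F x).2].
have mN : measurable N.
  by apply: bigcapT_measurable => t; apply: measurableC; exact: measurable_visit.
exists N; split=> //; last first.
  by move=> x /= nV t _ /= Vt; apply: nV; exists t.
apply: null_of_sections => // p.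
have hV q : [set: S1] q -> exists u, V (act phi u q).
  move=> _; have [a ta qa] := terminal_reach phi_cont A_reach q.
  apply: (orbit_closure_reach qa); apply: open_nbhs_nbhs; split=> //; apply: KV.
  by exists a => //; exact: orbit_closure_refl.
have [n hn] := uniform_reach phi_cont (@compact_circle R) oV hV.
(* Words are padded to the common length n + 1, one more than the bound n, since the visit at time
   [size u] must occur before the block ends. *)
have hu q : exists u, size u = n.+1 /\ exists2 t, (t < n.+1)%N & V (act phi (take t u) q).
  have [u un Vu] := hn q I.
  exists (u ++ nseq (n.+1 - size u) (Ordinal (ltnW hs))); split.
    by rewrite size_cat size_nseq subnKC// ltnW.
  by exists (size u) => //; rewrite take_size_cat.
pose u q := sval (cid (hu q)).
have uP q : size (u q) = n.+1 /\ exists2 t, (t < n.+1)%N & V (act phi (take t (u q)) q).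
  by rewrite /u; case: cid.
have := @block_frequency R s hs S1 phi setT n.+1 u [set x | V x.2] (fun _ _ _ => I)
  (fun q _ => (uP q).1) _ p isT I.
case=> [q w _ wu|B [mB B0 hB]].
  have [t tn Vt] := (uP q).2; exists t => //.
  by rewrite /= iter_skew2 /= (word_take _ (ltnW tn)) wu.
apply/eqP; rewrite -measure_le0 -B0; apply: le_measure; rewrite ?inE//.
  exact: measurable_ysection.
move=> w; rewrite /ysection /= inE => Nw; apply: hB => /= /(frequency_visit 0)[t _ Vt].
exact: (Nw t I).
Qed.

Lemma iter_skew_inj n : injective (iter n F).
Proof.
have FI : injective F.
  move=> [w p] [v q]; rewrite /step_skew /= => -[/= wv pq].
  have E : w = v.
    apply/funext => j; have := congr1 (fun h : Sigma => h (j - 1)) wv.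
    by rewrite /bernoulli_shift subrK.
  by rewrite E in pq *; rewrite (phi_inj pq).
by elim: n => [|n ih] x y //; rewrite !iterS => /FI/ih.
Qed.

(** A limit point has, for every n, an n-th preimage with fiber coordinate in the closure of each
    neighbourhood [U l] of [K]. Injectivity of [F] makes it the same preimage for all l, so its
    fiber coordinate lies in [K]. *)
Lemma ae_omega_limit : {ae @mu_X R s hs, forall x, omega_limit F x `<=` @attractor R s hs phi A}.
Proof.
pose U (l : nat) := [set p : S1 | exists2 q, K q & mdist p q < l.+1%:R^-1].
have oU l : open (U l).
  rewrite openE => p [q Kq pq]; apply/nbhs_ballP.
  exists (l.+1%:R^-1 - mdist p q); first by rewrite /= subr_gt0.
  move=> p'; rewrite ballEmdist /= => pp'; exists q => //.
  by apply: le_lt_trans (metric_triangle _ p _) _; rewrite metric_sym -ltrBrDr.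
have KU l : K `<=` U l by move=> p Kp; exists p => //; rewrite mdistxx invr_gt0.
have H l := cid (fiber_attractor_stable A_stable (oU l) (KU l)).
have : {ae @mu_X R s hs, forall x, forall l, exists t, (sval (H l)) (iter t F x).2}.
  by apply: ae_foralln => l; case: (H l) => V [oV KV _] /=; exact: ae_visit.
apply: filterS => x hx z zx.
have cl (C : set X) : closed C -> (\forall t \near \oo, C (iter t F x)) -> C z.
  by move=> cC Cx; apply: cC => V zV; exact: zx Cx zV.
have evU l : \forall t \near \oo, U l (iter t F x).2.
  have [t] := hx l; case: (H l) => V [oV KV VU] /= Vt.
  exists t => // t' /= tt'; rewrite -(subnK tt') iterD iter_skew2; exact: VU.
pose C l n := iter n F @` [set y : X | closure (U l) y.2].
have Cz l n : C l n z.
  apply: cl.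
    apply: (compact_closed (@phase_space_hausdorff R s hs)).
    apply: continuous_compact.
      by apply: continuous_subspaceT; exact: iter_skew_continuous.
    rewrite (_ : [set y | _] = setT `*` closure (U l)); last first.
      by apply/seteqP; split=> y /=; tauto.
    apply: compact_setX; first exact: compact_shift_space.
    apply: (subclosed_compact _ (@compact_circle R)) => //; exact: closed_closure.
  have [t _ ht] := evU l; exists (t + n)%N => // t' /= tt'.
  exists (iter (t' - n) F x) => /=.
    by apply: subset_closure; apply: ht => /=; lia.
  by rewrite -iterD subnKC//; lia.
move=> n _; have [y _ yz] := Cz 0%N n; exists y => //=.
apply: fiber_attractor_closed => W /nbhs_ballP[e /= e0 eW].
have [l le] : exists l : nat, l.+1%:R^-1 < e / 2.
  exists (Num.truncn (e / 2)^-1); rewrite invf_plt ?posrE ?divr_gt0//.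
  exact: truncnS_gt.
have [y' Uy' y'z] := Cz l n.
have yy' : y' = y by apply: (@iter_skew_inj n); rewrite y'z yz.
have e20 : 0 < e / 2 by rewrite divr_gt0.
have [p [[q Kq pq] yp]] := Uy' _ (nbhsx_ballx y'.2 (e / 2) e20).
exists q; split=> //; apply: eW; rewrite ballEmdist /=.
rewrite ballEmdist /= yy' in yp; apply: le_lt_trans (metric_triangle _ p _) _.
by rewrite (splitr e) ltrD// (lt_trans pq).
Qed.

(** A priori the orbit closure containing the n-th preimage depends on n. If each of the finitely
    many [a] failed at some [k a], the largest of these numbers would give a contradiction, since
    moving forward stays in the same orbit closure. *)
Lemma attractor_minimal_point z : @attractor R s hs phi A z ->
  exists2 a, terminal phi A a & forall n, exists y : X, orbit_closure phi a y.2 /\ iter n F y = z.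
Proof.
move=> Az; apply: contrapT => H.
have nH a : terminal phi A a -> exists n, ~ exists y : X, orbit_closure phi a y.2 /\ iter n F y = z.
  move=> ta; apply: contrapT => h; apply: H; exists a => // n.
  by apply: contrapT => h'; apply: h; exists n.
pose k a := if pselect (terminal phi A a) is left ta then sval (cid (nH a ta)) else 0%N.
pose n := \max_(a <- A) k a.
have [y [a ta ay] yz] := Az n I.
have kn : (k a <= n)%N by apply: leq_bigmax_seq => //; exact: ta.1.
have : ~ exists y : X, orbit_closure phi a y.2 /\ iter (k a) F y = z.
  by rewrite /k; case: pselect => // ta'; case: cid.
apply; exists (iter (n - k a) F y); split; last by rewrite -iterD subnKC.
by rewrite iter_skew2; exact: orbit_closure_act.
Qed.

End limit_sets.

(** * The attractor lies in the statistical attractor *)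

Section lower_bound.
Context (R : realType) (s : nat) (hs : (2 <= s)%N).
Local Notation Sigma := (shift_space R hs).
Local Notation S1 := (circle R).
Local Notation X := (Sigma * S1)%type.
Local Notation mu := (bernoulli_measure R hs).
Variable phi : 'I_s -> S1 -> S1.
Hypothesis phi_cont : forall i, continuous (phi i).
Local Notation F := (@step_skew R s hs S1 phi).

Lemma visits_le N x (T U : set X) : T `<=` U -> (visits phi N x T <= visits phi N x U)%N.
Proof.
move=> TU; apply: leq_sum => t _; case: asboolP => [/TU Ut|//].
by case: asboolP.
Qed.

Lemma frequency_le x (T U : set X) : T `<=` U -> (frequency R F x T <= frequency R F x U)%E.
Proof.
move=> TU; rewrite /frequency !limn_esup_lim; apply: lee_lim; [exact: is_cvg_esups|exact: is_cvg_esups|].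
apply: nearW => n; apply: ge_ereal_sup => _ [m /= nm <-].
apply: (@le_trans _ _ ((#|[pred t : 'I_m | `[< U (iter t F x) >]]|%:R / m%:R)%:E)).
  by rewrite !card_visits lee_fin ler_wpM2r// ler_nat visits_le.
by apply: ereal_sup_ubound; exists m.
Qed.

Lemma open_reach_within n (G : set S1) : open G ->
  open [set q | exists2 u, (size u <= n)%N & G (act phi u q)].
Proof.
move=> oG; rewrite openE => q [u un Gu].
have : nbhs q (act phi u @^-1` G) by apply: act_continuous => //; exact: open_nbhs_nbhs.
by apply: filterS => t Gt; exists u.
Qed.

Lemma open_mdist (p : S1) (e : R) : open [set q | mdist p q < e].
Proof.
rewrite openE => q pq; apply/nbhs_ballP; exists (e - mdist p q); first by rewrite /= subr_gt0.
move=> t; rewrite ballEmdist /= => qt.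
by apply: le_lt_trans (metric_triangle _ q _) _; rewrite -ltrBrDl.
Qed.

Lemma closed_mdist (p : S1) (e : R) : closed [set q | mdist p q <= e].
Proof.
rewrite (_ : [set _ | _] = ~` [set q | e < mdist p q]); last first.
  by apply/seteqP; split=> q /=; [move=> h; apply/negP; rewrite -leNgt|move/negP; rewrite -leNgt].
apply: open_closedC; rewrite openE => q pq; apply/nbhs_ballP.
exists (mdist p q - e); first by rewrite /= subr_gt0.
move=> t; rewrite ballEmdist /= metric_sym => qt.
by have := metric_triangle p t q; lra.
Qed.

Variable A : seq S1.
Hypothesis A_reach : forall p, exists2 a, a \in A & orbit_closure phi p a.
Hypothesis A_basin : forall a, a \in A -> nbhs a [set q | orbit_closure phi q a].
Hypothesis A_stable : forall a, a \in A -> stable_orbit phi a.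

(** Some b in [A] is reached from [p], hence from [a]; as [a] is terminal, b reaches it back. *)
Lemma terminal_orbit_closure a p : terminal phi A a -> orbit_closure phi a p ->
  orbit_closure phi p a.
Proof.
move=> ta ap; have [b bA pb] := A_reach p.
apply: (orbit_closure_trans phi_cont pb); apply: ta.2 => //.
exact: (orbit_closure_trans phi_cont ap pb).
Qed.

Definition target (z : X) m : set X :=
  [set x | agree m z.1 x.1 /\ mdist z.2 x.2 < m.+1%:R^-1].

Lemma target_sub z U : nbhs z U -> exists m, target z m `<=` U.
Proof.
move=> /nbhs_cylinderP[m [N [/nbhs_ballP[e /= e0 eN] h]]].
exists (maxn m (Num.truncn e^-1)) => x [zx zx2]; apply: h => [j jm|].
  by apply: zx; rewrite leq_max jm.
apply: eN; rewrite ballEmdist /=; apply: lt_trans zx2 _.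
rewrite invf_plt ?posrE//; apply: lt_le_trans (truncnS_gt _) _.
by rewrite ler_nat ltnS leq_maxr.
Qed.

(* From any point near a terminal orbit closure, some word of bounded length
   leads into the basin of [a]; a second one leads to the neighbourhood of the
   fiber coordinate [y.2]; the word read along the orbit of [y] then leads to
   the target. *)
Lemma target_word a z m n1 e : (forall n, exists y : X, orbit_closure phi a y.2 /\ iter n F y = z) ->
  (forall q, mdist a q <= e -> orbit_closure phi q a) ->
  exists2 L, (0 < L)%N & forall q,
    (exists2 u, (size u <= n1)%N & mdist a (act phi u q) < e) ->
    exists u, size u = L /\ forall w : Sigma, word L w = u ->
      exists2 t, (t < L)%N & target z m (iter t F (w, q)).
Proof.
move=> lev he; have [y [ay yz]] := lev m.
pose v := word m y.1.
pose G2 := act phi v @^-1` [set p | mdist z.2 p < m.+1%:R^-1].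
have oG2 : open G2.
  by apply: open_comp => [p _|]; [exact: act_continuous|exact: open_mdist].
have [n2 hn2] : exists N, forall q, [set q | mdist a q <= e] q ->
    exists2 u, (size u <= N)%N & G2 (act phi u q).
  apply: uniform_reach => // [|q /he qa].
    by apply: (subclosed_compact (closed_mdist (p := a) (e := e)) (@compact_circle R)).
  apply: (orbit_closure_reach (orbit_closure_trans phi_cont qa ay)).
  apply: open_nbhs_nbhs; split=> //=.
  by rewrite /G2 /= -iter_skew2 yz mdistxx invr_gt0.
(* The two connecting words take at most [n1 + n2] letters. Then the first 2m + 1 letters of [y] are
   read: m steps into them they occupy the coordinates -m, ..., m, as in [z]. Padding comes last. *)
pose L := (n1 + n2 + m.*2.+1)%N.
exists L; first by rewrite /L addnS.
move=> q [u1 u1n /ltW au1]; have [u2 u2n Gu2] := hn2 _ au1.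
pose u := u1 ++ u2; have un : (size u <= n1 + n2)%N by rewrite size_cat leq_add.
pose full := u ++ (word m.*2.+1 y.1 ++ nseq (n1 + n2 - size u) (Ordinal (ltnW hs))).
have sfull : size full = L.
  by rewrite !size_cat size_word size_nseq -size_cat -/u /L; lia.
exists full; split=> // w wf; exists (size u + m)%N; first by rewrite /L; lia.
have wk := (word_eqP _ sfull).1 wf.
have zE : z.1 = (fun j => y.1 (j + m%:Z)).
  by rewrite -yz; case: (y) => y1 y2; rewrite iter_skew.
split.
  move=> j jm; rewrite iter_skew /= zE.
  have [i [iE i2]] : exists i : nat, j + m%:Z = i%:Z /\ (i < m.*2.+1)%N.
    by exists (absz (j + m%:Z)); lia.
  have kL : (size u + i < L)%N by rewrite /L; lia.
  have -> : j + (size u + m)%N%:Z = (size u + i)%N%:Z by lia.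
  rewrite (wk (Ordinal kL)) [nat_of_ord _]/= /full nth_cat ifF; last by lia.
  by rewrite addKn nth_cat size_word i2 nth_mkseq// iE.
have -> : (iter (size u + m) F (w, q)).2 = act phi v (act phi (u1 ++ u2) q).
  rewrite iter_skew2 /= (@word_take _ _ _ _ L) ?wf; last by rewrite /L; lia.
  rewrite /full takeD take_size_cat// drop_size_cat// act_cat.
  rewrite take_cat size_word ifT; last by lia.
  by rewrite -(@word_take _ _ _ m)//; lia.
by rewrite act_cat.
Qed.

(** A closed set competing in the definition may miss a null set of points. By Fubini some fiber
    point near the orbit closure of [a] is admissible with almost every base point, and almost every
    base point visits all targets with positive frequency. *)
Lemma attractor_sub_statistical : @attractor R s hs phi A `<=` statistical_attractor F.
Proof.
move=> z Az B [cB [N [mN N0 hN]]].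
have [a ta lev] := attractor_minimal_point phi_cont Az.
have [e e0 he] : exists2 e, 0 < e & forall q, mdist a q <= e -> orbit_closure phi q a.
  have /nbhs_ballP[e /= e0 he] := A_basin ta.1.
  exists (e / 2) => [|q aq]; first by rewrite divr_gt0.
  apply: he; rewrite ballEmdist /=; lra.
pose G := [set q | mdist a q < e].
have oG : open G by exact: open_mdist.
have [n1 hn1] : exists N, forall q, orbit_closure phi a q -> exists2 u, (size u <= N)%N & G (act phi u q).
  apply: uniform_reach => // [|q aq].
    apply: (subclosed_compact _ (@compact_circle R)) => //; exact: closed_closure.
  apply: (orbit_closure_reach (terminal_orbit_closure ta aq)).
  by apply: open_nbhs_nbhs; split=> //; rewrite /G /= mdistxx.
have [V [oV aV VG]] := A_stable ta.1 (@open_reach_within n1 G oG) hn1.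
(* [block_frequency] needs a set invariant under all the maps. [V] need not be one; the points all
   of whose images reach [G] within [n1] letters form one containing it. *)
pose Vh := [set q | forall u, exists2 u', (size u' <= n1)%N & G (act phi u' (act phi u q))].
have Vh_inv i q : Vh q -> Vh (phi i q) by move=> hq u; exact: (hq (i :: u)).
have VVh : V `<=` Vh by move=> q Vq u; exact: VG.
have V0 : V !=set0 by exists a; apply: aV; exact: orbit_closure_refl.
have [p Vp p0] := ae_circle_open oV V0 (null_sections mN N0).
have freq m : {ae mu, forall w, (0 < frequency R F (w, p) (target z m))%E}.
  have [L L0 hL] := target_word m n1 lev he.
  have hu q : exists u, Vh q -> size u = L /\ forall w : Sigma, word L w = u ->
      exists2 t, (t < L)%N & target z m (iter t F (w, q)).
    have [hq|nq] := pselect (Vh q); last by exists [::].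
    by have [u hu] := hL q (hq [::]); exists u.
  pose u q := sval (cid (hu q)).
  have uP q : Vh q -> size (u q) = L /\ forall w : Sigma, word L w = u q ->
      exists2 t, (t < L)%N & target z m (iter t F (w, q)).
    by rewrite /u; case: cid.
  apply: (@block_frequency R s hs S1 phi Vh L u) => //.
  - by move=> q /uP[].
  - by move=> q w /uP[_]; exact.
  - exact: VVh.
have [w [wN wz]] : exists w, ~ N (w, p) /\ forall m, (0 < frequency R F (w, p) (target z m))%E.
  apply: contrapT => H.
  have : mu.-negligible [set: Sigma].
    have h1 : mu.-negligible (ysection N p) by exists (ysection N p); split=> //; exact: measurable_ysection.
    have h2 : {ae mu, forall w, forall m, (0 < frequency R F (w, p) (target z m))%E}.
      exact: ae_foralln.
    apply: (@negligibleS _ _ _ _ _ _ _ (negligibleU h1 h2)) => w _ /=.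
    have [Nw|Nw] := pselect (N (w, p)); first by left; rewrite /ysection /= inE.
    by right => wz; apply: H; exists w.
  move=> /(negligibleP _ (@measurableT _ Sigma)) T0.
  have := @probability_setT _ _ _ mu; rewrite T0 => h.
  by have := @lte01 R; rewrite -h ltxx.
have : [set x | omega_stat R F x `<=` B] (w, p) by apply: contrapT => nB; apply: wN; exact: hN.
apply=> U zU; have [m mU] := target_sub zU.
exact: lt_le_trans (wz m) (frequency_le _ mU).
Qed.

Hypothesis phi_inj : forall i, injective (phi i).

Lemma statistical_eq_attractor : statistical_attractor F = @attractor R s hs phi A /\
  milnor_attractor F = @attractor R s hs phi A.
Proof.
have h1 : milnor_attractor F `<=` @attractor R s hs phi A.
  apply: bigcap_inf; split; first exact: attractor_closed.
  exact: (@ae_omega_limit R s hs phi phi_cont phi_inj A A_reach A_stable).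
have h2 : statistical_attractor F `<=` milnor_attractor F.
  move=> z zs B [cB LB]; apply: zs; split=> //.
  by apply: filterS LB => x hx t /omega_stat_sub/hx.
have h3 := attractor_sub_statistical.
split; apply/seteqP; split=> //; first exact: subset_trans h2 h1.
exact: subset_trans h3 h2.
Qed.

End lower_bound.

Theorem theorem5p1 (R : realType) (r s : nat) (hr : (1 <= r)%N)
    (hs : (2 <= s)%N) :
  exists2 A : set (step_skew_products R r s), residual A &
    forall f : step_skew_products R r s, A f ->
      lyapunov_stable (skew_product hs f)
        (statistical_attractor (skew_product hs f)) /\
      statistical_attractor (skew_product hs f) =
        milnor_attractor (skew_product hs f).
Proof.
pose i0 : 'I_s := Ordinal (ltnW hs).
exists (generic i0).
  by apply: generic_residual => //; exists (Ordinal hs).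
move=> f gf; have [A [A_reach A_good]] := generic_finitely_attracted hr gf.
have A_stable a (aA : a \in A) := (A_good a aA).2.
have A_basin a (aA : a \in A) := (A_good a aA).1.
have cphi i : continuous (maps f i) := @Diff_continuous R r (f i).
have phi_inj i : injective (maps f i) := @diff_inj R r (f i).
have [e1 e2] := statistical_eq_attractor hs cphi A_reach A_basin A_stable phi_inj.
have -> : skew_product hs f = @step_skew R s hs (circle R) (maps f) by [].
rewrite e2 e1; split=> //.
exact: (@attractor_lyapunov R s hs (maps f) cphi A A_stable).
Qed.
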